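(* Let $A_o,B_o\in M(n,\mathbb C)$ and let $\nabla^o$ be the meromorphic connection on the trivial rank $n$ bundle $E^o\to\mathbb P^1$ with matrix of connection 1-forms $\Omega_o=-\left(A_o+\frac1zB_o\right)\mathrm dz$. (1) The classes $\mathfrak I_{\rm d}(\nabla^o)$, $\mathfrak I_{\rm dv}(\nabla^o)$ and $\mathfrak I_{\rm fs}(\nabla^o)$ are closed under arbitrary base changes $\phi\colon (X,x_o)\to(X',x_o')$ of the deformation parameter spaces (pull-back along $\phi$). (2) We have $$\mathfrak I_{\rm fs}(\nabla^o)\subseteq \mathfrak I_{\rm dv}(\nabla^o),\qquad \mathfrak I^{\rm gen}_{\rm d}(\nabla^o)\subseteq \mathfrak I_{\rm dv}(\nabla^o),\qquad \mathfrak I_{\rm dv}(\nabla^o)\subseteq \mathfrak I_{\rm d}(\nabla^o)\subseteq \mathfrak I(\nabla^o).$$ (3) If $A_o\in\mathcal M_{\rm reg}\cap\mathcal M_{\rm diag}$, then $$\mathfrak I_{\rm fs}(\nabla^o)=\mathfrak I_{\rm dv}(\nabla^o)=\mathfrak I_{\rm d}(\nabla^o)=\mathfrak I(\nabla^o).$$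
   Context: Conventions. A connection with matrix of connection 1-forms $\Omega$ in a basis of sections is $\nabla=\mathrm d+\Omega$; a change of basis $G$ replaces $\Omega$ by $G^{-1}\Omega G+G^{-1}\mathrm dG$. For a square matrix $M$, $M'$ is its diagonal part and $M''=M-M'$ its off-diagonal part. $\mathcal M_{\rm reg}\subset M(n,\mathbb C)$ is the set of regular matrices (minimal polynomial equal to characteristic polynomial) and $\mathcal M_{\rm diag}$ the set of diagonalizable matrices. Integrable deformations. An integrable deformation $(\nabla,E,X,x_o)$ of $(E^o,\nabla^o)$ consists of a connected complex manifold $X$, a point $x_o\in X$, a holomorphic vector bundle $E$ on $D\times X$ ($D\subseteq\mathbb P^1$ a disc centered at $z=\infty$), and a flat meromorphic connection $\nabla$ on $E$ with a pole of order 2 along $\{\infty\}\times X$, such that $(E,\nabla)$ restricts to $(E^o,\nabla^o)$ at $x_o$. It is a known fact that, if $X$ is simply connected (always the case after shrinking $X$), there are an analytic hypersurface $\Theta\subseteq X\setminus\{x_o\}$ and a unique basis of sections (meromorphic along $D\times \Theta$) with respect to which $\nabla$ has matrix $$\Omega(z,x)=-\left(A(x)+\tfrac1zB_o\right)\mathrm dz-z\,C(x),\qquad x\in X\setminus\Theta,$$ with $A$ a holomorphic matrix function and $C$ a matrix of holomorphic 1-forms on $X\setminus\Theta$ (meromorphic along $\Theta$), $A(x_o)=A_o$, $C(x_o)=0$. In this basis $E$ and $\nabla$ extend over $\mathbb P^1\times(X\setminus\Theta)$ (trivial bundle). $A$ is the pole part and $C$ the deformation part of $\nabla$. The integrability condition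 is: $\mathrm dC=0$, $C\wedge C=0$, $[A,C]=0$, $\mathrm dA=C+[C,B_o]$. Classes of germs (at the base point) of integrable deformations of $\nabla^o$: - $\mathfrak I(\nabla^o)$: all germs. - $\mathfrak I_{\rm d}(\nabla^o)$ (d-type): $A$ and $C$ are locally holomorphically diagonalizable at $x_o$ (i.e. conjugate to diagonal by a holomorphic invertible matrix defined near $x_o$). - $\mathfrak I_{\rm d}^{\rm gen}(\nabla^o)$ (generic d-type): d-type and, if $f_1,\dots,f_n$ are the holomorphic eigenvalues of $A$ near $x_o$, then $\mathrm d_{x_o}f_i\neq\mathrm d_{x_o}f_j$ for all $i\neq j$. - $\mathfrak I_{\rm dv}(\nabla^o)$ (dv-type): d-type and there are a neighborhood $U\subseteq X\setminus\Theta$ of $x_o$, a holomorphic off-diagonal matrix $\mathcal L\colon U\to M(n,\mathbb C)$ ($\mathcal L=\mathcal L''$), and a basis of holomorphic sections of $E|_{\mathbb P^1\times U}$ with respect to which $\nabla$ has matrix $$-\left(\Delta_0(x)+\tfrac1z\mathcal B(x)\right)\mathrm dz-z\,\mathrm d\Delta_0(x)+\varpi(x)$$ with $\Delta_0$ the holomorphic diagonal form of $A|_U$, $\mathcal B\colon U\to M(n,\mathbb C)$ holomorphic, $\varpi$ a matrix of holomorphic 1-forms on $U$, and $\mathcal B''=[\mathcal L,\Delta_0]$, $\varpi''=[\mathrm d\Delta_0,\mathcal L]$. - $\mathfrak I_{\rm fs}(\nabla^o)$ (fs-type): there are a neighborhood $U\subseteq X\setminus\Theta$ of $x_o$, holomorphic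 maps $\Phi_k\colon U\to M(n,\mathbb C)$, $k\geq0$, with $\Phi_0(U)\subseteq GL(n,\mathbb C)$, a holomorphic diagonal matrix $\Delta_0\colon U\to M(n,\mathbb C)$, and a constant diagonal matrix $\mathfrak B_o'$ such that the formal series $\Phi=\sum_{k\ge0}\Phi_kz^{-k}$ satisfies $\Phi^{-1}\Omega\Phi+\Phi^{-1}\mathrm d\Phi=-\mathrm d(z\Delta_0(x))-\mathfrak B_o'\frac{\mathrm dz}{z}$. *)

(* Defs.v *)
From HB Require Import structures.
From mathcomp Require Import all_boot all_order all_algebra.
From mathcomp Require Import complex.
From mathcomp Require Import all_classical all_reals all_analysis.

Set Implicit Arguments.
Unset Strict Implicit.
Unset Printing Implicit Defensive.

Import Order.TTheory GRing.Theory Num.Theory numFieldNormedType.Exports.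

Local Open Scope classical_set_scope.
Local Open Scope ring_scope.

(* Every definition below is meant for K := R[i] with R : realType.  It is    *)
(* stated over a numFieldType because the normed-module structure of a        *)
(* scalar field over itself is inferred in that generality; over R[i],        *)
(* [differentiable] is complex (Frechet) differentiability.                   *)

Definition holomorphic_on (K : numFieldType) (V W : normedModType K)
    (U : set V) (f : V -> W) : Prop :=
  forall x, U x -> differentiable f x.

Definition pd (K : numFieldType) (m : nat) (W : normedModType K)
    (k : 'I_m) (f : 'rV[K]_m -> W) (x : 'rV[K]_m) : W :=
  'D_(delta_mx 0 k) f x.

Definition lie (K : numFieldType) (n : nat) (M N : 'M[K]_n) : 'M[K]_n :=
  M *m N - N *m M.

Definition offdiag (K : numFieldType) (n : nat) (M : 'M[K]_n) : 'M[K]_n :=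
  \matrix_(i, j) (if i == j then 0 else M i j).

(* A germ of pointed complex manifold is (C^m, x_o).  A germ of integrable    *)
(* deformation of d - (A_o + z^-1 B_o) dz is recorded by its canonical form   *)
(*      Omega = - (A(x) + z^-1 B_o) dz - z C(x),                              *)
(* with A = [pole] and C = \sum_k [defo k] dx_k.  Only the germs of [pole]    *)
(* and [defo] at [base] matter: the predicates below only ever look at them   *)
(* on some unspecified open neighbourhood of [base].                          *)
Record deformation (K : numFieldType) (m n : nat) := Deformation {
  base : 'rV[K]_m;
  pole : 'rV[K]_m -> 'M[K]_n;
  defo : 'I_m -> 'rV[K]_m -> 'M[K]_n }.

(* The clauses on U are holomorphy of A and C and the integrability condition *)
(*   dC = 0,  C /\ C = 0,  [A, C] = 0,  dA = C + [C, B_o].                    *)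
(* The normalisation "C(x_o) = 0" says that the 1-form C restricts to zero on *)
(* the point {x_o}, i.e. that Omega restricts to Omega_o there; any 1-form    *)
(* does, so it gives no clause.  It does not mean that the components of C    *)
(* vanish at x_o: that would force d_{x_o} A = 0.                             *)
Definition I_all (K : numFieldType) (m n : nat) (Ao Bo : 'M[K]_n) :
    set (deformation K m n) :=
  [set T | pole T (base T) = Ao /\
    exists U : set 'rV[K]_m,
      [/\ open U, U (base T),
          holomorphic_on U (pole T),
          (forall k, holomorphic_on U (defo T k)) &
          forall x, U x ->
          [/\ (forall k l, pd k (defo T l) x = pd l (defo T k) x),
              (forall k l, defo T k x *m defo T l x = defo T l x *m defo T k x),
              (forall k, lie (pole T x) (defo T k x) = 0) &
              (forall k, pd k (pole T) x =
                         defo T k x + lie (defo T k x) Bo)]]].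

Definition hol_GL (K : numFieldType) (V : normedModType K) (n : nat)
    (U : set V) (G : V -> 'M[K]_n) : Prop :=
  holomorphic_on U G /\ forall x, U x -> G x \in unitmx.

(* One G diagonalizes all the members of the family M; this is used for a     *)
(* single matrix (J = unit) and for a matrix of 1-forms, whose diagonality is *)
(* that of all its components (J = 'I_m).                                     *)
Definition loc_hol_diagonalizable (K : numFieldType) (m n : nat) (J : Type)
    (M : J -> 'rV[K]_m -> 'M[K]_n) (xo : 'rV[K]_m) : Prop :=
  exists (U : set 'rV[K]_m) (G : 'rV[K]_m -> 'M[K]_n),
    [/\ open U, U xo, hol_GL U G &
        forall x j, U x -> is_diag_mx (invmx (G x) *m M j x *m G x)].

Definition I_d (K : numFieldType) (m n : nat) (Ao Bo : 'M[K]_n) :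
    set (deformation K m n) :=
  [set T | [/\ I_all Ao Bo T,
      loc_hol_diagonalizable (fun _ : unit => pole T) (base T) &
      loc_hol_diagonalizable (defo T) (base T)]].

Definition hol_diagonal_form (K : numFieldType) (m n : nat)
    (U : set 'rV[K]_m) (A Delta : 'rV[K]_m -> 'M[K]_n) : Prop :=
  [/\ holomorphic_on U Delta,
      (forall x, U x -> is_diag_mx (Delta x)) &
      exists G : 'rV[K]_m -> 'M[K]_n, hol_GL U G /\
        forall x, U x -> invmx (G x) *m A x *m G x = Delta x].

(* The f_i are the diagonal entries of a holomorphic diagonal form of A.      *)
Definition I_d_gen (K : numFieldType) (m n : nat) (Ao Bo : 'M[K]_n) :
    set (deformation K m n) :=
  [set T | I_d Ao Bo T /\
    exists (U : set 'rV[K]_m) (f : 'I_n -> 'rV[K]_m -> K),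
      [/\ open U, U (base T),
          (forall i, holomorphic_on U (f i)),
          hol_diagonal_form U (pole T) (fun x => diag_mx (\row_i f i x)) &
          forall i j, i != j ->
            ('d (f i) (base T) : 'rV[K]_m -> K) <> 'd (f j) (base T)]].

(* A matrix of 1-forms W_z dz + \sum_k W_k dx_k on (a part of) C x C^m.       *)
Record conn_form (K : numFieldType) (m n : nat) := ConnForm {
  dz_part : K -> 'rV[K]_m -> 'M[K]_n;
  dx_part : 'I_m -> K -> 'rV[K]_m -> 'M[K]_n }.

Definition Omega (K : numFieldType) (m n : nat) (Bo : 'M[K]_n)
    (T : deformation K m n) : conn_form K m n :=
  ConnForm (fun z x => - (pole T x + z^-1 *: Bo))
           (fun k z x => - (z *: defo T k x)).

(* G^-1 W G + G^-1 dG, the differential being taken in both z and x.          *)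
Definition gauge (K : numFieldType) (m n : nat)
    (G : K * 'rV[K]_m -> 'M[K]_n) (W : conn_form K m n) : conn_form K m n :=
  ConnForm
    (fun z x => invmx (G (z, x)) *m dz_part W z x *m G (z, x)
                + invmx (G (z, x)) *m 'D_1 (fun w : K => G (w, x)) z)
    (fun k z x => invmx (G (z, x)) *m dx_part W k z x *m G (z, x)
                + invmx (G (z, x)) *m pd k (fun y => G (z, y)) x).

(* A holomorphic basis of the trivial bundle on P^1 x U: G is its matrix in   *)
(* the chart z, H its matrix in the chart w = 1/z.                            *)
Definition hol_frame_P1 (K : numFieldType) (m n : nat) (U : set 'rV[K]_m)
    (G : K * 'rV[K]_m -> 'M[K]_n) : Prop :=
  hol_GL ([set: K] `*` U) G /\
  exists H : K * 'rV[K]_m -> 'M[K]_n,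
    hol_GL ([set: K] `*` U) H /\
    forall z x, z != 0 -> U x -> G (z, x) = H (z^-1, x).

(* Both connection forms have a pole along z = 0 and along z = oo, so they    *)
(* are compared for z != 0.                                                   *)
Definition I_dv (K : numFieldType) (m n : nat) (Ao Bo : 'M[K]_n) :
    set (deformation K m n) :=
  [set T | I_d Ao Bo T /\
    exists (U : set 'rV[K]_m) (L Delta B : 'rV[K]_m -> 'M[K]_n)
           (varpi : 'I_m -> 'rV[K]_m -> 'M[K]_n)
           (G : K * 'rV[K]_m -> 'M[K]_n),
      [/\ open U /\ U (base T),
          [/\ holomorphic_on U L, holomorphic_on U B &
              forall k, holomorphic_on U (varpi k)],
          hol_diagonal_form U (pole T) Delta,
          hol_frame_P1 U G /\
          (forall z x, z != 0 -> U x ->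
             dz_part (gauge G (Omega Bo T)) z x =
               - (Delta x + z^-1 *: B x) /\
             forall k, dx_part (gauge G (Omega Bo T)) k z x =
               - (z *: pd k Delta x) + varpi k x) &
          forall x, U x ->
            [/\ offdiag (L x) = L x,
                offdiag (B x) = lie (L x) (Delta x) &
                forall k, offdiag (varpi k x) = lie (pd k Delta x) (L x)]]].

(* A formal series a_0 + a_1 z^-1 + ... is the sequence of its coefficients;  *)
(* [fmul] is the Cauchy product, also used when one factor is shifted by z.   *)
Definition fmul (K : numFieldType) (n : nat) (a b : nat -> 'M[K]_n) :
    nat -> 'M[K]_n :=
  fun k => \sum_(i < k.+1) a i *m b (k - i)%N.

Definition fone (K : numFieldType) (n : nat) : nat -> 'M[K]_n :=
  fun k => if k == 0%N then 1%:M else 0.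

(* The next four definitions give series with at most a simple pole at        *)
(* z = oo: the k-th term is the coefficient of z^(1-k).  In this order they   *)
(* are -(A + z^-1 B), -z C, d/dz of \sum_j a_j z^-j, and its image under a    *)
(* derivation in x, where da_j is the derivative of a_j.                      *)
Definition fdz_coef (K : numFieldType) (n : nat) (A B : 'M[K]_n) :
    nat -> 'M[K]_n :=
  fun k => match k with 1 => - A | 2 => - B | _ => 0 end.

Definition fdx_coef (K : numFieldType) (n : nat) (C : 'M[K]_n) :
    nat -> 'M[K]_n :=
  fun k => match k with 0 => - C | _ => 0 end.

Definition fderiv_z (K : numFieldType) (n : nat) (a : nat -> 'M[K]_n) :
    nat -> 'M[K]_n :=
  fun k => match k with j.+2 => - (a j *+ j) | _ => 0 end.

Definition fderiv_x (K : numFieldType) (n : nat) (da : nat -> 'M[K]_n) :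
    nat -> 'M[K]_n :=
  fun k => match k with j.+1 => da j | _ => 0 end.

(* Psi is the inverse Phi^-1 in the ring of formal series.                    *)
Definition I_fs (K : numFieldType) (m n : nat) (Ao Bo : 'M[K]_n) :
    set (deformation K m n) :=
  [set T | I_all Ao Bo T /\
    exists (U : set 'rV[K]_m) (Phi : nat -> 'rV[K]_m -> 'M[K]_n)
           (Delta : 'rV[K]_m -> 'M[K]_n) (B' : 'M[K]_n),
      [/\ open U /\ U (base T),
          (forall k, holomorphic_on U (Phi k)) /\
          (forall x, U x -> Phi 0%N x \in unitmx),
          holomorphic_on U Delta /\ (forall x, U x -> is_diag_mx (Delta x)),
          is_diag_mx B' &
          forall x, U x ->
            let phi := fun k => Phi k x in
            exists psi : nat -> 'M[K]_n,
              [/\ fmul psi phi =1 fone K n, fmul phi psi =1 fone K n,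
                  (forall k,
                     fmul (fmul psi (fdz_coef (pole T x) Bo)) phi k
                     + fmul psi (fderiv_z phi) k
                     = fdz_coef (Delta x) B' k) &
                  forall l k,
                     fmul (fmul psi (fdx_coef (defo T l x))) phi k
                     + fmul psi (fderiv_x (fun j => pd l (Phi j) x)) k
                     = fdx_coef (pd l Delta x) k]]].

(* phi^*C has components \sum_l (d phi_l / d x_k) * (C_l o phi).              *)
Definition pullback (K : numFieldType) (m m' n : nat) (phi : 'rV[K]_m -> 'rV[K]_m')
    (xo : 'rV[K]_m) (T : deformation K m' n) : deformation K m n :=
  Deformation xo
    (fun x => pole T (phi x))
    (fun k x => \sum_l (pd k phi x) 0 l *: defo T l (phi x)).

Definition base_change (K : numFieldType) (m m' : nat)
    (phi : 'rV[K]_m -> 'rV[K]_m') (xo : 'rV[K]_m) (xo' : 'rV[K]_m') : Prop :=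
  phi xo = xo' /\
  exists V : set 'rV[K]_m, [/\ open V, V xo & holomorphic_on V phi].

Definition closed_under_base_change (K : numFieldType) (n : nat)
    (cls : forall m, set (deformation K m n)) : Prop :=
  forall (m m' : nat) (T : deformation K m' n) (phi : 'rV[K]_m -> 'rV[K]_m')
         (xo : 'rV[K]_m),
    base_change phi xo (base T) -> cls m' T -> cls m (pullback phi xo T).

Definition regular_mx (K : numFieldType) (n : nat) (M : 'M[K]_n.+1) : Prop :=
  mxminpoly M = char_poly M.

(* Main.v *)
(* The classes fs, dv and d. If Phi_0 + Phi_1/z + ... formally reduces Omega to
   diagonal form, then Phi_0 diagonalizes A and C simultaneously, and the
   off-diagonal part of Phi_0^-1 Phi_1 is the matrix L required by dv-type. For a
   generic d-type deformation with A = G Delta G^-1, the integrability condition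
   reads [G^-1 dG, Delta] = [d Delta, G^-1 B_o G]; as d f_i - d f_j has a nonvanishing
   component near the base point, one can divide by it, and this produces L.

   Regular diagonalizable A_o. The eigenvalues of A_o are simple, so A has distinct
   holomorphic eigenvalues f_i and a holomorphic eigenframe G near the base point.
   The diagonal of G^-1 dG is then closed, since the diagonal of its square vanishes,
   and a rescaling of the columns of G by exponentials of its primitives makes it zero.
   In this gauge the diagonal of G^-1 B_o G is constant, and the dz-equation determines
   recursively the coefficients F_k of a formal gauge transformation 1 + F_1/z + ...
   with values in the holomorphic matrices. Integrability implies that the F_k satisfy
   the dx-equation as well.

   Complex analysis. Differentiable functions on open subsets of C^m are shown to be
   smooth without contour integrals: Goursat's subdivision argument for Riemann sums
   along squares, applied to (f z - f c - f'(c) (z - c)) / (z - c)^2, bounds f'(c)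
   because the sums of 1 / (z - c) stay away from 0; this Cauchy estimate, applied to
   difference quotients, yields second derivatives. *)

From HB Require Import structures.
Require Import Defs.
From mathcomp Require Import all_boot all_order all_algebra.
From mathcomp Require Import complex ring lra zify.
From mathcomp Require Import all_classical all_reals all_analysis.

Set Implicit Arguments.
Unset Strict Implicit.
Unset Printing Implicit Defensive.

Import Order.TTheory GRing.Theory Num.Theory numFieldNormedType.Exports.

Local Open Scope classical_set_scope.
Local Open Scope ring_scope.

Local Notation Re := complex.Re.
Local Notation Im := complex.Im.

(** * Goursat's lemma and Cauchy's estimate *)

(** Riemann sums suffice because three facts hold exactly on every grid, before any limit:
    additivity under trisection, vanishing on affine functions, and the lower bound for 1 / (z - c).
    Cutting into thirds rather than halves keeps c at the centre of the middle square, so the other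
    eight squares avoid the pole. For a regular diagonalizable A_o, two facts rest on one relation:
    the off-diagonal entries of G^-1 dG are (d f_i - d f_j) L_ij, with L_ij independent of the
    direction of differentiation. Hence products of two components have symmetric diagonals, so the
    diagonal of G^-1 dG is closed, and the diagonal of [G^-1 B_o G, G^-1 dG] vanishes, so that of
    G^-1 B_o G is constant. Integrability gives the dx-equation because its defect obeys the
    recursion of the F_k and starts at 0: distinct eigenvalues kill its off-diagonal entries, and
    the nonzero integer k + 1 kills the diagonal ones. *)

Section Squares.
Context {R : realType}.
Implicit Types (x y s h : R) (z : R[i]).

(** Compactness by nested squares: a square violating [P] has a third violating it, and the
    resulting sequence shrinks to a point (u, v) at which the local hypothesis is contradicted. It
    serves in dimension two for [goursat] and, with y ignored, in dimension one for
    [mean_value_bound]. *)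
Lemma trisection (P : R -> R -> R -> Prop) x0 y0 s0 : 0 < s0 ->
  (forall x y s, 0 < s ->
     (forall p q : 'I_3, P (x + p%:R * (s / 3)) (y + q%:R * (s / 3)) (s / 3)) ->
     P x y s) ->
  (forall u v, x0 <= u <= x0 + s0 -> y0 <= v <= y0 + s0 ->
     exists2 d : R, 0 < d & forall x y s, 0 < s < d ->
       x <= u <= x + s -> y <= v <= y + s -> P x y s) ->
  P x0 y0 s0.
Proof.
move=> s0_gt0 glue loc; apply: contrapT => nP.
have /choice[nxt nxtP] : forall t : R * R * R, exists pq : 'I_3 * 'I_3,
    0 < t.2 -> ~ P t.1.1 t.1.2 t.2 ->
    ~ P (t.1.1 + pq.1%:R * (t.2 / 3)) (t.1.2 + pq.2%:R * (t.2 / 3)) (t.2 / 3).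
  move=> [[x y] s] /=; apply: contrapT => /forallNP H.
  have [s_gt0 nPt] : 0 < s /\ ~ P x y s.
    split; first by apply: contrapT => ns; apply: (H (ord0, ord0)).
    by move=> Pt; apply: (H (ord0, ord0)).
  apply: nPt; apply: glue => // p q; apply: contrapT => nPpq.
  by apply: (H (p, q)).
pose step t := (t.1.1 + (nxt t).1%:R * (t.2 / 3),
                t.1.2 + (nxt t).2%:R * (t.2 / 3), t.2 / 3) : R * R * R.
pose t n := iter n step (x0, y0, s0).
have tS n : t n.+1 = step (t n) by [].
have t2 n : (t n).2 = s0 / 3 ^+ n.
  elim: n => [|n IH]; first by rewrite expr0 divr1.
  by rewrite tS /= IH exprSr invfM mulrA.
have t_gt0 n : 0 < (t n).2 by rewrite t2 divr_gt0 // exprn_gt0.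
have tP n : ~ P (t n).1.1 (t n).1.2 (t n).2.
  by elim: n => // n IH; rewrite tS; apply: nxtP.
have ordb (p : 'I_3) s : 0 < s ->
    0 <= p%:R * (s / 3) /\ p%:R * (s / 3) + s / 3 <= s.
  move=> sp; have s3 : 0 < s / 3 by rewrite divr_gt0.
  split; first by rewrite mulr_ge0 // ltW.
  have : ((p : nat).+1%:R : R) <= 3 by rewrite ler_nat ltn_ord.
  by rewrite -natr1; nra.
pose cx (t : R * R * R) := t.1.1; pose cy (t : R * R * R) := t.1.2.
(* Nested intervals, stated for either coordinate [c]: the common point is the supremum of the lower
   endpoints. *)
have nest (c : R * R * R -> R) :
    (forall t, exists p : 'I_3, c (step t) = c t + p%:R * (t.2 / 3)) ->
    exists u, forall n, c (t n) <= u <= c (t n) + (t n).2.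
  move=> cP.
  have mono n k : c (t n) <= c (t (n + k)%N) /\
      c (t (n + k)%N) + (t (n + k)%N).2 <= c (t n) + (t n).2.
    elim: k => [|k [IH1 IH2]]; first by rewrite addn0.
    have [p cp] := cP (t (n + k)%N).
    have [lo hi] := ordb p _ (t_gt0 (n + k)%N).
    rewrite addnS tS cp /=; split; first by lra.
    by lra.
  have ub m n : c (t n) <= c (t m) + (t m).2.
    have := t_gt0 m; have := t_gt0 n.
    case: (leqP n m) => [/subnKC <-|/ltnW /subnKC <-].
      by have [] := mono n (m - n)%N; lra.
    by have [] := mono m (n - m)%N; lra.
  pose S := [set c (t n) | n in [set: nat]].
  have S0 : S !=set0 by exists (c (t 0%N)); exists 0%N.
  exists (sup S) => n; apply/andP; split.
    apply: ub_le_sup; last by exists n.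
    by exists (c (t 0%N) + (t 0%N).2) => _ [k _ <-].
  by apply: ge_sup => // _ [k _ <-].
have [u uP] := nest cx (fun t => ex_intro _ (nxt t).1 erefl).
have [v vP] := nest cy (fun t => ex_intro _ (nxt t).2 erefl).
have [d d_gt0 dP] := loc u v (uP 0%N) (vP 0%N).
(* Any n > s0 / d works, as n < 3 ^ n. *)
have [n nd] : exists n, s0 / 3 ^+ n < d.
  pose n := Num.bound (s0 / d); exists n.
  rewrite ltr_pdivrMr ?exprn_gt0 // -ltr_pdivrMl // mulrC.
  have : s0 / d < n%:R.
    by rewrite archi_boundP // divr_ge0 // ltW.
  move=> /lt_le_trans; apply; rewrite -natrX ler_nat ltnW //.
  by rewrite ltn_expl.
apply: (tP n); apply: dP; [by rewrite t_gt0 t2|exact: uP|exact: vP].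
Qed.

End Squares.

(** * The modulus as a real number *)

Section ComplexModulus.
Context {R : realType}.
Implicit Types (x y : R) (z w : R[i]).

(** The norm of R[i] takes its values in R[i]; this copy takes them in R, where [lra] and [nra]
    apply. *)
Definition nm z : R := Num.sqrt (Re z ^+ 2 + Im z ^+ 2).

Lemma normE z : `|z| = (nm z)%:C%C.
Proof. exact: normc_def. Qed.

Lemma nmM z w : nm (z * w) = nm z * nm w.
Proof. by apply: complexI; rewrite rmorphM /= -!normE normrM. Qed.

Lemma nmD z w : nm (z + w) <= nm z + nm w.
Proof. by rewrite -lecR rmorphD /= -!normE ler_normD. Qed.

Lemma nmN z : nm (- z) = nm z.
Proof. by apply: complexI; rewrite -!normE normrN. Qed.

Lemma nmV z : nm z^-1 = (nm z)^-1.
Proof. by apply: complexI; rewrite fmorphV /= -!normE normfV. Qed.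

Lemma nm_ge0 z : 0 <= nm z.
Proof. exact: sqrtr_ge0. Qed.

Lemma nm0 : nm 0 = 0.
Proof. by apply: complexI; rewrite -normE normr0. Qed.

Lemma nm0_eq0 z : (nm z == 0) = (z == 0).
Proof. by rewrite -(inj_eq (@complexI R)) -normE normr_eq0. Qed.

Lemma nm_gt0 z : (0 < nm z) = (z != 0).
Proof. by rewrite lt_def nm_ge0 andbT nm0_eq0. Qed.

Lemma nm_real x : nm x%:C%C = `|x|.
Proof. by rewrite /nm /= expr0n /= addr0 sqrtr_sqr. Qed.

Lemma nm_nat n : nm n%:R = n%:R :> R.
Proof. by apply: complexI; rewrite -normE normr_nat rmorph_nat. Qed.

Lemma nm_i : nm 'i%C = 1 :> R.
Proof. by rewrite /nm /= expr0n /= expr1n add0r sqrtr1. Qed.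

Lemma nm_sum (I : Type) (r : seq I) (P : pred I) (F : I -> R[i]) :
  nm (\sum_(i <- r | P i) F i) <= \sum_(i <- r | P i) nm (F i).
Proof.
elim/big_ind2 : _ => [|z a w b za wb|//]; first by rewrite nm0.
by rewrite (le_trans (nmD _ _)) // lerD.
Qed.

Lemma nmB z w : nm (z - w) <= nm z + nm w.
Proof. by rewrite (le_trans (nmD _ _)) // nmN. Qed.

Lemma nm_distC z w : nm (z - w) = nm (w - z).
Proof. by rewrite -nmN opprB. Qed.

Lemma nm_le_Re_Im z : nm z <= `|Re z| + `|Im z|.
Proof.
rewrite [z]complexE (le_trans (nmD _ _)) // nmM nm_i mul1r !nm_real.
by case: z => a b /=; simpc.
Qed.

Lemma Re_le_nm z : `|Re z| <= nm z.
Proof. by rewrite -lecR -normE normc_ge_Re. Qed.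

Lemma Im_le_nm z : `|Im z| <= nm z.
Proof.
have -> : nm z = nm (z * 'i%C) by rewrite nmM nm_i mulr1.
by rewrite -normrN -ReiNIm Re_le_nm.
Qed.

End ComplexModulus.

(** * Riemann sums along squares and Goursat's lemma *)

Section SquareSums.
Context {R : realType}.
Implicit Types (x y s h : R) (z : R[i]) (g : R[i] -> R[i]).
Local Open Scope complex_scope.

Definition hsum g N h x y : R[i] := \sum_(j < N) g ((x + j%:R * h) +i* y).
Definition vsum g N h x y : R[i] := \sum_(j < N) g (x +i* (y + j%:R * h)).

(* The left-endpoint Riemann sum of g over the boundary of the square with    *)
(* lower left corner x +i* y and side N h.                                    *)
Definition square_sum g N h x y : R[i] :=
  h%:C * (hsum g N h x y - hsum g N h x (y + N%:R * h)
          + 'i * (vsum g N h (x + N%:R * h) y - vsum g N h x y)).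

Lemma hsumD g N M h x y :
  hsum g (N + M) h x y = hsum g N h x y + hsum g M h (x + N%:R * h) y.
Proof.
rewrite /hsum big_split_ord /=; congr (_ + _).
by apply: eq_bigr => j _; rewrite natrD mulrDl addrA.
Qed.

Lemma vsumD g N M h x y :
  vsum g (N + M) h x y = vsum g N h x y + vsum g M h x (y + N%:R * h).
Proof.
rewrite /vsum big_split_ord /=; congr (_ + _).
by apply: eq_bigr => j _; rewrite natrD mulrDl addrA.
Qed.

(** An inner edge is sampled at the same points by the two squares that share it, with opposite
    signs, so the cancellation is exact. *)
Lemma square_sum3 g N h x y : square_sum g (N + (N + N)) h x y =
  \sum_(p < 3) \sum_(q < 3)
    square_sum g N h (x + p%:R * (N%:R * h)) (y + q%:R * (N%:R * h)).
Proof.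
rewrite !big_ord_recl !big_ord0 /= /bump /= /square_sum !hsumD !vsumD.
rewrite !natrD !mulrDl !mul0r !mul1r !addr0 !addrA.
move: (hsum g N h) (vsum g N h) (N%:R * h) h%:C ('i : R[i]) => H V s c i.
ring.
Qed.

Lemma square_sumD g1 g2 N h x y :
  square_sum (fun z => g1 z + g2 z) N h x y =
  square_sum g1 N h x y + square_sum g2 N h x y.
Proof.
have hD y' : hsum (fun z => g1 z + g2 z) N h x y' = hsum g1 N h x y' + hsum g2 N h x y'.
  exact: big_split.
have vD x' : vsum (fun z => g1 z + g2 z) N h x' y = vsum g1 N h x' y + vsum g2 N h x' y.
  exact: big_split.
rewrite /square_sum !hD !vD; move: (hsum g1) (hsum g2) (vsum g1) (vsum g2) => H1 H2 V1 V2.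
by move: h%:C ('i : R[i]) => c i; ring.
Qed.

Lemma square_sumZ a g N h x y :
  square_sum (fun z => a * g z) N h x y = a * square_sum g N h x y.
Proof.
have hZ y' : hsum (fun z => a * g z) N h x y' = a * hsum g N h x y'.
  by rewrite /hsum mulr_sumr.
have vZ x' : vsum (fun z => a * g z) N h x' y = a * vsum g N h x' y.
  by rewrite /vsum mulr_sumr.
rewrite /square_sum !hZ !vZ; move: (hsum g) (vsum g) => H V.
by move: h%:C ('i : R[i]) => c i; ring.
Qed.

(** Opposite sides differ by a constant at each pair of sample points, and the horizontal
    contribution - b i s cancels i times the vertical one, b s. *)
Lemma square_sum_affine a b N h x y :
  square_sum (fun z => a + b * z) N h x y = 0.
Proof.
rewrite /square_sum /hsum /vsum -!sumrB.
under eq_bigr => j _.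
  have -> : a + b * ((x + j%:R * h) +i* y)
    - (a + b * ((x + j%:R * h) +i* (y + N%:R * h))) = - (b * 'i * (N%:R * h)%:C).
    by rewrite opprD addrACA subrr add0r -mulrBr -mulrA -mulrN; congr (b * _); simpc;
      congr (_ +i* _); ring.
  over.
under [X in _ + 'i * X]eq_bigr => j _.
  have -> : a + b * ((x + N%:R * h) +i* (y + j%:R * h))
    - (a + b * (x +i* (y + j%:R * h))) = b * (N%:R * h)%:C.
    by rewrite opprD addrACA subrr add0r -mulrBr; congr (b * _); simpc;
      congr (_ +i* _); ring.
  over.
rewrite !sumr_const card_ord.
suff alg (K : comPzRingType) (c i s d : K) (M : nat) :
  c * (- (d * i * s) *+ M + i * (d * s *+ M)) = 0 by exact: alg.
by ring.
Qed.

Definition on_square x y s z :=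
  (x <= Re z <= x + s) /\ (y <= Im z <= y + s).

Definition on_boundary x y s z := on_square x y s z /\
  (Re z = x \/ Re z = x + s \/ Im z = y \/ Im z = y + s).

Lemma square_sum_bound g N h x y M : 0 <= h ->
  (forall z, on_boundary x y (N%:R * h) z -> nm (g z) <= M) ->
  nm (square_sum g N h x y) <= 4 * (N%:R * h) * M.
Proof.
move=> h0 gM.
have jh (j : 'I_N) : 0 <= j%:R * h <= N%:R * h.
  by rewrite mulr_ge0 // ler_wpM2r // ler_nat ltnW.
have nh : 0 <= N%:R * h by rewrite mulr_ge0.
have hb y' : y' = y \/ y' = y + N%:R * h -> nm (hsum g N h x y') <= N%:R * M.
  move=> y'P; rewrite (le_trans (nm_sum _ _ _)) //.
  rewrite -[X in _ <= X%:R * _]card_ord mulr_natl -sumr_const ler_sum // => j _.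
  apply: gM; have := jh j; rewrite /on_boundary /on_square /=; split; last by tauto.
  by case: y'P => ->; lra.
have vb x' : x' = x \/ x' = x + N%:R * h -> nm (vsum g N h x' y) <= N%:R * M.
  move=> x'P; rewrite (le_trans (nm_sum _ _ _)) //.
  rewrite -[X in _ <= X%:R * _]card_ord mulr_natl -sumr_const ler_sum // => j _.
  apply: gM; have := jh j; rewrite /on_boundary /on_square /=; split; last by tauto.
  by case: x'P => ->; lra.
rewrite /square_sum nmM nm_real ger0_norm //.
have -> : 4 * (N%:R * h) * M = h * ((N%:R * M + N%:R * M) + (N%:R * M + N%:R * M)).
  by ring.
rewrite ler_wpM2l // (le_trans (nmD _ _)) // lerD //.
  by rewrite (le_trans (nmB _ _)) // lerD //; apply: hb; tauto.
rewrite nmM nm_i mul1r.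
by rewrite (le_trans (nmB _ _)) // lerD //; apply: vb; tauto.
Qed.

Definition cdiff g z := exists b, forall e : R, 0 < e -> exists2 d : R, 0 < d &
  forall w, nm (w - z) < d -> nm (g w - g z - b * (w - z)) <= e * nm (w - z).

Lemma eq_square_sum g1 g2 N h x y : g1 =1 g2 ->
  square_sum g1 N h x y = square_sum g2 N h x y.
Proof. by move=> /funext ->. Qed.

(** The bound c s^2 is proportional to the area, so the bounds of nine thirds add up to that of the
    whole square. Near a point, the affine part of [g] contributes nothing and the remainder is
    small compared with the side. *)
Lemma goursat g x0 y0 s0 : 0 < s0 ->
  (forall z, on_square x0 y0 s0 z -> cdiff g z) ->
  forall e : R, 0 < e -> exists n0, forall n, (n0 <= n)%N ->
    nm (square_sum g (3 ^ n) (s0 / 3 ^+ n) x0 y0) <= e.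
Proof.
move=> s0_gt0 gd e e_gt0.
pose c := e / s0 ^+ 2.
have c_gt0 : 0 < c by rewrite divr_gt0 // exprn_gt0.
suff [n0 n0P] : exists n0, forall n, (n0 <= n)%N ->
    nm (square_sum g (3 ^ n) (s0 / 3 ^+ n) x0 y0) <= c * s0 ^+ 2.
  exists n0 => n /n0P; rewrite /c divfK // expf_neq0 //; exact: lt0r_neq0.
have sN s n : (3 ^ n)%:R * (s / 3 ^+ n) = s :> R.
  by rewrite natrX mulrC divfK // expf_neq0.
apply: (@trisection _ (fun x y s => exists n0, forall n, (n0 <= n)%N ->
    nm (square_sum g (3 ^ n) (s / 3 ^+ n) x y) <= c * s ^+ 2)) => //.
- move=> x y s s_gt0 H.
  have /choice[n1 n1P] : forall pq : 'I_3 * 'I_3, exists n0, forall n, (n0 <= n)%N ->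
      nm (square_sum g (3 ^ n) (s / 3 / 3 ^+ n) (x + pq.1%:R * (s / 3))
        (y + pq.2%:R * (s / 3))) <= c * (s / 3) ^+ 2.
    by move=> [p q]; apply: H.
  (* The grid of level n + 1 on the square is the grid of level n on each of its thirds, whence the
     successor. *)
  exists (\max_pq n1 pq).+1 => -[//|n]; rewrite ltnS => nn.
  have -> : (3 ^ n.+1 = 3 ^ n + (3 ^ n + 3 ^ n))%N by rewrite expnS; lia.
  have -> : s / 3 ^+ n.+1 = s / 3 / 3 ^+ n by rewrite exprS invfM mulrA.
  rewrite square_sum3 sN.
  have -> : c * s ^+ 2 = \sum_(p < 3) \sum_(q < 3) c * (s / 3) ^+ 2.
    by rewrite !sumr_const card_ord; field.
  rewrite (le_trans (nm_sum _ _ _)) // ler_sum // => p _.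
  rewrite (le_trans (nm_sum _ _ _)) // ler_sum // => q _.
  by apply: (n1P (p, q)); rewrite (leq_trans _ nn) // (leq_bigmax (p, q)).
move=> u v ux vy; have [b bP] := gd (u +i* v) (conj ux vy).
(* The perimeter is 4 s and the distance to the base point at most 2 s, so the error c / 8 per unit
   distance yields c s^2. *)
have [d d_gt0 dP] := bP (c / 8) ltac:(lra).
exists (d / 2) => [|x y s /andP[s_gt0 sd] xu yv]; first lra.
exists 0%N => n _.
set z0 := u +i* v in bP dP *.
have -> : square_sum g (3 ^ n) (s / 3 ^+ n) x y =
    square_sum (fun w => g w - g z0 - b * (w - z0)) (3 ^ n) (s / 3 ^+ n) x y.
  have /(@eq_square_sum g) -> :
    g =1 fun w => (g w - g z0 - b * (w - z0)) + ((g z0 - b * z0) + b * w).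
    suff alg (K : comPzRingType) (p q z w r : K) :
      p = (p - q - r * (w - z)) + ((q - r * z) + r * w) by move=> w; exact: alg.
    by ring.
  by rewrite square_sumD square_sum_affine addr0.
have -> : c * s ^+ 2 = 4 * ((3 ^ n)%:R * (s / 3 ^+ n)) * (c / 8 * (2 * s)).
  by rewrite sN; field.
apply: square_sum_bound => [|w]; first by rewrite divr_ge0 ?exprn_ge0 ?ltW.
rewrite sN => -[[wx wy] _].
have ws : nm (w - z0) <= 2 * s.
  rewrite (le_trans (nm_le_Re_Im _)) //.
  have -> : Re (w - z0) = Re w - u by case: (w).
  have -> : Im (w - z0) = Im w - v by case: (w).
  have : `|Re w - u| <= s by rewrite ler_norml; lra.
  have : `|Im w - v| <= s by rewrite ler_norml; lra.
  by lra.
rewrite (le_trans (dP _ _)) ?ler_wpM2l //; lra.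
Qed.

End SquareSums.

Section DifferentialEstimates.
Context {K : numFieldType}.

Lemma diff_eps (V W : normedModType K) (f : V -> W) x : differentiable f x ->
  forall e, 0 < e -> exists2 d, 0 < d &
    forall h, `|h| < d -> `|f (h + x) - f x - 'd f x h| <= e * `|h|.
Proof.
move=> /diff_locally/eqaddoE/eqaddoP H e e_gt0.
have /nbhs_ballP[d /= d_gt0 dP] := H e e_gt0.
exists d => // h hd; rewrite -addrA -opprD.
by apply: dP; rewrite -ball_normE /= sub0r normrN.
Qed.

Lemma eps_diff (V W : normedModType K) (f : V -> W) x (L : {linear V -> W}) :
  continuous L ->
  (forall e, 0 < e -> exists2 d, 0 < d &
    forall h, `|h| < d -> `|f (h + x) - f x - L h| <= e * `|h|) ->
  is_diff x f L.
Proof.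
move=> Lc H.
have E : f \o shift x = cst (f x) + L +o_ 0 id.
  apply/eqaddoP => e e_gt0; have [d d_gt0 dP] := H e e_gt0.
  apply/nbhs_ballP; exists d => //= h.
  rewrite -ball_normE /= sub0r normrN => /dP.
  by rewrite -addrA -opprD.
have D := diff_unique Lc E.
by split => //; apply/diff_locallyP; rewrite D.
Qed.

End DifferentialEstimates.

(* Fixing this structure on R[i] makes [differentiable] mean complex            *)
(* differentiability in all that follows.                                      *)
Definition KK (R : realType) : numFieldType := R[i]%C.

(** * Cauchy's estimate on a square *)

Section CauchyEstimate.
Context {R : realType}.
Local Notation K := (KK R).
Implicit Types (f g : K -> K) (x y r s h : R) (z c w : K).
Local Open Scope complex_scope.

Lemma KK_posP (e : K) : 0 < e -> exists2 d : R, 0 < d & e = d%:C.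
Proof.
case: e => a b e_gt0; have /andP[/= /eqP -> a_gt0] : (0 : R[i]) < a +i* b by [].
by exists a.
Qed.

Lemma differentiable_cdiff f z : differentiable f z ->
  forall e : R, 0 < e -> exists2 d : R, 0 < d & forall w, nm (w - z) < d ->
    nm (f w - f z - 'D_1 f z * (w - z)) <= e * nm (w - z).
Proof.
move=> df e e_gt0.
have [|d' + dP] := diff_eps df (e := e%:C : K); first by rewrite ltcR.
move=> /KK_posP[d d_gt0 d'E]; exists d => // w wd.
have zw : `|w - z| < d' by rewrite d'E normE ltcR.
have := dP (w - z) zw; rewrite subrK !normE -rmorphM lecR.
have -> // : 'd f z (w - z) = 'D_1 f z * (w - z).
by rewrite diff1E // derive1E mulrC.
Qed.

(** Of the nine thirds of a square centred at [c], the middle one is again centred at [c]; the other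
    eight avoid [c] and have small sums by [goursat]. Repeating this k times moves the contour to a
    square 3^k times smaller. *)
Lemma square_sum_annulus (g : R[i] -> R[i]) (c : R[i]) k r : 0 < r ->
  (forall z : R[i], on_square (Re c - r) (Im c - r) (2 * r) z -> z != c -> cdiff g z) ->
  forall e : R, 0 < e -> exists n0, forall n, (n0 <= n)%N ->
    nm (square_sum g (3 ^ (n + k)) (2 * r / 3 ^+ (n + k)) (Re c - r) (Im c - r)
        - square_sum g (3 ^ n) (2 * (r / 3 ^+ k) / 3 ^+ n)
            (Re c - r / 3 ^+ k) (Im c - r / 3 ^+ k)) <= e.
Proof.
elim: k r => [|k IH] r r_gt0 gd e e_gt0.
  by exists 0%N => n _; rewrite addn0 expr0 divr1 subrr nm0 ltW.
pose r' := r / 3; have r'_gt0 : 0 < r' by rewrite divr_gt0.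
have rE : r = 3 * r' by rewrite /r'; field.
have [n1 n1P] : exists n0, forall n, (n0 <= n)%N ->
    nm (square_sum g (3 ^ (n + k)) (2 * r' / 3 ^+ (n + k)) (Re c - r') (Im c - r')
        - square_sum g (3 ^ n) (2 * (r' / 3 ^+ k) / 3 ^+ n)
            (Re c - r' / 3 ^+ k) (Im c - r' / 3 ^+ k)) <= e / 2.
  apply: IH => // [z [zx zy] zc|]; last by rewrite divr_gt0.
  by apply: gd => //; split; lra.
have /choice[n2 n2P] : forall pq : 'I_3 * 'I_3, exists n0, forall n, (n0 <= n)%N ->
    pq != (1, 1) ->
    (* With e / 18 for each of the outer squares, even nine of them would only reach e / 2, the
       other half being left for the induction hypothesis. *)
    nm (square_sum g (3 ^ n) (2 * r' / 3 ^+ n) (Re c - r + pq.1%:R * (2 * r'))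
        (Im c - r + pq.2%:R * (2 * r'))) <= e / 18.
  move=> pq; case: (eqVneq pq (1, 1)) => [_|pq11]; first by exists 0%N.
  have [|||n0 n0P] := @goursat _ g (Re c - r + pq.1%:R * (2 * r'))
      (Im c - r + pq.2%:R * (2 * r')) (2 * r') _ _ (e / 18).
  - by lra.
  - move=> z [zx zy]; have pb (p : 'I_3) : 0 <= (p%:R : R) <= 2.
      by rewrite ler0n ler_nat -ltnS ltn_ord.
    have := pb pq.1; have := pb pq.2 => qb' pb'.
    apply: gd; first by split; nra.
    apply: contra pq11 => /eqP zc; move: zx zy; rewrite zc => zx zy.
    (* A coordinate of the centre lies strictly inside the middle third, so even the closed outer
       squares do not meet [c]. *)
    have p1 (p : 'I_3) t : t - r + p%:R * (2 * r') <= t <= t - r + p%:R * (2 * r') + 2 * r' ->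
        p = 1.
      case: p => -[|[|[|//]]] p3 /= tP; apply: val_inj => //=; exfalso; lra.
    by case: pq zx zy {qb' pb'} => p q /= /p1 -> /p1 ->.
  - by rewrite divr_gt0.
  - by exists n0 => n /n0P.
exists (maxn n1 (\max_pq n2 pq)) => n; rewrite geq_max => /andP[nn1 nn2].
have -> : (3 ^ (n + k.+1) = 3 ^ (n + k) + (3 ^ (n + k) + 3 ^ (n + k)))%N.
  by rewrite addnS expnS; lia.
have -> : 2 * r / 3 ^+ (n + k.+1) = 2 * r' / 3 ^+ (n + k).
  by rewrite addnS exprS invfM rE; field; rewrite expf_neq0.
have sN m : (3 ^ m)%:R * (2 * r' / 3 ^+ m) = 2 * r' :> R.
  by rewrite natrX mulrC divfK // expf_neq0.
have -> : r / 3 ^+ k.+1 = r' / 3 ^+ k by rewrite exprS invfM rE; field; rewrite expf_neq0.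
rewrite square_sum3 sN pair_big /= (bigD1 (1, 1)) //= mul1r.
have -> : Re c - r + 2 * r' = Re c - r' by rewrite rE; ring.
have -> : Im c - r + 2 * r' = Im c - r' by rewrite rE; ring.
rewrite addrAC (le_trans (nmD _ _)) //.
have := n1P n nn1; set a := nm _ => an.
suff : nm (\sum_(i : 'I_3 * 'I_3 | i != (1, 1)) square_sum g (3 ^ (n + k)) (2 * r' / 3 ^+ (n + k))
    (Re c - r + i.1%:R * (2 * r')) (Im c - r + i.2%:R * (2 * r'))) <= e / 2.
  by lra.
rewrite (le_trans (nm_sum _ _ _)) //.
have : \sum_(i : 'I_3 * 'I_3) e / 18 = e / 2.
  by rewrite sumr_const card_prod card_ord; field.
rewrite (bigD1 (1, 1)) //= => sE.
have : \sum_(i : 'I_3 * 'I_3 | i != (1, 1)) nm (square_sum g (3 ^ (n + k)) (2 * r' / 3 ^+ (n + k))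
    (Re c - r + i.1%:R * (2 * r')) (Im c - r + i.2%:R * (2 * r'))) <=
  \sum_(i : 'I_3 * 'I_3 | i != (1, 1)) e / 18.
  apply: ler_sum => i i11; apply: n2P => //.
  by rewrite (leq_trans _ (leq_addr _ _)) // (leq_trans _ nn2) // leq_bigmax.
by lra.
Qed.

(** A substitute for the value 2 pi i of the contour integral. The four sides combine into i h times
    a sum of 4 r / (r^2 + t_j^2) with t_j^2 <= r^2; each term is at least 2 / r, and N h = 2 r. *)
Lemma square_sum_inv (c : R[i]) r N : 0 < r -> (0 < N)%N ->
  4 <= nm (square_sum (fun z => (z - c)^-1) N (2 * r / N%:R) (Re c - r) (Im c - r)).
Proof.
move=> r_gt0 N_gt0; set h := 2 * r / N%:R.
have nN : (0 : R) < N%:R by rewrite ltr0n.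
have hE : N%:R * h = 2 * r by rewrite /h mulrC divfK // lt0r_neq0.
have h_gt0 : 0 < h by rewrite /h divr_gt0 // mulr_gt0.
pose t (j : 'I_N) : R := j%:R * h - r.
have tP j : t j ^+ 2 <= r ^+ 2.
  have : 0 <= j%:R * h <= N%:R * h.
    apply/andP; split; first by rewrite mulr_ge0 // ltW.
    by rewrite ler_pM2r // ler_nat ltnW.
  by rewrite /t hE; nra.
have -> : square_sum (fun z => (z - c)^-1) N h (Re c - r) (Im c - r) =
    h%:C * ('i * (\sum_(j < N) 4 * r / (r ^+ 2 + t j ^+ 2))%:C).
  rewrite /square_sum; congr (_ * _).
  rewrite /hsum /vsum -!sumrB rmorph_sum /= !mulr_sumr -big_split.
  apply: eq_bigr => j _; rewrite hE.
  case: (c) => a b /=; simpc.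
  have -> : a - r + j%:R * h - a = t j by rewrite /t; ring.
  have -> : b - r + j%:R * h - b = t j by rewrite /t; ring.
  have -> : b - r - b = - r by ring.
  have -> : b - r + 2 * r - b = r by ring.
  have -> : a - r - a = - r by ring.
  have -> : a - r + 2 * r - a = r by ring.
  rewrite !sqrrN.
  have D : r ^+ 2 + t j ^+ 2 != 0.
    by rewrite gt_eqF // ltr_pwDl ?exprn_gt0 // sqr_ge0.
  have D' : t j ^+ 2 + r ^+ 2 != 0 by rewrite addrC.
  by congr (_ +i* _); field; rewrite ?D ?D'.
rewrite !nmM nm_i mul1r !nm_real gtr0_norm // ger0_norm; last first.
  by apply: sumr_ge0 => j _; rewrite divr_ge0 ?addr_ge0 ?sqr_ge0 // mulr_ge0 // ltW.
have E4 : 4 = h * (\sum_(j < N) 2 / r) :> R.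
  rewrite sumr_const card_ord -[_ *+ N]mulr_natl mulrCA mulrA hE; field.
  exact: lt0r_neq0.
rewrite [leLHS]E4 (ler_wpM2l (ltW h_gt0)) // ler_sum // => j _.
rewrite ler_pdivlMr; last by rewrite ltr_pwDl ?exprn_gt0 // sqr_ge0.
rewrite mulrAC ler_pdivrMr //.
by have := tP j; nra.
Qed.

Lemma cauchy_estimate f (c : K) r M : 0 < r ->
  (forall z : K, on_square (Re c - r) (Im c - r) (2 * r) z -> differentiable f z) ->
  (forall z : K, on_square (Re c - r) (Im c - r) (2 * r) z -> nm (f z) <= M) ->
  nm ('D_1 f c) <= 4 * M / r.
Proof.
move=> r_gt0 fd fM.
set D := 'D_1 f c.
suff : nm D * 4 <= 16 * M / r.
  rewrite !ler_pdivlMr //; lra.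
apply/ler_addgt0Pr => e e_gt0.
(* One [a] is lost on the annulus and eight on the small square around [c]. *)
pose a := e / 9; have a_gt0 : 0 < a by rewrite divr_gt0.
have eE : e = 9 * a by rewrite /a; field.
have cin : on_square (Re c - r) (Im c - r) (2 * r) c by split; lra.
pose g (z : K) : K := (f z - f c - D * (z - c)) * ((z - c) * (z - c))^-1.
have gd (z : R[i]) : on_square (Re c - r) (Im c - r) (2 * r) z -> z != c -> cdiff g z.
  move=> zS zc.
  have dg : differentiable g (z : K).
    apply: differentiableM.
      apply: differentiableB.
        by apply: differentiableB; [exact: fd|exact: differentiable_cst].
      apply: differentiableM; first exact: differentiable_cst.
      by apply: differentiableB; [exact: ex_diff|exact: differentiable_cst].
    apply: differentiableV.
      by apply: differentiableM; apply: differentiableB; rewrite //; exact: differentiable_cst.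
    by rewrite mulf_neq0 // subr_eq0.
  by exists ('D_1 g (z : K)); exact: differentiable_cdiff.
have [d d_gt0 dP] := differentiable_cdiff (fd _ cin) a_gt0.
have [k kd] : exists k, 2 * (r / 3 ^+ k) < d.
  pose k := Num.bound (2 * r / d); exists k.
  rewrite mulrA ltr_pdivrMr ?exprn_gt0 // -ltr_pdivrMl // mulrC.
  have : 2 * r / d < k%:R by rewrite archi_boundP // divr_ge0 ?ltW // mulr_gt0.
  move=> /lt_le_trans; apply; rewrite -natrX ler_nat ltnW //.
  by rewrite ltn_expl.
have [n0 n0P] := square_sum_annulus k r_gt0 gd a_gt0.
have := n0P n0 (leqnn _); set T0 := square_sum _ _ _ _ _; set Tk := square_sum _ _ _ _ _.
move=> T0k.
have sN s m : (3 ^ m)%:R * (s / 3 ^+ m) = s :> R.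
  by rewrite natrX mulrC divfK // expf_neq0.
have bdry t z : 0 < t -> on_boundary (Re c - t) (Im c - t) (2 * t) z ->
    t <= nm (z - c) <= 2 * t.
  move=> t_gt0 [[zx zy] zb].
  have ReE : Re (z - c) = Re z - Re c by case: (z) (c) => ? ? [].
  have ImE : Im (z - c) = Im z - Im c by case: (z) (c) => ? ? [].
  have := nm_le_Re_Im (z - c); have := Re_le_nm (z - c); have := Im_le_nm (z - c).
  rewrite ReE ImE => iz rz uz.
  have h1 : `|Re z - Re c| <= t by rewrite ler_norml; lra.
  have h2 : `|Im z - Im c| <= t by rewrite ler_norml; lra.
  apply/andP; split; last by lra.
  case: zb => [zE|[zE|[zE|zE]]].
  - by move: rz; rewrite zE addrAC subrr add0r normrN gtr0_norm.
  - by move: rz; rewrite zE; have -> : Re c - t + 2 * t - Re c = t by [ring]; rewrite gtr0_norm.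
  - by move: iz; rewrite zE addrAC subrr add0r normrN gtr0_norm.
  - by move: iz; rewrite zE; have -> : Im c - t + 2 * t - Im c = t by [ring]; rewrite gtr0_norm.
(* On the small boundary, t <= |z - c|, so differentiability at [c] gives |g| <= a / |z - c| <= a /
   t, and the perimeter is 8 t. *)
have Tk8 : nm Tk <= 8 * a.
  pose t := r / 3 ^+ k; have t_gt0 : 0 < t by rewrite divr_gt0 // exprn_gt0.
  have -> : 8 * a = 4 * ((3 ^ n0)%:R * (2 * t / 3 ^+ n0)) * (a / t).
    by rewrite sN; field; exact: lt0r_neq0.
  apply: square_sum_bound => [|z].
    by rewrite divr_ge0 ?exprn_ge0 // ltW // mulr_gt0.
  rewrite sN => /(bdry _ _ t_gt0)/andP[zt zt2].
  have zc0 : 0 < nm (z - c) by lra.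
  rewrite /g nmM nmV nmM.
  rewrite ler_pdivrMr; last by rewrite mulr_gt0.
  have zd : nm (z - c) < d by rewrite /t in zt2; lra.
  rewrite (le_trans (dP _ zd)) //; move: (nm (z - c)) zc0 zt => u u0 tu.
  have -> : a / t * (u * u) = (a * u) * (u / t) by field; exact: lt0r_neq0.
  by apply: ler_peMr; [rewrite mulr_ge0 // ltW|rewrite ler_pdivlMr // mul1r].
pose N := (3 ^ (n0 + k))%N; pose h := 2 * r / 3 ^+ (n0 + k).
have hE : h = 2 * r / N%:R by rewrite /h /N natrX.
have h_ge0 : 0 <= h by rewrite divr_ge0 ?exprn_ge0 // mulr_ge0 // ltW.
have N_gt0 : (0 < N)%N by rewrite expn_gt0.
have := square_sum_inv c r_gt0 N_gt0; rewrite -hE.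
set Ti := square_sum _ _ _ _ _ => Ti4.
have T1E : square_sum (fun z : R[i] => ((f z - f c) * ((z - c) * (z - c))^-1 : R[i])) N h (Re c - r) (Im c - r)
    = T0 + D * Ti.
  rewrite -square_sumZ -square_sumD; apply: eq_square_sum => z.
  rewrite /g; case: (eqVneq (z : K) c) => [->|zc].
    (* At z = c both sides are 0, by the convention that 0 is its own inverse. *)
    by rewrite !subrr mulr0 invr0 !mulr0 addr0.
  move: zc; rewrite -subr_eq0; move: (z - c) (f z - f c) => w p w0.
  suff alg (F : fieldType) (v q D' : F) : v != 0 ->
    q * (v * v)^-1 = (q - D' * v) * (v * v)^-1 + D' * v^-1 by exact: alg.
  by move=> v0; field.
(* The perimeter 8 r times the bound 2 M / r^2 of the integrand. *)
have T1b : nm (T0 + D * Ti) <= 16 * M / r.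
  rewrite -T1E.
  have -> : 16 * M / r = 4 * (N%:R * h) * (2 * M / r ^+ 2).
    by rewrite /N /h sN; field; exact: lt0r_neq0.
  apply: square_sum_bound => // z; rewrite /N /h sN => zb.
  have /andP[zt zt2] := bdry _ _ r_gt0 zb.
  have zc0 : 0 < nm (z - c) by lra.
  rewrite nmM nmV nmM ler_pdivrMr; last by rewrite mulr_gt0.
  have M0 : 0 <= M by rewrite (le_trans (nm_ge0 _) (fM _ cin)).
  rewrite (le_trans (nmB _ _)) // (le_trans (lerD (fM _ _) (fM _ cin))) //.
    by case: zb.
  have nn : r ^+ 2 <= nm (z - c) * nm (z - c) by rewrite expr2 ler_pM // ltW.
  rewrite -[_ / _ * _]mulrA [_^-1 * _]mulrC mulrA ler_pdivlMr ?exprn_gt0 //.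
  have -> : M + M = 2 * M by ring.
  by rewrite ler_wpM2l ?mulr_ge0.
have T0b : nm T0 <= 9 * a.
  have -> : T0 = (T0 - Tk) + Tk by rewrite subrK.
  by rewrite (le_trans (nmD _ _)) //; lra.
have : nm D * nm Ti <= 16 * M / r + 9 * a.
  rewrite -nmM; have -> : D * Ti = (T0 + D * Ti) - T0 by rewrite addrAC subrr add0r.
  by rewrite (le_trans (nmB _ _)) // lerD.
rewrite eE; apply: le_trans; rewrite ler_wpM2l //; exact: nm_ge0.
Qed.

End CauchyEstimate.

Section CauchyLimits.
Context {R : realType}.
Local Notation K := (KK R).
Local Open Scope complex_scope.

(** Completeness without a filter: the intervals [a - rho, a + rho] meet pairwise, hence have a
    common point, the supremum of the left ends. The index type is later a set of complex increments
    or the integers. *)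
Lemma real_cauchy_limit (T : Type) (a rho : T -> R) :
  (forall s t, `|a s - a t| <= rho s + rho t) ->
  exists l, forall t, `|a t - l| <= rho t.
Proof.
move=> H; case: (pselect (exists t0 : T, True)) => [[t0 _]|/forallNP T0]; last first.
  by exists 0 => t; case: (T0 t).
pose S := [set a t - rho t | t in [set: T]].
have ub t : ubound S (a t + rho t).
  by move=> _ [s _ <-]; have := H s t; rewrite ler_norml; lra.
exists (sup S) => t; rewrite ler_distlC; apply/andP; split.
  by apply: ub_le_sup; [exists (a t + rho t); exact: ub|exists t].
by apply: ge_sup; [exists (a t0 - rho t0); exists t0|exact: ub].
Qed.

Lemma complex_cauchy_limit (T : Type) (a : T -> R[i]) (rho : T -> R) :
  (forall s t, nm (a s - a t) <= rho s + rho t) ->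
  exists l, forall t, nm (a t - l) <= 2 * rho t.
Proof.
move=> H.
have [t|l1 l1P] := @real_cauchy_limit T (fun t => Re (a t)) rho.
  move=> s; apply: le_trans (H t s); apply: le_trans (Re_le_nm _).
  by case: (a t) (a s) => ? ? [].
have [t|l2 l2P] := @real_cauchy_limit T (fun t => Im (a t)) rho.
  move=> s; apply: le_trans (H t s); apply: le_trans (Im_le_nm _).
  by case: (a t) (a s) => ? ? [].
exists (l1 +i* l2) => t; rewrite (le_trans (nm_le_Re_Im _)) //.
have := l1P t; have := l2P t; case: (a t) => ? ? /=; lra.
Qed.

End CauchyLimits.

(** * Directional derivatives: mean value inequality and Cauchy's estimate *)

Section SecondDerivatives.
Context {R : realType}.
Local Notation K := (KK R).
Context {V : normedModType K}.
Implicit Types (f : V -> K) (x y u v w : V) (M r : R).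
Local Open Scope complex_scope.

Definition nv v : R := Re (`|v| : R[i]).

Lemma nvE v : `|v| = (nv v)%:C :> K.
Proof. by rewrite /nv RRe_real // normr_real. Qed.

Lemma nvD v w : nv (v + w) <= nv v + nv w.
Proof. by have := ler_normD v w; rewrite !nvE -rmorphD lecR. Qed.

Lemma nvN v : nv (- v) = nv v.
Proof. by rewrite /nv normrN. Qed.

Lemma nvZ (a : K) v : nv (a *: v) = nm a * nv v.
Proof.
have /eqP := normrZ a v; rewrite !nvE.
by rewrite (normE (a : R[i])) -rmorphM => /eqP/complexI.
Qed.

Lemma nv_ge0 v : 0 <= nv v.
Proof. by rewrite -lecR -nvE normr_ge0. Qed.

Lemma nv0 : nv 0 = 0.
Proof. by rewrite /nv normr0. Qed.

Lemma nv0_eq0 v : (nv v == 0) = (v == 0).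
Proof. by rewrite -(inj_eq (@complexI R)) -nvE normr_eq0. Qed.

Lemma nvB v w : nv (v - w) <= nv v + nv w.
Proof. by rewrite -(nvN w) nvD. Qed.

Lemma open_nvP (U : set V) x : open U -> U x ->
  exists2 r, 0 < r & forall y, nv (y - x) < r -> U y.
Proof.
move=> Uo Ux; have /nbhs_ballP[e /= /KK_posP[r r0 eE] eP] : nbhs x U by exact: open_nbhs_nbhs.
exists r => // y yr; apply: eP.
by rewrite -ball_normE /= distrC eE nvE ltcR.
Qed.

Lemma nv_open x r : open [set y | nv (y - x) < r].
Proof.
rewrite openE => y /= yr; apply/nbhs_ballP.
exists (r - nv (y - x))%:C => /=; first by rewrite ltcR subr_gt0.
move=> z; rewrite -ball_normE /= nvE ltcR => zy.
have -> : z - x = (y - x) - (y - z) by rewrite opprB [RHS]addrC subrKA.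
by rewrite (le_lt_trans (nvB _ _)) //; lra.
Qed.

Definition line f x v : K -> K := fun z => f (z *: v + x).

Lemma derivable_line f x v (z : K) : derivable f (z *: v + x) v ->
  differentiable (line f x v) z.
Proof.
rewrite /derivable => H; apply/derivable1_diffP; move: H; rewrite /derivable.
set g1 := fun h => _; set g2 := fun h => _; suff -> : g1 = g2 by [].
by apply/funext => h; rewrite /g1 /g2 /line /= scalerDl addrA [_%:A]mulr1.
Qed.

Lemma derive_line f x v (z : K) : 'D_1 (line f x v) z = 'D_v f (z *: v + x).
Proof.
rewrite /derive; set g1 := fun h => _; set g2 := fun h => _.
suff -> : g1 = g2 by [].
by apply/funext => h; rewrite /g1 /g2 /line /= scalerDl addrA [_%:A]mulr1.
Qed.

(** On short intervals differentiability gives the slope bound M + e, and such bounds add up over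
    consecutive intervals by the triangle inequality; [trisection] makes them global. *)
Lemma mean_value_bound f x u M :
  (forall t : R, 0 <= t <= 1 -> derivable f (t%:C *: u + x) u) ->
  (forall t : R, 0 <= t <= 1 -> nm ('D_u f (t%:C *: u + x)) <= M) ->
  nm (f (u + x) - f x) <= M.
Proof.
move=> fd fM; apply/ler_addgt0Pr => e e_gt0.
pose p (t : R) := line f x u t%:C.
suff : nm (p (0 + 1) - p 0) <= (M + e) * 1.
  by rewrite /p /line add0r mulr1 scale1r scale0r add0r.
apply: (@trisection R (fun a _ s => nm (p (a + s) - p a) <= (M + e) * s) 0 0 1) => //.
- move=> a _ s s_gt0 H.
  have := H (inord 0) (inord 0); have := H (inord 1) (inord 0).
  have := H (inord 2) (inord 0); rewrite !inordK // mul0r addr0 mul1r.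
  have -> : a + 2%:R * (s / 3) + s / 3 = a + s by field.
  have -> : a + s / 3 + s / 3 = a + 2%:R * (s / 3) by field.
  set p0 := p a; set p1 := p (a + s / 3); set p2 := p (a + 2%:R * (s / 3)).
  set p3 := p (a + s) => h2 h1 h0.
  have -> : p3 - p0 = (p3 - p2) + ((p2 - p1) + (p1 - p0)).
    by rewrite !addrA !subrK.
  have := nmD (p3 - p2) ((p2 - p1) + (p1 - p0)); have := nmD (p2 - p1) (p1 - p0).
  by lra.
move=> t t2 t01 _; rewrite add0r in t01.
have [d d_gt0 dP] := differentiable_cdiff (derivable_line (fd t t01)) e_gt0.
exists d => // a _ s /andP[s_gt0 sd] /andP[at1 at2] _.
have E (b : R) : nm (b%:C - t%:C) = `|b - t| by rewrite -rmorphB nm_real.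
have h1 : nm ((a + s)%:C - t%:C) < d by rewrite E ger0_norm ?subr_ge0 //; lra.
have h2 : nm (a%:C - t%:C) < d by rewrite E ler0_norm ?subr_le0 //; lra.
have := dP _ h1; have := dP _ h2; rewrite !E (@ler0_norm _ (a - t)) ?subr_le0 // ger0_norm ?subr_ge0 //.
rewrite derive_line -/(p a) -/(p t) -/(p (a + s)).
have := fM t t01; set D := 'D_u f _ => DM.
set q1 := p a - _ - _; set q2 := p (a + s) - _ - _ => b1 b2.
have -> : p (a + s) - p a = D * s%:C + (q2 - q1).
  rewrite /q1 /q2 rmorphD /=.
  move: (p (a + s)) (p a) (p t) (a%:C) (s%:C) (t%:C) => A B C a' s' t'.
  by rewrite (_ : a' + s' = s' + a') ?[s' + a']addrC //; ring.
have := nmD (D * s%:C) (q2 - q1); have := nmB q2 q1.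
rewrite nmM nm_real gtr0_norm // => b3 b4.
by have : nm D * s <= M * s; [rewrite ler_wpM2r // ltW|lra].
Qed.

(** The one-variable estimate on the complex line through x in the direction v. *)
Lemma cauchy_estimate_dir f x v r M : 0 < r ->
  (forall y, nv (y - x) < r -> derivable f y v) ->
  (forall y, nv (y - x) < r -> nm (f y) <= M) ->
  nm ('D_v f x) <= 12 * M * nv v / r.
Proof.
move=> r_gt0 fd fM; have [->|v0] := eqVneq v 0.
  by rewrite derive0 nm0 nv0 mulr0 mul0r.
have nv_gt0 : 0 < nv v by rewrite lt_def nv_ge0 nv0_eq0 v0.
(* Points of the square of half-side t have modulus at most 2 t, less than r / nv v; the factor 3
   turns the constant 4 into 12. *)
pose t := r / (3 * nv v); have t_gt0 : 0 < t by rewrite divr_gt0 // mulr_gt0.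
have tE : 3 * t * nv v = r by rewrite /t; field; exact: lt0r_neq0.
have inb (z : R[i]) : on_square (Re (0 : R[i]) - t) (Im (0 : R[i]) - t) (2 * t) z ->
    nv (z *: v + x - x) < r.
  rewrite /on_square /= !sub0r => -[zx zy]; rewrite addrK nvZ -tE ltr_pM2r //.
  have := nm_le_Re_Im z; have : `|Re z| <= t by rewrite ler_norml; lra.
  have : `|Im z| <= t by rewrite ler_norml; lra.
  by lra.
have -> : 12 * M * nv v / r = 4 * M / t.
  by rewrite -tE; field; rewrite !lt0r_neq0.
have -> : 'D_v f x = 'D_1 (line f x v) (0 : K) by rewrite derive_line scale0r add0r.
apply: (cauchy_estimate t_gt0) => z zS.
  by apply: derivable_line; apply: fd; apply: inb.
by apply: fM; apply: inb.
Qed.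

End SecondDerivatives.

(** * Smoothness of holomorphic functions *)

Section Smoothness.
Context {R : realType}.
Local Notation K := (KK R).
Context {V : normedModType K}.
Implicit Types (f : V -> K) (x y z u v w : V).
Local Open Scope complex_scope.

Lemma bounded_linear_nv_continuous (L : {linear V -> K}) (B : R) :
  (forall w, nm (L w) <= B * nv w) -> continuous L.
Proof.
move=> LB x; apply/cvgrPdist_le => e /KK_posP[d d_gt0 ->].
have B1 : 0 < `|B| + 1 by rewrite ltr_wpDl.
apply/nbhs_ballP; exists (d / (`|B| + 1))%:C => /=; first by rewrite ltcR divr_gt0.
move=> y; rewrite -ball_normE /= nvE ltcR ltr_pdivlMr // => yd.
rewrite -linearB normE lecR (le_trans (LB _)) // (le_trans _ (ltW yd)) //.
by rewrite mulrC ler_wpM2l ?nv_ge0 // (le_trans (ler_norm _)) // lerDl.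
Qed.

Lemma derivable_shiftl f u x v : derivable f (u + x) v ->
  derivable (fun y => f (u + y)) x v.
Proof.
rewrite /derivable; set g1 := fun h => _; set g2 := fun h => _; suff -> : g1 = g2 by [].
by apply/funext => h; rewrite /g1 /g2 /= addrCA.
Qed.

Lemma derive_shiftl f u x v : 'D_v (fun y => f (u + y)) x = 'D_v f (u + x).
Proof.
rewrite /derive; set g1 := fun h => _; set g2 := fun h => _; suff -> : g1 = g2 by [].
by apply/funext => h; rewrite /g1 /g2 /= addrCA.
Qed.

Section Local.
Variables (f : V -> K) (x0 : V) (r M : R).
Hypotheses (r_gt0 : 0 < r).
Hypothesis fd : forall y, nv (y - x0) < 4 * r -> differentiable f y.
Hypothesis fM : forall y, nv (y - x0) < 4 * r -> nm (f y) <= M.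

(** Lipschitz constants of f and of its derivative: Cauchy's estimate on balls of radius r for f
    itself, then of radius r / 2 for the increments of f, which [L] controls. *)
Let L : R := 12 * M / r.
Let L2 : R := 24 * L / r.

Let M_ge0 : 0 <= M.
Proof. by rewrite (le_trans (nm_ge0 (f x0))) // fM // subrr nv0 mulr_gt0. Qed.

Let L_ge0 : 0 <= L.
Proof. by apply: divr_ge0; [exact: mulr_ge0|exact: ltW]. Qed.

Let L2_ge0 : 0 <= L2.
Proof. by apply: divr_ge0; [exact: mulr_ge0|exact: ltW]. Qed.

Let nvS x y z : nv (x - z) <= nv (x - y) + nv (y - z).
Proof. by rewrite (le_trans _ (nvD _ _)) // subrKA. Qed.

Let nvS' u y z : nv (u + y - z) <= nv u + nv (y - z).
Proof. by rewrite -addrA nvD. Qed.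

Lemma local_derive_bound y v : nv (y - x0) < 3 * r -> nm ('D_v f y) <= L * nv v.
Proof.
have r0 : 0 < r := r_gt0.
move=> yr; have -> : L * nv v = 12 * M * nv v / r by rewrite /L mulrAC.
have B z : nv (z - y) < r -> nv (z - x0) < 4 * r by have := nvS z y x0; lra.
apply: cauchy_estimate_dir => // z /B zr; last exact: fM.
by apply: diff_derivable; exact: fd.
Qed.

Lemma local_lipschitz y u : nv (y - x0) + nv u < 3 * r ->
  nm (f (u + y) - f y) <= L * nv u.
Proof.
have r0 : 0 < r := r_gt0.
move=> yur.
have B (t : R) : 0 <= t <= 1 -> nv (t%:C *: u + y - x0) < 3 * r.
  move=> /andP[t0 t1]; have := nvS' (t%:C *: u) y x0; rewrite nvZ nm_real ger0_norm //.
  have : t * nv u <= nv u by rewrite ler_piMl ?nv_ge0.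
  by lra.
apply: mean_value_bound => t /B tr; last exact: local_derive_bound.
by apply: diff_derivable; apply: fd; apply: lt_trans tr _; lra.
Qed.

(** The increment y |-> f (u + y) - f y is a differentiable function of size at most L nv u, so
    Cauchy's estimate bounds its derivative. *)
Lemma local_derive_lipschitz y u v : nv (y - x0) < 2 * r -> nv u < r / 2 ->
  nm ('D_v f (u + y) - 'D_v f y) <= L2 * nv u * nv v.
Proof.
have r0 : 0 < r := r_gt0.
move=> yr ur.
have B z : nv (z - y) < r / 2 -> nv (z - x0) + nv u < 3 * r.
  by have := nvS z y x0; lra.
have D z : nv (z - x0) + nv u < 3 * r ->
    derivable (fun y => f (u + y)) z v /\ derivable f z v.
  move=> zr; split; last by apply: diff_derivable; apply: fd; have := nv_ge0 u; lra.
  apply: derivable_shiftl; apply: diff_derivable; apply: fd.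
  by have := nvS' u z x0; lra.
have yr' : nv (y - x0) + nv u < 3 * r by lra.
have [D1 D2] := D y yr'.
have -> : 'D_v f (u + y) - 'D_v f y = 'D_v ((fun y => f (u + y)) - f) y.
  by rewrite (deriveB D1 D2) derive_shiftl.
have -> : L2 * nv u * nv v = 12 * (L * nv u) * nv v / (r / 2).
  by rewrite /L2; field; exact: lt0r_neq0.
apply: cauchy_estimate_dir => [|z /B zr|z /B zr]; first by rewrite divr_gt0.
  by have [d1 d2] := D z zr; exact: (derivableB d1 d2).
exact: local_lipschitz.
Qed.

(** The mean value inequality applied to f minus its differential at y, whose derivative along the
    segment is controlled by [local_derive_lipschitz]. *)
Lemma local_taylor y u : nv (y - x0) < 2 * r -> nv u < r / 2 ->
  nm (f (u + y) - f y - 'D_u f y) <= L2 * nv u ^+ 2.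
Proof.
have r0 : 0 < r := r_gt0.
move=> yr ur.
have dfy : differentiable f y by apply: fd; lra.
have dc : continuous ('d f y) by exact: diff_continuous.
pose g := f - ('d f y : V -> K).
have -> : f (u + y) - f y - 'D_u f y = g (u + y) - g y.
  rewrite deriveE // /g; rewrite -[(f - _) (u + y)]/(f (u + y) - 'd f y (u + y)).
  rewrite -[(f - _) y]/(f y - 'd f y y) linearD.
  suff alg (Z : comPzRingType) (a b c d : Z) : a - b - c = a - (c + d) - (b - d).
    exact: alg.
  by ring.
have B (t : R) : 0 <= t <= 1 -> nv (t%:C *: u) <= nv u.
  by move=> /andP[t0 t1]; rewrite nvZ nm_real ger0_norm // ler_piMl ?nv_ge0.
have D (t : R) : 0 <= t <= 1 -> derivable f (t%:C *: u + y) u.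
  move=> /B tu; apply: diff_derivable; apply: fd.
  by apply: le_lt_trans (nvS' (t%:C *: u) y x0) _; lra.
have D' z : is_derive z u ('d f y) ('d f y u).
  have dd : differentiable ('d f y) z by exact: linear_differentiable.
  apply: DeriveDef; first exact: diff_derivable.
  by rewrite deriveE // diff_lin.
apply: mean_value_bound => t t01.
  by apply: derivableB; [exact: D|have [] := D' (t%:C *: u + y)].
have D2 : derivable ('d f y) (t%:C *: u + y) u by have [] := D' (t%:C *: u + y).
rewrite /g (deriveB (D t t01) D2).
have -> : 'D_u ('d f y) (t%:C *: u + y) = 'D_u f y.
  by have [_ ->] := D' (t%:C *: u + y); rewrite deriveE.
have tu := B t t01.
have tr : nv (t%:C *: u) < r / 2 by lra.
rewrite (le_trans (local_derive_lipschitz u yr tr)) //.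
rewrite expr2 mulrA ler_wpM2r ?nv_ge0 // ler_wpM2l //.
Qed.

(** As 'D_w f is not yet known to be differentiable, difference quotients in the direction w are
    compared with each other. They differ from 'D_w f by O(|h|) uniformly, so q_h - q_k is O(|h| +
    |k|); by Cauchy's estimate so is its derivative along v. These derivatives thus form a Cauchy
    family, and they are the difference quotients of 'D_v f. *)
Lemma local_derivable2 y v w : nv (y - x0) < r -> derivable (fun z => 'D_v f z) y w.
Proof.
have r0 : 0 < r := r_gt0.
move=> yr.
(* The admissible increments, which index the Cauchy family. *)
pose T := {h : K | h != 0 /\ nm h * nv w < r / 2}.
pose C1 := 24 * L2 * nv w ^+ 2 * nv v / r.
pose F (h : K) : K := h^-1 * ('D_v f (h *: w + y) - 'D_v f y).
have B z : nv (z - y) < r / 2 -> nv (z - x0) < 2 * r by have := nvS z y x0; lra.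
have dz z (h : K) : nv (z - x0) < 2 * r -> nm h * nv w < r / 2 ->
    derivable (fun y => f (h *: w + y)) z v /\ derivable f z v.
  move=> zr hr; split; last by apply: diff_derivable; apply: fd; lra.
  apply: derivable_shiftl; apply: diff_derivable; apply: fd.
  by have := nvS' (h *: w) z x0; rewrite nvZ; lra.
have yr2 : nv (y - x0) < 2 * r by lra.
have [l lP] : exists l, forall h : T, nm (F (sval h) - l) <= 2 * (C1 * nm (sval h)).
  apply: (@complex_cauchy_limit R T (fun h => F (sval h))).
  move=> [h [h0 hr]] [k [k0 kr]] /=.
  pose q (h : K) : V -> K := h^-1 \*: ((fun y => f (h *: w + y)) - f).
  have qD z (j : K) : nv (z - x0) < 2 * r -> nm j * nv w < r / 2 -> derivable (q j) z v.
    move=> zr jr; have [d1 d2] := dz z j zr jr.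
    by apply: derivableZ; exact: (derivableB d1 d2).
  have qE (j : K) : nm j * nv w < r / 2 -> 'D_v (q j) y = F j.
    move=> jr; have [d1 d2] := dz y j yr2 jr.
    by rewrite (@deriveZ _ _ _ _ j^-1 _ _ (derivableB d1 d2)) (deriveB d1 d2) derive_shiftl.
  have qB z (j : K) : nv (z - x0) < 2 * r -> j != 0 -> nm j * nv w < r / 2 ->
      nm (q j z - 'D_w f z) <= L2 * nv w ^+ 2 * nm j.
    move=> zr j0 jr; have jr' : nv (j *: w) < r / 2 by rewrite nvZ.
    have := local_taylor zr jr'.
    have -> : 'D_(j *: w) f z = j * 'D_w f z.
      by rewrite !deriveE ?linearZ //; apply: fd; lra.
    have -> : f (j *: w + z) - f z - j * 'D_w f z = j * (q j z - 'D_w f z).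
      rewrite mulrBr /q; congr (_ - _); rewrite -[(_ \*: _) z]/(j^-1 * (f (j *: w + z) - f z)).
      by rewrite mulVKf.
    rewrite nmM nvZ exprMn => H; have jn : 0 < nm j by rewrite nm_gt0.
    rewrite -(ler_pM2l jn) (le_trans H) // expr2.
    by rewrite le_eqVlt; apply/orP; left; apply/eqP; ring.
  rewrite -(qE h hr) -(qE k kr) -(deriveB (qD y h yr2 hr) (qD y k yr2 kr)).
  have -> : C1 * nm h + C1 * nm k =
      12 * (L2 * nv w ^+ 2 * nm h + L2 * nv w ^+ 2 * nm k) * nv v / (r / 2).
    by rewrite /C1; field; exact: lt0r_neq0.
  apply: cauchy_estimate_dir => [|z /B zr|z /B zr]; first by rewrite divr_gt0.
    by apply: derivableB; exact: qD.
  rewrite -[(q h - q k) z]/(q h z - q k z) -[q h z](subrK ('D_w f z)) -addrA.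
  rewrite (le_trans (nmD _ _)) // lerD ?qB //.
  by rewrite nm_distC qB.
apply/cvg_ex; exists l; apply/cvgrPdist_le => e /KK_posP[d d_gt0 ->].
pose d1 := d / (2 * C1 + 1); pose d2 := r / 2 / (nv w + 1).
have C1_ge0 : 0 <= C1.
  apply: divr_ge0 (ltW r0); apply: mulr_ge0 (nv_ge0 v).
  by apply: mulr_ge0 (exprn_ge0 _ (nv_ge0 w)); exact: mulr_ge0.
have c1 : 0 < 2 * C1 + 1 by lra.
have w1 : 0 < nv w + 1 by have := nv_ge0 w; lra.
have d1_gt0 : 0 < d1 by rewrite divr_gt0.
have d2_gt0 : 0 < d2 by rewrite !divr_gt0.
near=> h.
have h0 : h != 0 by near: h; exact: nbhs_dnbhs_neq.
have hd1 : nm h < d1.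
  by rewrite -ltcR -normE; near: h; apply: dnbhs0_lt; rewrite ltcR.
have hd2 : nm h < d2.
  by rewrite -ltcR -normE; near: h; apply: dnbhs0_lt; rewrite ltcR.
have hr : nm h * nv w < r / 2.
  by move: hd2; rewrite /d2 ltr_pdivlMr // mulrDr mulr1; have := nm_ge0 h; lra.
have := lP (exist _ h (conj h0 hr)); rewrite /= => H.
rewrite distrC normE lecR (le_trans H) //.
move: hd1; rewrite /d1 ltr_pdivlMr //; have := nm_ge0 h; nra.
Unshelve. all: by end_near. Qed.

(** The candidate differential sends w to the mixed derivative in the other order, so
    differentiability and symmetry come together. The remainder is the derivative along v of the
    Taylor remainder of f, hence quadratic in w by Cauchy's estimate. *)
Lemma local_derive_diff v :
  differentiable (fun z => 'D_v f z) x0 /\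
  forall w, 'D_w (fun z => 'D_v f z) x0 = 'D_v (fun z => 'D_w f z) x0.
Proof.
have r0 : 0 < r := r_gt0.
have x0r t : 0 < t -> nv (x0 - x0) < t by rewrite subrr nv0.
pose D w : K := 'D_v (fun z => 'D_w f z) x0.
have D_lin : linear D.
  move=> a w w'; rewrite /D.
  have d1 := @local_derivable2 x0 w v (x0r _ r0); have d2 := @local_derivable2 x0 w' v (x0r _ r0).
  have d1' := @derivableZ _ _ _ _ a _ _ d1; have d12 := deriveD d1' d2.
  rewrite (@deriveZ _ _ _ _ a _ _ d1) in d12; apply: etrans d12; apply: near_eq_derive.
  have : nbhs x0 [set z | nv (z - x0) < r].
    by apply: open_nbhs_nbhs; split; [exact: nv_open|exact: x0r].
  apply: filterS => z /= zr.
  have dz : differentiable f z by apply: fd; lra.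
  rewrite -[RHS]/(a * 'D_w f z + 'D_w' f z).
  by rewrite (deriveE _ dz) (deriveE w dz) (deriveE w' dz) linearP.
pose Dlin := GRing.isLinear.Build _ _ _ _ D D_lin.
pose DL : {linear V -> K} := HB.pack D Dlin.
have Dc : continuous DL.
  apply: (@bounded_linear_nv_continuous _ (12 * L * nv v / r)) => w.
  have -> : 12 * L * nv v / r * nv w = 12 * (L * nv w) * nv v / r by ring.
  apply: cauchy_estimate_dir => // z zr; first by apply: local_derivable2.
  by apply: local_derive_bound; lra.
suff H : is_diff x0 (fun z => 'D_v f z) DL.
  have [dv dE] := H; split=> [|w]; first exact: dv.
  exact: (etrans (deriveE w dv) (congr1 (@^~ w) dE)).
apply: eps_diff => // e /KK_posP[d d_gt0 ->].
pose C2 := 24 * L2 * nv v / r.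
have C2_ge0 : 0 <= C2 
  by apply: divr_ge0 (ltW r0); apply: mulr_ge0 (nv_ge0 v); exact: mulr_ge0.
have c2 : 0 < C2 + 1 by lra.
exists (Num.min (r / 2) (d / (C2 + 1)))%:C; first by rewrite ltcR lt_min !divr_gt0.
move=> w; rewrite nvE ltcR lt_min => /andP[wr wd].
rewrite -rmorphM normE lecR.
have q1 z : nv (z - x0) < r / 2 -> derivable (fun z => f (w + z)) z v /\ derivable f z v.
  move=> zr; split; last by apply: diff_derivable; apply: fd; lra.
  apply: derivable_shiftl; apply: diff_derivable; apply: fd.
  by have := nvS' w z x0; lra.
have q2 z : nv (z - x0) < r / 2 -> derivable (fun z => 'D_w f z) z v.
  by move=> zr; apply: local_derivable2; lra.
have xr2 : nv (x0 - x0) < r / 2 by apply: x0r; rewrite divr_gt0.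
have [q1x q1x'] := q1 _ xr2; have q2x := q2 _ xr2.
have -> : 'D_v f (w + x0) - 'D_v f x0 - DL w =
    'D_v ((fun z => f (w + z)) - f - (fun z => 'D_w f z)) x0.
  by rewrite (deriveB (derivableB q1x q1x') q2x) (deriveB q1x q1x') derive_shiftl.
have : nm ('D_v ((fun z => f (w + z)) - f - (fun z => 'D_w f z)) x0) <=
    12 * (L2 * nv w ^+ 2) * nv v / (r / 2).
  apply: cauchy_estimate_dir => [|z zr|z zr]; first by rewrite divr_gt0.
    have [d1 d2] := q1 _ zr; exact: (derivableB (derivableB d1 d2) (q2 _ zr)).
  by apply: local_taylor => //; lra.
have -> : 12 * (L2 * nv w ^+ 2) * nv v / (r / 2) = C2 * nv w * nv w.
  by rewrite /C2; field; exact: lt0r_neq0.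
move=> /le_trans; apply; rewrite ler_wpM2r ?nv_ge0 //.
move: wd; rewrite ltr_pdivlMr //; have := nv_ge0 w; nra.
Qed.

End Local.

Lemma holomorphic_local_bound (I : finType) (U : set V) (f : I -> V -> K) x :
  open U -> (forall i, holomorphic_on U (f i)) -> U x ->
  exists r M, [/\ 0 < r, 0 <= M, forall y, nv (y - x) < 4 * r -> U y &
    forall i y, nv (y - x) < 4 * r -> nm (f i y) <= M].
Proof.
move=> Uo fU Ux.
have : \forall y \near x, U y /\ forall i, nm (f i y) <= nm (f i x) + 1.
  apply: filterI; first exact: open_nbhs_nbhs.
  apply: filter_forall => i.
  have /cvgrPdist_lt/(_ 1 ltr01) : {for x, continuous (f i)}.
    by apply: differentiable_continuous; exact: fU.
  apply: filterS => y; rewrite normE -[1]/(1%:C) ltcR => fxy.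
  have := nmB (f i x) (f i x - f i y); rewrite opprB addrC subrK; lra.
move=> /nbhs_ballP[e /= /KK_posP[r r_gt0 ->] rP].
exists (r / 4), (\sum_i (nm (f i x) + 1)).
have r4 : 4 * (r / 4) = r by field.
have {}rP y : nv (y - x) < 4 * (r / 4) -> U y /\ forall i, nm (f i y) <= nm (f i x) + 1.
  by rewrite r4 => yr; apply: rP; rewrite -ball_normE /= distrC nvE ltcR.
split; first by rewrite divr_gt0.
- by apply: sumr_ge0 => i _; rewrite addr_ge0 // nm_ge0.
- by move=> y /rP[].
move=> i y /rP[_ /(_ i)] /le_trans; apply.
rewrite (bigD1 i) //= lerDl sumr_ge0 // => j _.
by rewrite addr_ge0 // nm_ge0.
Qed.

Theorem holomorphic_derive (U : set V) f v : open U -> holomorphic_on U f ->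
  holomorphic_on U (fun x => 'D_v f x) /\
  forall w x, U x -> 'D_w (fun y => 'D_v f y) x = 'D_v (fun y => 'D_w f y) x.
Proof.
move=> Uo fU.
suff H x : U x -> exists r M, [/\ 0 < r,
    forall y, nv (y - x) < 4 * r -> differentiable f y &
    forall y, nv (y - x) < 4 * r -> nm (f y) <= M].
  split=> [x|w x] /H[r [M [r_gt0 fd fM]]].
    exact: (proj1 (local_derive_diff r_gt0 fd fM v)).
  exact: (proj2 (local_derive_diff r_gt0 fd fM v) w).
move=> Ux.
have [r [M [r_gt0 _ rU rM]]] := holomorphic_local_bound Uo (fun _ : unit => fU) Ux.
by exists r, M; split => // y yr; [apply: fU; exact: rU|exact: (rM tt)].
Qed.

End Smoothness.

(** * Primitives and exponentials of closed forms *)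

Section Primitive.
Context {R : realType} {m : nat}.
Local Notation K := (KK R).
Local Notation V := 'rV[K]_m.
Implicit Types (f : V -> K) (x y z u v : V).
Local Open Scope complex_scope.

Lemma nm_coord_le v k : nm (v 0 k) <= nv v.
Proof.
rewrite -lecR -nvE -normE [leRHS]/Num.Def.normr /= mx_normE.
by rewrite -[leLHS]nngE num_le; exact: (le_bigmax _ _ (0, k)).
Qed.

Lemma derive_coord f x v : differentiable f x ->
  'D_v f x = \sum_k v 0 k * pd k f x.
Proof.
move=> df; rewrite deriveE // {1}[v]row_sum_delta linear_sum.
by apply: eq_bigr => k _; rewrite linearZ /= /pd deriveE.
Qed.

Variables (U : set V) (x0 : V) (w : 'I_m -> V -> K).
Hypotheses (Uo : open U) (Ux0 : U x0).
Hypothesis w_hol : forall k, holomorphic_on U (w k).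
Hypothesis w_closed : forall x k l, U x -> pd k (w l) x = pd l (w k) x.

Let ray (a : K) x : V := a *: (x - x0) + x0.

Lemma derive_ray f a x v : differentiable f (ray a x) ->
  derivable (f \o ray a) x v /\ 'D_v (f \o ray a) x = a * 'D_v f (ray a x).
Proof.
move=> df.
have E : (fun h => h^-1 *: ((f \o shift (ray a x)) (h *: (a *: v)) - f (ray a x))) =
         (fun h => h^-1 *: (((f \o ray a) \o shift x) (h *: v) - (f \o ray a) x)).
  apply/funext => h /=; congr (_ *: (f _ - _)).
  by rewrite /ray -[h *: v + x - x0]addrA [in RHS]scalerDr addrA !scalerA [a * h]mulrC.
split; first by rewrite /derivable -E; exact: diff_derivable.
have -> : 'D_v (f \o ray a) x = 'D_(a *: v) f (ray a x) by rewrite /derive -E.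
by rewrite !deriveE // linearZ.
Qed.

Let term (a : K) k : V -> K := (fun x => (x - x0) 0 k) * (w k \o ray a).

Lemma derive_term a k x v : U (ray a x) ->
  derivable (term a k) x v /\
  'D_v (term a k) x = (x - x0) 0 k * (a * 'D_v (w k) (ray a x)) + w k (ray a x) * v 0 k.
Proof.
move=> Ur; have [d1 e1] := derive_ray (f := w k) (a := a) (x := x) v (w_hol k Ur).
have [d2 e2] : derivable (fun x => (x - x0) 0 k) x v /\
    'D_v (fun x => (x - x0) 0 k) x = v 0 k.
  have E : (fun h : K => h^-1 *: (((fun x => (x - x0) 0 k) \o shift x) (h *: v) - (x - x0) 0 k))
      = (fun h => h^-1 *: (h * v 0 k)).
    by apply/funext => h /=; rewrite !mxE; congr (_ *: _); rewrite -[_ + _ - x0 0 k]addrA addrK.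
  suff H : (fun h : K => h^-1 *: (h * v 0 k)) @ 0^' --> v 0 k.
    split; first by rewrite /derivable E; apply/cvg_ex; exists (v 0 k).
    by rewrite /derive E; exact: cvg_lim.
  apply/cvgrPdist_le => e e_gt0; near=> h.
  rewrite /GRing.scale /= mulKf ?subrr ?normr0 ?ltW //.
  by near: h; exact: nbhs_dnbhs_neq.
split; first exact: derivableM.
by rewrite (deriveM d2 d1) e1 e2.
Unshelve. all: by end_near. Qed.

(* Riemann sums of the integral of w along the segment from x0 to x.          *)
Let rsum (N : nat) : V -> K :=
  N%:R^-1 \*: \sum_(j < N) \sum_(k < m) term (j%:R / N%:R) k.

Lemma diff_rsum N x : (forall j : 'I_N, U (ray (j%:R / N%:R) x)) ->
  differentiable (rsum N) x.
Proof.
move=> Ur; apply: differentiableZ; apply: differentiable_sum => j.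
apply: differentiable_sum => k; apply: differentiableM.
  apply: (@differentiable_comp _ _ _ _ (fun y => y - x0) (fun y : V => y 0 k)).
    by apply: differentiableB; [exact: ex_diff|exact: differentiable_cst].
  exact: differentiable_coord.
apply: differentiable_comp; last exact: (w_hol k (Ur j)).
apply: differentiableD; last exact: differentiable_cst.
apply: differentiableZ; apply: differentiableB; last exact: differentiable_cst.
exact: ex_diff.
Qed.

Lemma rsum0 N : rsum N x0 = 0.
Proof.
rewrite /rsum -[LHS]/(N%:R^-1 * (\sum_(j < N) \sum_(k < m) term (j%:R / N%:R) k) x0).
rewrite fct_sumE big1 ?mulr0 // => j _; rewrite fct_sumE big1 // => k _.
by rewrite -[LHS]/((x0 - x0) 0 k * _) subrr mxE mul0r.
Qed.

(** Closedness replaces the derivatives of the w_k along l by those of w_l along k, and their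
    combination is the derivative of w_l along the ray. *)
Lemma derive_rsum N x l : (forall j : 'I_N, U (ray (j%:R / N%:R) x)) ->
  (forall v, derivable (rsum N) x v) /\
  pd l (rsum N) x = N%:R^-1 * \sum_(j < N) (w l (ray (j%:R / N%:R) x) +
     j%:R / N%:R * 'D_(x - x0) (w l) (ray (j%:R / N%:R) x)).
Proof.
move=> Ur.
have dt v (j : 'I_N) k := proj1 (@derive_term (j%:R / N%:R) k x v (Ur j)).
have ds v (j : 'I_N) : derivable (\sum_(k < m) term (j%:R / N%:R) k) x v.
  by apply: derivable_sum => k; exact: dt.
have dss v : derivable (\sum_(j < N) \sum_(k < m) term (j%:R / N%:R) k) x v.
  by apply: derivable_sum => j; exact: ds.
split=> [v|]; first exact: derivableZ.
rewrite /pd (@deriveZ _ _ _ _ _ _ _ (dss _)); congr (_ * _).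
rewrite derive_sum; last by move=> j; exact: ds.
apply: eq_bigr => j _; rewrite derive_sum; last by move=> k; exact: dt.
under eq_bigr => k _ do rewrite (proj2 (derive_term k _ (Ur j))).
rewrite big_split /= addrC; congr (_ + _).
  rewrite (bigD1 l) //= mxE !eqxx mulr1 big1 ?addr0 // => k kl.
  by rewrite mxE eqxx (negbTE kl) mulr0.
rewrite (derive_coord _ (w_hol l (Ur j))) mulr_sumr; apply: eq_bigr => k _.
by rewrite (w_closed k l (Ur j)) mulrCA.
Qed.

(** The partial derivatives of the Riemann sums converge to w with error O(1/N). The sums all vanish
    at x0, so the mean value inequality makes them converge too, and first-order expansions uniform
    in N pass to the limit. *)
Lemma closed_form_primitive : exists (W : set V) (F : V -> K),
  [/\ open W, W x0, W `<=` U &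
      forall x, W x -> differentiable F x /\ forall k, pd k F x = w k x].
Proof.
have [r [M [r_gt0 M_ge0 rU rM]]] := holomorphic_local_bound Uo w_hol Ux0.
pose L := 12 * M / r; pose L2 := 24 * L / r.
have wd k y : nv (y - x0) < 4 * r -> differentiable (w k) y.
  by move=> /rU Uy; exact: w_hol.
have wL k y u : nv (y - x0) + nv u < 3 * r -> nm (w k (u + y) - w k y) <= L * nv u.
  exact: (@local_lipschitz _ _ (w k) x0 r M r_gt0 (wd k) (rM k)).
have wB k y v : nv (y - x0) < 3 * r -> nm ('D_v (w k) y) <= L * nv v.
  exact: (@local_derive_bound _ _ (w k) x0 r M r_gt0 (wd k) (rM k)).
have wT k y u : nv (y - x0) < 2 * r -> nv u < r / 2 ->
    nm (w k (u + y) - w k y - 'D_u (w k) y) <= L2 * nv u ^+ 2.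
  exact: (@local_taylor _ _ (w k) x0 r M r_gt0 (wd k) (rM k)).
pose W := [set x | nv (x - x0) < r / 2].
have Wray (t : R) x : 0 <= t <= 1 -> W x -> nv (ray t%:C x - x0) < r / 2.
  move=> /andP[t0 t1]; rewrite /W /= /ray addrK nvZ nm_real ger0_norm //.
  by apply: le_lt_trans; rewrite ler_piMl ?nv_ge0.
have fracE N j : (j%:R / N%:R : K) = (j%:R / N%:R : R)%:C.
  by rewrite fmorph_div /= !rmorph_nat.
have fracP N (j : 'I_N) : 0 <= (j%:R / N%:R : R) <= 1.
  have N0 : (0 : R) < N%:R by rewrite ltr0n (leq_ltn_trans _ (ltn_ord j)).
  by rewrite divr_ge0 ?ler0n //= ler_pdivrMr // mul1r ler_nat ltnW.
have Uray N (j : 'I_N) x : W x -> U (ray (j%:R / N%:R) x).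
  by move=> Wx; apply: rU; rewrite fracE; have := Wray _ _ (fracP N j) Wx; lra.
have L_ge0 : 0 <= L by apply: divr_ge0 (ltW r_gt0); exact: mulr_ge0.
have L2_ge0 : 0 <= L2 by apply: divr_ge0 (ltW r_gt0); exact: mulr_ge0.
(* Each of the N terms below has error at most L2 (r / N)^2 + (1 / N) L (r / N). *)
pose C0 := L2 * r ^+ 2 + L * r.
have C0_ge0 : 0 <= C0.
  by apply: addr_ge0; apply: mulr_ge0 => //; [exact: sqr_ge0|exact: ltW].
have n_gt0 n : (0 : R) < n.+1%:R by rewrite ltr0n.
have stepA n l x : W x -> nm (pd l (rsum n.+1) x - w l x) <= C0 / n.+1%:R.
  move=> Wx; rewrite (proj2 (derive_rsum l (fun j => Uray _ j _ Wx))).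
  set N := n.+1; pose a (j : nat) : K := j%:R / N%:R; pose p j := ray (a j) x.
  have N0 : (N%:R : K) != 0 by rewrite pnatr_eq0.
  have aN : a N = 1 by rewrite /a divff.
  (* The derivative of t w_l along the ray integrates to w_l x; its discrete form telescopes. *)
  have -> : w l x = \sum_(j < N) (a j.+1 * w l (p j.+1) - a j * w l (p j)).
    rewrite -(big_mkord xpredT (fun j => a j.+1 * w l (p j.+1) - a j * w l (p j))).
    rewrite (telescope_sumr (fun j => a j * w l (p j))) // aN mul1r /p aN /ray.
    by rewrite scale1r subrK /a mul0r mul0r subr0.
  rewrite mulr_sumr -sumrB (le_trans (nm_sum _ _ _)) //.
  have -> : C0 / N%:R = \sum_(j < N) (C0 / N%:R ^+ 2).
    rewrite sumr_const card_ord -[_ *+ N]mulr_natl; field; exact: lt0r_neq0.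
  apply: ler_sum => j _; rewrite -/(a j) -/(p j).
  pose u := (N%:R^-1 : K) *: (x - x0).
  have aS : a j.+1 = a j + N%:R^-1 by rewrite /a -natr1 mulrDl mul1r.
  have pS : p j.+1 = u + p j.
    by rewrite /p /ray aS scalerDl -/u addrAC [u + _]addrC addrAC.
  have Up : U (p j) by exact: Uray.
  have Du : 'D_u (w l) (p j) = N%:R^-1 * 'D_(x - x0) (w l) (p j).
    by rewrite (deriveE _ (w_hol l Up)) (deriveE _ (w_hol l Up)) /u linearZ.
  have -> : N%:R^-1 * (w l (p j) + a j * 'D_(x - x0) (w l) (p j))
      - (a j.+1 * w l (p j.+1) - a j * w l (p j))
      = - (a j.+1 * (w l (u + p j) - w l (p j) - 'D_u (w l) (p j))
           + N%:R^-1 * 'D_u (w l) (p j)).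
    rewrite Du pS aS.
    suff alg (Z : comPzRingType) (i g g' c d : Z) :
        i * (g + c * d) - ((c + i) * g' - c * g) =
        - ((c + i) * (g' - g - i * d) + i * (i * d)) by exact: alg.
    by ring.
  have nu : nv u = nv (x - x0) / N%:R by rewrite /u nvZ nmV nm_nat mulrC.
  have hr : nv (x - x0) < r / 2 by exact: Wx.
  have nur : nv u <= r / N%:R by rewrite nu ler_pM2r ?invr_gt0 //; lra.
  have nur2 : nv u < r / 2.
    apply: le_lt_trans hr; rewrite nu ler_pdivrMr // ler_peMr ?nv_ge0 //.
    by rewrite ler1n.
  have pr : nv (p j - x0) < r / 2.
    by rewrite /p /a fracE; apply: Wray => //; exact: fracP.
  have r2 : r / 2 < 2 * r by lra.
  have r3 : r / 2 < 3 * r by lra.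
  have pr2 := lt_trans pr r2; have pr3 := lt_trans pr r3.
  have a1 : nm (a j.+1) <= 1.
    rewrite /a nmM nmV !nm_nat ler_pdivrMr // mul1r ler_nat; exact: ltn_ord.
  have -> : C0 / N%:R ^+ 2 = 1 * (L2 * (r / N%:R) ^+ 2) + N%:R^-1 * (L * (r / N%:R)).
    by rewrite /C0; field; exact: lt0r_neq0.
  rewrite nmN; apply: (le_trans (nmD _ _)); apply: lerD.
    rewrite (nmM (a j.+1)); apply: ler_pM; [exact: nm_ge0|exact: nm_ge0|exact: a1|].
    apply: le_trans (wT _ _ _ pr2 nur2) _.
    by rewrite ler_wpM2l // lerXn2r // nnegrE ?nv_ge0 // divr_ge0 // ltW.
  rewrite (nmM N%:R^-1) nmV nm_nat ler_wpM2l ?invr_ge0 ?ler0n //.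
  by apply: le_trans (wB _ _ _ pr3) _; rewrite ler_wpM2l.
have drs n x : W x -> differentiable (rsum n.+1) x.
  by move=> Wx; apply: diff_rsum => j; exact: Uray.
pose mm : R := m%:R; have mm_ge0 : 0 <= mm by exact: ler0n.
pose ell x v : K := \sum_k v 0 k * w k x.
have stepB n x v : W x -> nm ('D_v (rsum n.+1) x - ell x v) <= mm * nv v * C0 / n.+1%:R.
  move=> Wx; rewrite (derive_coord v (drs n x Wx)) /ell -sumrB.
  rewrite (le_trans (nm_sum _ _ _)) //.
  have -> : mm * nv v * C0 / n.+1%:R = \sum_(k < m) (nv v * (C0 / n.+1%:R)).
    by rewrite sumr_const card_ord -[_ *+ m]mulr_natl !mulrA.
  apply: ler_sum => k _; rewrite -mulrBr nmM.
  by apply: ler_pM; [exact: nm_ge0|exact: nm_ge0|exact: nm_coord_le|exact: stepA].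
pose C1 := mm * r * C0.
have C1_ge0 : 0 <= C1 by apply: mulr_ge0 => //; apply: mulr_ge0 => //; exact: ltW.
have stepC x : W x -> exists l : K, forall n : nat,
    nm (rsum n.+1 x - l) <= 2 * (C1 / n.+1%:R).
  move=> Wx.
  apply: (@complex_cauchy_limit R nat (fun n => rsum n.+1 x) (fun n => C1 / n.+1%:R)).
  move=> s t; pose G : V -> K := rsum s.+1 - rsum t.+1.
  have -> : rsum s.+1 x - rsum t.+1 x = G ((x - x0) + x0) - G x0.
    rewrite subrK -[G x]/(rsum s.+1 x - rsum t.+1 x) -[G x0]/(rsum s.+1 x0 - rsum t.+1 x0).
    by rewrite !rsum0 !subr0.
  have ds (c : R) k : 0 <= c <= 1 -> derivable (rsum k.+1) (c%:C *: (x - x0) + x0) (x - x0).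
    by move=> c01; apply: diff_derivable; apply: drs; exact: Wray.
  apply: mean_value_bound => c c01; first by exact: (derivableB (ds c s c01) (ds c t c01)).
  have Wc : W (c%:C *: (x - x0) + x0) by exact: Wray.
  rewrite (deriveB (ds c s c01) (ds c t c01)).
  rewrite -[X in nm (X - _)](subrK (ell (c%:C *: (x - x0) + x0) (x - x0))) -addrA.
  have hr : nv (x - x0) <= r by move: Wx; rewrite /W /=; lra.
  have B k : mm * nv (x - x0) * C0 / k.+1%:R <= C1 / k.+1%:R.
    rewrite ler_pM2r ?invr_gt0 // /C1 ler_wpM2r //.
    by rewrite ler_wpM2l.
  rewrite (le_trans (nmD _ _)) // lerD // ?(le_trans (stepB _ _ _ Wc)) ?B //.
  by rewrite nm_distC (le_trans (stepB _ _ _ Wc)) ?B.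
have [F FP] : exists F : V -> K, forall x, W x -> forall n : nat,
    nm (rsum n.+1 x - F x) <= 2 * (C1 / n.+1%:R).
  have /choice[F FP] : forall x, exists l : K, W x -> forall n : nat,
      nm (rsum n.+1 x - l) <= 2 * (C1 / n.+1%:R).
    move=> x; have [Wx|nWx] := pselect (W x); last by exists 0.
    by have [l lP] := stepC x Wx; exists l.
  by exists F.
have lim_le (A B C : R) : 0 <= C -> (forall n : nat, A <= B + C / n.+1%:R) -> A <= B.
  move=> C_ge0 AB; apply/ler_addgt0Pr => e e_gt0.
  pose n := Num.bound (C / e); apply: (le_trans (AB n)); rewrite lerD2l ler_pdivrMr //.
  have : C / e < n%:R by rewrite archi_boundP // divr_ge0 // ltW.
  rewrite ltr_pdivrMr // => /ltW /le_trans; apply.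
  by rewrite mulrC ler_wpM2l ?ltW // ltr_nat.
have ell_lin x : linear (ell x).
  move=> a u v; rewrite /ell scaler_sumr -big_split; apply: eq_bigr => k _.
  by rewrite !mxE mulrDl -mulrA.
exists W, F; split.
- exact: nv_open.
- by rewrite /W /= subrr nv0 divr_gt0.
- by move=> x xW; apply: rU; move: xW; rewrite /W /=; lra.
move=> x Wx.
pose lmix := GRing.isLinear.Build _ _ _ _ (ell x) (ell_lin x).
pose lin : {linear V -> K} := HB.pack (ell x) lmix.
have ell_cont : continuous lin.
  apply: (@bounded_linear_nv_continuous _ _ lin (mm * M)) => v.
  rewrite /lin /= /ell (le_trans (nm_sum _ _ _)) //.
  have -> : mm * M * nv v = \sum_(k < m) (nv v * M).
    by rewrite sumr_const card_ord -[_ *+ m]mulr_natl mulrAC mulrA.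
  apply: ler_sum => k _; rewrite nmM; apply: ler_pM; [exact: nm_ge0|exact: nm_ge0|exact: nm_coord_le|].
  by apply: rM; move: Wx; rewrite /W /=; lra.
pose rho := r / 2 - nv (x - x0).
have rho_gt0 : 0 < rho by rewrite subr_gt0.
have seg (t : R) u : 0 <= t <= 1 -> nv u < rho -> W (t%:C *: u + x).
  move=> /andP[t0 t1] ur; rewrite /W /= -addrA (le_lt_trans (nvD _ _)) //.
  rewrite nvZ nm_real ger0_norm //.
  have : t * nv u <= nv u by rewrite ler_piMl ?nv_ge0.
  by move: ur; rewrite /rho; lra.
(* The estimate is proved for the Riemann sum up to a multiple of 1 / n.+1, and [lim_le] removes
   that term. *)
have stepD u : nv u < rho -> nm (F (u + x) - F x - ell x u) <= mm * L * nv u ^+ 2.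
  move=> ur; apply: (lim_le _ _ (mm * nv u * C0 + 4 * C1)).
    by apply: addr_ge0; apply: mulr_ge0 => //; apply: mulr_ge0 => //; exact: nv_ge0.
  move=> n; pose a : V -> K := rsum n.+1.
  have Wux : W (u + x) by have := seg 1 u _ ur; rewrite scale1r; apply; rewrite ler01 lexx.
  have -> : F (u + x) - F x - ell x u =
      (a (u + x) - a x - ell x u) + ((a x - F x) - (a (u + x) - F (u + x))).
    suff alg (Z : comPzRingType) (b c d e f : Z) :
      b - c - d = (e - f - d) + ((f - c) - (e - b)) by exact: alg.
    by ring.
  have T1 : nm (a (u + x) - a x - ell x u) <= mm * L * nv u ^+ 2 + mm * nv u * C0 / n.+1%:R.
    pose G : V -> K := a - (lin : V -> K).
    have -> : a (u + x) - a x - ell x u = G (u + x) - G x.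
      rewrite -[G (u + x)]/(a (u + x) - lin (u + x)) -[G x]/(a x - lin x) linearD.
      rewrite -[ell x u]/(lin u).
      suff alg (Z : comPzRingType) (b c d e : Z) :
        b - c - d = b - (d + e) - (c - e) by exact: alg.
      by ring.
    have da (t : R) : 0 <= t <= 1 -> derivable a (t%:C *: u + x) u.
      by move=> t01; apply: diff_derivable; apply: drs; exact: seg.
    have dl z : differentiable lin z by exact: linear_differentiable.
    have dl' z : derivable lin z u by exact: diff_derivable.
    have dlE z : 'D_u lin z = ell x u.
      exact: etrans (deriveE u (dl z)) (congr1 (@^~ u) (diff_lin z ell_cont)).
    apply: mean_value_bound => t t01; first exact: (derivableB (da t t01) (dl' _)).
    set z := t%:C *: u + x; have Wz : W z by exact: seg.
    have -> : 'D_u G z = ('D_u a z - ell z u) + (ell z u - ell x u).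
      rewrite addrA subrK -(dlE z); exact: (deriveB (da t t01) (dl' _)).
    apply: (le_trans (nmD _ _)); rewrite [leRHS]addrC; apply: lerD; first exact: stepB.
    rewrite /ell -sumrB; apply: (le_trans (nm_sum _ _ _)).
    have -> : mm * L * nv u ^+ 2 = \sum_(k < m) (nv u * (L * nv u)).
      by rewrite sumr_const card_ord -[_ *+ m]mulr_natl -/mm; ring.
    have tu : nv (t%:C *: u) <= nv u.
      by case/andP: t01 => t0 t1; rewrite nvZ nm_real ger0_norm // ler_piMl ?nv_ge0.
    apply: ler_sum => k _; rewrite -mulrBr nmM.
    apply: ler_pM; [exact: nm_ge0|exact: nm_ge0|exact: nm_coord_le|].
    have h3 : nv (x - x0) + nv (t%:C *: u) < 3 * r.
      by move: ur; rewrite /rho; lra.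
    by rewrite (le_trans (wL k x _ h3)) // ler_wpM2l.
  have F1 := FP x Wx n; have F2 := FP (u + x) Wux n.
  have T2 := nmB (a x - F x) (a (u + x) - F (u + x)).
  rewrite (le_trans (nmD _ _)) //.
  have -> : mm * L * nv u ^+ 2 + (mm * nv u * C0 + 4 * C1) / n.+1%:R =
     (mm * L * nv u ^+ 2 + mm * nv u * C0 / n.+1%:R) + (2 * (C1 / n.+1%:R) + 2 * (C1 / n.+1%:R)).
    by field; exact: lt0r_neq0.
  by rewrite lerD // (le_trans T2) // lerD.
have [dF dFE] : is_diff x F lin.
  apply: eps_diff => // e /KK_posP[d d_gt0 ->].
  have c_ge0 : 0 <= mm * L by exact: mulr_ge0.
  have c_gt0 : 0 < mm * L + 1 by lra.
  exists (Num.min rho (d / (mm * L + 1)))%:C.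
    by rewrite ltcR lt_min rho_gt0 divr_gt0.
  move=> u; rewrite nvE ltcR lt_min => /andP[ur ud].
  rewrite -rmorphM normE lecR (le_trans (stepD u ur)) // expr2 mulrA.
  rewrite ler_wpM2r ?nv_ge0 //.
  move: ud; rewrite ltr_pdivlMr //; have := nv_ge0 u; nra.
split=> [|k]; first exact: dF.
rewrite /pd (deriveE _ dF) dFE /lin /= /ell (bigD1 k) //= mxE !eqxx mul1r big1 ?addr0 //.
by move=> l lk; rewrite mxE eqxx (negbTE lk) mul0r.
Qed.

End Primitive.

(** * The complex exponential *)

Section Exponential.
Context {R : realType}.
Local Notation K := (KK R).
Local Open Scope complex_scope.

Definition cexp (z : K) : K :=
  (expR (Re (z : R[i])))%:C * (cos (Im (z : R[i])) +i* sin (Im (z : R[i]))).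

Lemma cexpD (z w : R[i]) : cexp (z + w) = cexp z * cexp w.
Proof.
case: z w => [a b] [c d]; rewrite /cexp /= expRD cosD sinD; simpc.
by congr (_ +i* _); ring.
Qed.

Lemma cexp0 : cexp 0 = 1.
Proof. by rewrite /cexp /= expR0 cos0 sin0; simpc. Qed.

Lemma cexp_neq0 (z : K) : cexp z != 0.
Proof.
apply/eqP => z0; have := cexpD z (- z); rewrite subrr cexp0 z0 mul0r.
by move/eqP; rewrite oner_eq0.
Qed.

Lemma is_derive_eps (f : R -> R) (x df : R) : is_derive x 1 f df ->
  forall e : R, 0 < e -> exists2 d : R, 0 < d &
    forall h, `|h| < d -> `|f (h + x) - f x - df * h| <= e * `|h|.
Proof.
move=> [dfx dfE] e e_gt0.
have dif : differentiable f x by exact/derivable1_diffP.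
have [d d_gt0 dP] := diff_eps dif e_gt0; exists d => // h /dP.
by rewrite diff1E // derive1E dfE [h *: _]mulrC.
Qed.

(** Differentiability at 0, from the real derivatives of exp, cos and sin; [cexpD] carries it to
    other points. *)
Lemma cexp_eps (e : R) : 0 < e -> exists2 d : R, 0 < d &
  forall z : R[i], nm z < d -> nm (cexp z - 1 - z) <= e * nm z.
Proof.
(* The four error terms below add up to at most 6 c |z|. *)
move=> e_gt0; pose c := Num.min 1 (e / 8).
have c_gt0 : 0 < c by rewrite lt_min ltr01 divr_gt0.
have c1 : c <= 1 by rewrite ge_min lexx.
have ce : c <= e / 8 by rewrite ge_min lexx orbT.
have [d1 d1_gt0 d1P] := is_derive_eps (is_derive_expR 0) c_gt0.
have [d2 d2_gt0 d2P] := is_derive_eps (is_derive_cos 0) c_gt0.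
have [d3 d3_gt0 d3P] := is_derive_eps (is_derive_sin 0) c_gt0.
exists (Num.min (Num.min d1 d2) (Num.min d3 (c / 2))).
  by rewrite !lt_min d1_gt0 d2_gt0 d3_gt0 divr_gt0.
move=> [a b]; set z := a +i* b; rewrite !lt_min => /andP[/andP[z1 z2] /andP[z3 z4]].
have za : `|a| <= nm z by exact: (Re_le_nm z).
have zb : `|b| <= nm z by exact: (Im_le_nm z).
have := d1P a (le_lt_trans za z1); have := d2P b (le_lt_trans zb z2).
have := d3P b (le_lt_trans zb z3).
rewrite !addr0 expR0 cos0 sin0 !oppr0 !mul0r !subr0 !mul1r !addr0 => hs hc he.
have n0 := nm_ge0 z; have a0 := normr_ge0 a; have b0 := normr_ge0 b.
have ea : `|expR a - 1| <= c.
  have -> : expR a - 1 = (expR a - 1 - a) + a by rewrite subrK.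
  apply: (le_trans (ler_normD _ _)).
  have : c * `|a| <= `|a| by rewrite ler_piMl.
  lra.
have e2 : 0 <= expR a <= 2.
  rewrite expR_ge0 /=; move: ea; rewrite ler_norml; lra.
apply: (le_trans (nm_le_Re_Im _)).
rewrite /cexp /=; simpc.
have -> : expR a * cos b - 1 - a = expR a * (cos b - 1) + (expR a - 1 - a) by ring.
have -> : expR a * sin b - b = expR a * (sin b - b) + (expR a - 1) * b by ring.
have h1 := ler_normD (expR a * (cos b - 1)) (expR a - 1 - a).
have h2 := ler_normD (expR a * (sin b - b)) ((expR a - 1) * b).
move: h1 h2; rewrite !normrM (@ger0_norm _ (expR a)) ?expR_ge0 // => h1 h2.
have g1 : expR a * `|cos b - 1| <= 2 * (c * nm z).
  apply: ler_pM; rewrite ?expR_ge0 //; first by case/andP: e2.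
  by apply: le_trans hc _; rewrite ler_wpM2l // ltW.
have g2 : expR a * `|sin b - b| <= 2 * (c * nm z).
  apply: ler_pM; rewrite ?expR_ge0 //; first by case/andP: e2.
  by apply: le_trans hs _; rewrite ler_wpM2l // ltW.
have g3 : `|expR a - 1| * `|b| <= c * nm z by exact: ler_pM.
have g4 : c * `|a| <= c * nm z by rewrite ler_wpM2l // ltW.
have g5 : c * nm z <= e / 8 * nm z by rewrite ler_wpM2r.
have g6 : 0 <= e * nm z by rewrite mulr_ge0 // ltW.
lra.
Qed.

Lemma cexp_comp (V : normedModType K) (F : V -> K) x : differentiable F x ->
  differentiable (cexp \o F) x /\
  forall v, 'D_v (cexp \o F) x = 'D_v F x * cexp (F x).
Proof.
move=> dF; set z := F x.
have ez : is_diff z cexp ( *:%R^~ (cexp z)).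
  have lin : linear ( *:%R^~ (cexp z) : K -> K).
    by move=> a b c; rewrite scalerDl scalerA.
  pose lmix := GRing.isLinear.Build _ _ _ _ ( *:%R^~ (cexp z) : K -> K) lin.
  pose L : {linear K -> K} := HB.pack ( *:%R^~ (cexp z) : K -> K) lmix.
  rewrite -[X in is_diff _ _ X]/(L : K -> K).
  apply: eps_diff; first exact: scalel_continuous.
  move=> e /KK_posP[d d_gt0 ->].
  have c_gt0 : 0 < nm (cexp z) by rewrite nm_gt0 cexp_neq0.
  have [d' d'_gt0 d'P] := cexp_eps (divr_gt0 d_gt0 c_gt0).
  exists d'%:C; first by rewrite ltcR.
  move=> h; rewrite !normE ltcR -rmorphM lecR => /d'P H.
  have -> : cexp (h + z) - cexp z - L h = (cexp h - 1 - h) * cexp z.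
    rewrite cexpD -[L h]/(h * cexp z).
    suff alg (Z : comPzRingType) (a b c : Z) : a * b - b - c * b = (a - 1 - c) * b.
      exact: alg.
    by ring.
  rewrite nmM -(ler_pdivlMr _ _ c_gt0) (le_trans H) //.
  by rewrite mulrAC.
have [dE dEE] := ez.
split=> [|v]; first exact: differentiable_comp.
have dc : differentiable (cexp \o F) x by exact: differentiable_comp.
have h1 := congr1 (@^~ v) (diff_comp dF dE).
have h2 := congr1 (@^~ ('d F x v)) dEE.
have h3 := congr1 (fun b => b * cexp z) (esym (deriveE v dF)).
exact: etrans (deriveE v dc) (etrans h1 (etrans h2 h3)).
Qed.

Lemma closed_form_exponential m (U : set 'rV[K]_m) x0 (w : 'I_m -> 'rV[K]_m -> K) :
  open U -> U x0 -> (forall k, holomorphic_on U (w k)) ->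
  (forall x k l, U x -> pd k (w l) x = pd l (w k) x) ->
  exists (W : set 'rV[K]_m) (E : 'rV[K]_m -> K),
  [/\ open W, W x0, W `<=` U &
      forall x, W x -> [/\ differentiable E x, E x != 0 &
        forall k, pd k E x = w k x * E x]].
Proof.
move=> Uo Ux0 wh wc.
have [W [F [Wo Wx0 WU WF]]] := closed_form_primitive Uo Ux0 wh wc.
exists W, (cexp \o F); split; [exact: Wo|exact: Wx0|exact: WU|move=> x Wx].
have [dF FE] := WF x Wx; have [dE EE] := cexp_comp dF.
split=> [||k]; [exact: dE|exact: cexp_neq0|].
by rewrite /pd EE -FE.
Qed.

End Exponential.

(** * Holomorphic matrices and base change *)

Section MatrixCalculus.
Context {K : numFieldType}.

Lemma near_eq_diff (V W : normedModType K) (f g : V -> W) x :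
  (\near x, f x = g x) -> differentiable f x -> differentiable g x.
Proof.
move=> fg df; suff [] : is_diff x g ('d f x) by [].
apply: eps_diff; first exact: diff_continuous.
move=> e e_gt0; have [d d_gt0 dP] := diff_eps df e_gt0.
have /nbhs_ballP[d' /= d'_gt0 d'P] := fg.
have [c c_gt0 [cd cd']] : exists2 c, 0 < c & c <= d /\ c <= d'.
  have [dd'|/ltW d'd] := real_leP (gtr0_real d_gt0) (gtr0_real d'_gt0).
    by exists d.
  by exists d'.
exists c => // h hc.
have e1 : f (h + x) = g (h + x).
  apply: d'P; rewrite -ball_normE /= opprD addrCA subrr addr0 normrN.
  exact: lt_le_trans hc cd'.
have e2 : f x = g x by apply: d'P; exact: ballxx.
by rewrite -e1 -e2; apply: dP; exact: lt_le_trans hc cd.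
Qed.

Context {V : normedModType K}.

Lemma continuous_near_neq0 (g : V -> K) x : {for x, continuous g} -> g x != 0 ->
  \forall y \near x, g y != 0.
Proof.
move=> /cvgrPdist_lt/(_ `|g x|) + gx; rewrite normr_gt0 => /(_ gx).
by apply: filterS => y; apply: contraTneq => ->; rewrite subr0 ltxx.
Qed.

Lemma differentiable_bigsum (W : normedModType K) (I : Type) (r : seq I) (P : pred I)
    (f : I -> V -> W) x :
  (forall i, P i -> differentiable (f i) x) ->
  differentiable (fun y => \sum_(i <- r | P i) f i y) x.
Proof.
move=> fd; elim: r => [|i r IH].
  have -> : (fun y => \sum_(i <- [::] | P i) f i y) = cst 0.
    by apply/funext => y; rewrite big_nil.
  exact: differentiable_cst.
have [Pi|nPi] := boolP (P i).
  have -> : (fun y => \sum_(j <- i :: r | P j) f j y) =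
      f i + (fun y => \sum_(j <- r | P j) f j y).
    by apply/funext => y; rewrite big_cons Pi.
  by apply: differentiableD => //; exact: fd.
have -> // : (fun y => \sum_(j <- i :: r | P j) f j y) =
    (fun y => \sum_(j <- r | P j) f j y).
by apply/funext => y; rewrite big_cons (negbTE nPi).
Qed.

Lemma differentiable_bigprod (I : Type) (r : seq I) (P : pred I) (f : I -> V -> K) x :
  (forall i, P i -> differentiable (f i) x) ->
  differentiable (fun y => \prod_(i <- r | P i) f i y) x.
Proof.
move=> fd; elim: r => [|i r IH].
  have -> : (fun y => \prod_(i <- [::] | P i) f i y) = cst 1.
    by apply/funext => y; rewrite big_nil.
  exact: differentiable_cst.
have [Pi|nPi] := boolP (P i).
  have -> : (fun y => \prod_(j <- i :: r | P j) f j y) =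
      f i * (fun y => \prod_(j <- r | P j) f j y).
    by apply/funext => y; rewrite big_cons Pi.
  by apply: differentiableM => //; exact: fd.
have -> // : (fun y => \prod_(j <- i :: r | P j) f j y) =
    (fun y => \prod_(j <- r | P j) f j y).
by apply/funext => y; rewrite big_cons (negbTE nPi).
Qed.

Lemma diff_mxP (p q : nat) (M : V -> 'M[K]_(p, q)) x :
  differentiable M x <-> forall i j, differentiable (fun y => M y i j) x.
Proof.
split=> [dM i j|dM].
  apply: (@differentiable_comp _ _ _ _ M (fun N : 'M[K]_(p, q) => N i j)) => //.
  exact: differentiable_coord.
have -> : M = (fun y => \sum_i \sum_j M y i j *: delta_mx i j).
  by apply/funext => y; exact: matrix_sum_delta.
apply: differentiable_bigsum => i _; apply: differentiable_bigsum => j _.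
exact: differentiableZl.
Qed.

Lemma derive_mx_entry (p q : nat) (M : V -> 'M[K]_(p, q)) x v i j :
  differentiable M x -> ('D_v M x) i j = 'D_v (fun y => M y i j) x.
Proof.
move=> dM; pose c (N : 'M[K]_(p, q)) : K := N i j.
have c_lin : linear c by move=> a A B; rewrite /c !mxE.
pose lmix := GRing.isLinear.Build _ _ _ _ c c_lin.
pose L : {linear 'M[K]_(p, q) -> K} := HB.pack c lmix.
have Lc : continuous L by exact: coord_continuous.
have dL : differentiable L (M x) by exact: linear_differentiable.
have dcM : differentiable (c \o M) x by exact: (differentiable_comp dM dL).
have h1 := congr1 (@^~ v) (diff_comp dM dL).
have h2 := congr1 (@^~ ('d M x v)) (diff_lin (M x) Lc).
rewrite (deriveE v dM).
exact: esym (etrans (deriveE v dcM) (etrans h1 h2)).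
Qed.

Lemma differentiable_mulmx (p q r : nat) (M : V -> 'M[K]_(p, q)) (N : V -> 'M[K]_(q, r)) x :
  differentiable M x -> differentiable N x -> differentiable (fun y => M y *m N y) x.
Proof.
move=> /diff_mxP dM /diff_mxP dN; apply/diff_mxP => i j.
have -> : (fun y => (M y *m N y) i j) = (fun y => \sum_k M y i k * N y k j).
  by apply/funext => y; rewrite mxE.
by apply: differentiable_bigsum => k _; exact: (differentiableM (dM i k) (dN k j)).
Qed.

Lemma derive_bigsum (W : normedModType K) (I : Type) (r : seq I) (f : I -> V -> W) x v :
  (forall i, differentiable (f i) x) ->
  'D_v (fun y => \sum_(i <- r) f i y) x = \sum_(i <- r) 'D_v (f i) x.
Proof.
move=> fd; elim: r => [|i r IH].
  rewrite big_nil; have -> : (fun y => \sum_(i <- [::]) f i y) = cst 0.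
    by apply/funext => y; rewrite big_nil.
  exact: derive_cst.
have -> : (fun y => \sum_(j <- i :: r) f j y) = f i + (fun y => \sum_(j <- r) f j y).
  by apply/funext => y; rewrite big_cons.
have d2 : differentiable (fun y => \sum_(j <- r) f j y) x.
  by apply: differentiable_bigsum => j _; exact: fd.
by rewrite (deriveD (diff_derivable (fd i)) (diff_derivable d2)) IH big_cons.
Qed.

Lemma derive_mulmx (p q r : nat) (M : V -> 'M[K]_(p, q)) (N : V -> 'M[K]_(q, r)) x v :
  differentiable M x -> differentiable N x ->
  'D_v (fun y => M y *m N y) x = 'D_v M x *m N x + M x *m 'D_v N x.
Proof.
move=> dM dN; apply/matrixP => i j.
rewrite (derive_mx_entry _ _ _ (differentiable_mulmx dM dN)) !mxE -big_split /=.
have -> : (fun y => (M y *m N y) i j) = (fun y => \sum_k M y i k * N y k j).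
  by apply/funext => y; rewrite mxE.
have dM' := (diff_mxP M x).1 dM; have dN' := (diff_mxP N x).1 dN.
have dk k : differentiable (fun y => M y i k * N y k j) x.
  exact: (differentiableM (dM' i k) (dN' k j)).
rewrite (derive_bigsum _ _ dk); apply: eq_bigr => k _.
rewrite (derive_mx_entry _ _ _ dM) (derive_mx_entry _ _ _ dN).
have := deriveM (diff_derivable (v := v) (dM' i k)) (diff_derivable (v := v) (dN' k j)).
move=> ->; rewrite addrC; congr (_ + _); exact: mulrC.
Qed.

Lemma differentiable_scalemx (p q : nat) (c : V -> K) (M : V -> 'M[K]_(p, q)) x :
  differentiable c x -> differentiable M x -> differentiable (fun y => c y *: M y) x.
Proof.
move=> dc /diff_mxP dM; apply/diff_mxP => i j.
have -> : (fun y => (c y *: M y) i j) = (fun y => c y * M y i j).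
  by apply/funext => y; rewrite mxE.
exact: (differentiableM dc (dM i j)).
Qed.

Lemma differentiable_det (p : nat) (M : V -> 'M[K]_p) x :
  differentiable M x -> differentiable (fun y => \det (M y)) x.
Proof.
move=> /diff_mxP dM; apply: differentiable_bigsum => s _.
apply: (@differentiableM _ _ (cst _)); first exact: differentiable_cst.
by apply: differentiable_bigprod => i _; exact: dM.
Qed.

(** Cramer's rule, valid only near x: [invmx] returns a singular matrix unchanged. *)
Lemma differentiable_invmx (p : nat) (M : V -> 'M[K]_p) x :
  differentiable M x -> M x \in unitmx -> differentiable (fun y => invmx (M y)) x.
Proof.
move=> dM uM.
have dd := differentiable_det dM.
have d0 : \det (M x) != 0 by rewrite -unitfE -unitmxE.
have near0 : \forall y \near x, \det (M y) != 0.
  apply: continuous_near_neq0 d0.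
  exact: differentiable_continuous.
apply: (@near_eq_diff _ _ (fun y => (\det (M y))^-1 *: \adj (M y))).
  by apply: filterS near0 => y y0; rewrite /invmx unitmxE unitfE y0.
apply/diff_mxP => i j.
have -> : (fun y => ((\det (M y))^-1 *: \adj (M y)) i j) =
    (fun y => (\det (M y))^-1 * cofactor (M y) j i).
  by apply/funext => y; rewrite !mxE.
apply: differentiableM; first exact: differentiableV.
apply: (@differentiableM _ _ (cst _)); first exact: differentiable_cst.
apply: differentiable_det; apply/diff_mxP => a b.
have -> : (fun y => row' j (col' i (M y)) a b) = (fun y => M y (lift j a) (lift i b)).
  by apply/funext => y; rewrite !mxE.
exact: (proj1 (diff_mxP M x) dM).
Qed.

End MatrixCalculus.

Section ProductDifferentials.
Context {K : numFieldType} {V W : normedModType K}.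

Lemma differentiable_fst (p : V * W) : differentiable (@fst V W) p.
Proof.
have lin : linear (@fst V W) by [].
pose lmix := GRing.isLinear.Build _ _ _ _ (@fst V W) lin.
pose L : {linear (V * W)%type -> V} := HB.pack (@fst V W) lmix.
by apply: (@linear_differentiable _ _ _ L) => q; exact: cvg_fst.
Qed.

Lemma differentiable_snd (p : V * W) : differentiable (@snd V W) p.
Proof.
have lin : linear (@snd V W) by [].
pose lmix := GRing.isLinear.Build _ _ _ _ (@snd V W) lin.
pose L : {linear (V * W)%type -> W} := HB.pack (@snd V W) lmix.
by apply: (@linear_differentiable _ _ _ L) => q; exact: cvg_snd.
Qed.

End ProductDifferentials.

Section PartialDerivatives.
Context {K : numFieldType}.

Lemma pd_comp (m m' : nat) (W : normedModType K) (phi : 'rV[K]_m -> 'rV[K]_m')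
    (f : 'rV[K]_m' -> W) x k :
  differentiable phi x -> differentiable f (phi x) ->
  pd k (f \o phi) x = \sum_l (pd k phi x) 0 l *: pd l f (phi x).
Proof.
move=> dphi df; have dc := differentiable_comp dphi df.
have h1 := congr1 (@^~ (delta_mx 0 k)) (diff_comp dphi df).
rewrite /pd; apply: (etrans (deriveE _ dc)); apply: (etrans h1).
rewrite (deriveE _ dphi) /= {1}[_ _ (delta_mx 0 k)]row_sum_delta linear_sum.
by apply: eq_bigr => l _; rewrite linearZ /= (deriveE _ df).
Qed.

Lemma open_holomorphic_preimage (V W : normedModType K) (A : set V) (B : set W) (f : V -> W) :
  open A -> holomorphic_on A f -> open B -> open (A `&` f @^-1` B).
Proof.
move=> Ao fA Bo; rewrite openE => x [Ax Bx]; apply: filterI; first exact: open_nbhs_nbhs.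
have fc : {for x, continuous f} by apply: differentiable_continuous; exact: fA.
by apply: fc; exact: open_nbhs_nbhs.
Qed.

Lemma holomorphic_comp (V W Z : normedModType K) (A : set V) (B : set W)
    (f : V -> W) (g : W -> Z) :
  holomorphic_on A f -> holomorphic_on B g -> holomorphic_on (A `&` f @^-1` B) (g \o f).
Proof. by move=> fA gB x [/fA df /gB dg]; exact: (differentiable_comp df dg). Qed.

Lemma lie_sumr (n : nat) (I : Type) (r : seq I) (c : I -> K) (A : 'M[K]_n) (B : I -> 'M[K]_n) :
  lie A (\sum_(i <- r) c i *: B i) = \sum_(i <- r) c i *: lie A (B i).
Proof.
rewrite /lie mulmx_sumr mulmx_suml -sumrB; apply: eq_bigr => i _.
by rewrite -scalemxAr -scalemxAl scalerBr.
Qed.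

Lemma lie_suml (n : nat) (I : Type) (r : seq I) (c : I -> K) (A : 'M[K]_n) (B : I -> 'M[K]_n) :
  lie (\sum_(i <- r) c i *: B i) A = \sum_(i <- r) c i *: lie (B i) A.
Proof.
rewrite /lie mulmx_sumr mulmx_suml -sumrB; apply: eq_bigr => i _.
by rewrite -scalemxAr -scalemxAl scalerBr.
Qed.

Lemma offdiag_sum (n : nat) (I : Type) (r : seq I) (c : I -> K) (B : I -> 'M[K]_n) :
  offdiag (\sum_(i <- r) c i *: B i) = \sum_(i <- r) c i *: offdiag (B i).
Proof.
apply/matrixP => a b; rewrite mxE !summxE.
have [ab|ab] := eqVneq a b.
  by rewrite big1 // => i _; rewrite !mxE ab eqxx mulr0.
by apply: eq_bigr => i _; rewrite !mxE (negbTE ab).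
Qed.

Lemma is_diag_mx_sum (n : nat) (I : Type) (r : seq I) (c : I -> K) (B : I -> 'M[K]_n) :
  (forall i, is_diag_mx (B i)) -> is_diag_mx (\sum_(i <- r) c i *: B i).
Proof.
move=> Bd; apply/is_diag_mxP => a b ab; rewrite summxE big1 // => i _.
by rewrite mxE (is_diag_mxP (Bd i)) ?mulr0.
Qed.

Lemma fmul_sumr (n : nat) (I : Type) (r : seq I) (c : I -> K) (a : nat -> 'M[K]_n)
    (b : I -> nat -> 'M[K]_n) k :
  fmul a (fun j => \sum_(i <- r) c i *: b i j) k = \sum_(i <- r) c i *: fmul a (b i) k.
Proof.
rewrite /fmul; under eq_bigr => j _ do rewrite mulmx_sumr.
rewrite exchange_big; apply: eq_bigr => i _ /=; rewrite scaler_sumr.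
by apply: eq_bigr => j _; rewrite -scalemxAr.
Qed.

Lemma fmul_suml (n : nat) (I : Type) (r : seq I) (c : I -> K) (a : nat -> 'M[K]_n)
    (b : I -> nat -> 'M[K]_n) k :
  fmul (fun j => \sum_(i <- r) c i *: b i j) a k = \sum_(i <- r) c i *: fmul (b i) a k.
Proof.
rewrite /fmul; under eq_bigr => j _ do rewrite mulmx_suml.
rewrite exchange_big; apply: eq_bigr => i _ /=; rewrite scaler_sumr.
by apply: eq_bigr => j _; rewrite -scalemxAl.
Qed.

End PartialDerivatives.

(* Complex analysis enters the study of the connections only through this        *)
(* property of the scalar field, [has_form_exponentials], [has_local_constancy]  *)
(* and the splitting of polynomials, all proved for R[i].                        *)
Definition smooth_field (K : numFieldType) : Prop :=
  forall (m p q : nat) (U : set 'rV[K]_m) (M : 'rV[K]_m -> 'M[K]_(p, q)),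
    open U -> holomorphic_on U M ->
    (forall k, holomorphic_on U (fun x => pd k M x)) /\
    (forall k l x, U x -> pd k (fun y => pd l M y) x = pd l (fun y => pd k M y) x).

Section HolomorphicMatrices.
Context {R : realType}.
Local Notation K := (KK R).

Lemma near_open (V : topologicalType) (U : set V) x (P : V -> Prop) :
  open U -> U x -> (forall y, U y -> P y) -> \forall y \near x, P y.
Proof. by move=> Uo Ux UP; apply: filterS UP _; exact: open_nbhs_nbhs. Qed.

Lemma holomorphic_pd (m p q : nat) (U : set 'rV[K]_m) (M : 'rV[K]_m -> 'M[K]_(p, q)) k :
  open U -> holomorphic_on U M -> holomorphic_on U (fun x => pd k M x).
Proof.
move=> Uo MU x Ux; apply/diff_mxP => i j.
have Mij : holomorphic_on U (fun y => M y i j).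
  by move=> y /MU dM; exact: ((diff_mxP M y).1 dM).
apply: (@near_eq_diff _ _ _ (fun y => 'D_(delta_mx 0 k) (fun z => M z i j) y)).
  by apply: near_open Uo Ux _ => y Uy; rewrite /pd (derive_mx_entry _ _ _ (MU y Uy)).
exact: (proj1 (holomorphic_derive (delta_mx 0 k) Uo Mij) x Ux).
Qed.

Lemma pd_comm (m p q : nat) (U : set 'rV[K]_m) (M : 'rV[K]_m -> 'M[K]_(p, q)) k l x :
  open U -> holomorphic_on U M -> U x ->
  pd k (fun y => pd l M y) x = pd l (fun y => pd k M y) x.
Proof.
move=> Uo MU Ux; apply/matrixP => i j.
have Mij : holomorphic_on U (fun y => M y i j).
  by move=> y /MU dM; exact: ((diff_mxP M y).1 dM).
have E (a b : 'I_m) : (pd a (fun y => pd b M y) x) i j =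
    'D_(delta_mx 0 a) (fun y => 'D_(delta_mx 0 b) (fun z => M z i j) y) x.
  rewrite [LHS](derive_mx_entry _ _ _ (holomorphic_pd b Uo MU Ux)).
  apply: near_eq_derive; apply: near_open Uo Ux _ => y Uy.
  by rewrite /pd (derive_mx_entry _ _ _ (MU y Uy)).
have H := proj2 (holomorphic_derive (delta_mx 0 l) Uo Mij) (delta_mx 0 k) x Ux.
exact: etrans (E k l) (etrans H (esym (E l k))).
Qed.

Lemma KK_smooth : smooth_field K.
Proof.
move=> m p q U M Uo MU; split=> [k|k l x Ux]; first exact: holomorphic_pd.
exact: (pd_comm k l Uo MU Ux).
Qed.

End HolomorphicMatrices.

(** * Pull-back of deformations *)

Section BaseChange.
Context {K : numFieldType} {n : nat}.
Hypothesis K_smooth : smooth_field K.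
Implicit Types (Ao Bo : 'M[K]_n).

Section Pullback.
Variables (m m' : nat) (phi : 'rV[K]_m -> 'rV[K]_m') (V : set 'rV[K]_m).
Hypotheses (Vo : open V) (phiV : holomorphic_on V phi).

Let c k l x : K := (pd k phi x) 0 l.

Lemma pullback_coef_holomorphic k l : holomorphic_on V (c k l).
Proof.
move=> x Vx.
exact: (proj1 (diff_mxP (fun y => pd k phi y) x) ((K_smooth Vo phiV).1 k x Vx) 0 l).
Qed.

Lemma pd_pullback_coef k l j x : V x -> pd k (c l j) x = pd l (c k j) x.
Proof.
move=> Vx.
have E a b : pd a (c b j) x = (pd a (fun y => pd b phi y) x) 0 j.
  exact: esym (derive_mx_entry (delta_mx 0 a) 0 j ((K_smooth Vo phiV).1 b x Vx)).
have H := congr1 (fun v : 'rV[K]_m' => v 0 j) ((K_smooth Vo phiV).2 k l x Vx).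
exact: etrans (E k l) (etrans H (esym (E l k))).
Qed.

Lemma holomorphic_pullback (U : set 'rV[K]_m') (C : 'I_m' -> 'rV[K]_m' -> 'M[K]_n) k :
  (forall l, holomorphic_on U (C l)) ->
  holomorphic_on (V `&` phi @^-1` U) (fun x => \sum_l c k l x *: C l (phi x)).
Proof.
move=> CU x [Vx Ux]; apply: differentiable_bigsum => l _.
apply: differentiable_scalemx; first exact: pullback_coef_holomorphic.
exact: (differentiable_comp (phiV Vx) (CU l _ Ux)).
Qed.

End Pullback.

Lemma pd_pullback_sum (m m' : nat) (phi : 'rV[K]_m -> 'rV[K]_m')
    (g : 'I_m' -> 'rV[K]_m -> K) (C : 'I_m' -> 'rV[K]_m' -> 'M[K]_n) x k a b :
  (forall j, differentiable (g j) x) -> differentiable phi x ->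
  (forall j, differentiable (C j) (phi x)) ->
  (pd k (fun y => \sum_j g j y *: C j (phi y)) x) a b =
  \sum_j pd k (g j) x * C j (phi x) a b +
  \sum_j \sum_i (g j x * (pd k phi x) 0 i) * (pd i (C j) (phi x)) a b.
Proof.
move=> dg dphi dC; have dCphi j := differentiable_comp dphi (dC j).
have dgC j := differentiable_scalemx (dg j) (dCphi j).
have dent j := proj1 (diff_mxP _ _) (dCphi j) a b.
rewrite -big_split /=.
have dS : differentiable (fun y => \sum_j g j y *: C j (phi y)) x.
  by apply: differentiable_bigsum => j _; exact: dgC.
apply: (etrans (derive_mx_entry _ a b dS)).
have -> : (fun y => (\sum_j g j y *: C j (phi y)) a b) =
    (fun y => \sum_j (g j * (fun y => C j (phi y) a b)) y).
  by apply/funext => y; rewrite summxE; apply: eq_bigr => j _; rewrite mxE.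
have dM j := differentiableM (dg j) (dent j).
apply: (etrans (derive_bigsum _ _ dM)); apply: eq_bigr => j _.
apply: (etrans (deriveM (diff_derivable (dg j)) (diff_derivable (dent j)))).
rewrite [RHS]addrC; congr (_ + _); last exact: mulrC.
rewrite -(derive_mx_entry _ a b (dCphi j)).
have /matrixP/(_ a b) H := pd_comp k dphi (dC j).
apply: (etrans (congr1 (fun t => g j x * t) H)).
by rewrite summxE mulr_sumr; apply: eq_bigr => i _; rewrite mxE mulrA.
Qed.

(** The only condition that is not linear or bilinear over functions is dC = 0. Its pull-back splits
    into two sums, symmetric respectively because second derivatives of phi commute and because C is
    closed. *)
Lemma I_all_base_change Ao Bo :
  closed_under_base_change (fun m => @I_all K m n Ao Bo).
Proof.
move=> m m' T phi xo [phixo [V [Vo Vxo phiV]]] [TA [U [Uo Ux AU CU TU]]].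
split; first by rewrite /= phixo.
have dphi x : V x -> differentiable phi x by exact: phiV.
exists (V `&` phi @^-1` U); split.
- exact: (open_holomorphic_preimage Vo phiV Uo).
- by split; [exact: Vxo|rewrite /= phixo].
- exact: (holomorphic_comp phiV AU).
- move=> k; exact: (holomorphic_pullback Vo phiV k CU).
move=> x [Vx Ux']; have [T1 T2 T3 T4] := TU _ Ux'.
have dC l := differentiable_comp (dphi x Vx) (CU l _ Ux').
have dc k l : differentiable (fun y => (pd k phi y) 0 l) x.
  exact: (pullback_coef_holomorphic Vo phiV).
split=> [k l|k l|k|k] /=.
- apply/matrixP => a b.
  have H (k' l' : 'I_m) :=
    pd_pullback_sum k' a b (fun j => dc l' j) (dphi x Vx) (fun j => CU j _ Ux').
  rewrite [LHS](H k l) [RHS](H l k); apply: congr2.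
    apply: eq_bigr => j _; apply: (congr1 (fun t => t * _)).
    exact: (pd_pullback_coef Vo phiV k l j Vx).
  rewrite exchange_big /=; apply: eq_bigr => i _; apply: eq_bigr => j _.
  have /matrixP/(_ a b) e := T1 i j; rewrite e; apply: (congr1 (fun t => t * _)).
  exact: mulrC.
- have E (a b : 'I_m) : (\sum_i (pd a phi x) 0 i *: defo T i (phi x)) *m
      (\sum_j (pd b phi x) 0 j *: defo T j (phi x)) =
      \sum_i \sum_j ((pd a phi x) 0 i * (pd b phi x) 0 j) *:
        (defo T i (phi x) *m defo T j (phi x)).
    rewrite mulmx_suml; apply: eq_bigr => i _; rewrite mulmx_sumr; apply: eq_bigr => j _.
    by rewrite -scalemxAl -scalemxAr scalerA.
  apply: (etrans (E k l)); apply: (etrans _ (esym (E l k))).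
  rewrite exchange_big; apply: eq_bigr => i _; apply: eq_bigr => j _ /=.
  by rewrite mulrC; congr (_ *: _); exact: T2.
- by rewrite lie_sumr big1 // => l _; rewrite T3 scaler0.
- rewrite [LHS](pd_comp k (dphi x Vx) (AU _ Ux')).
  rewrite lie_suml -big_split; apply: eq_bigr => l _.
  by rewrite T4 scalerDr.
Qed.

End BaseChange.

Section BaseChangeClasses.
Context {K : numFieldType} {n : nat}.
Hypothesis K_smooth : smooth_field K.
Implicit Types (Ao Bo : 'M[K]_n).

Lemma conj_sum (I : Type) (r : seq I) (c : I -> K) (X Y : 'M[K]_n) (C : I -> 'M[K]_n) :
  X *m (\sum_(i <- r) c i *: C i) *m Y = \sum_(i <- r) c i *: (X *m C i *m Y).
Proof.
rewrite mulmx_sumr mulmx_suml; apply: eq_bigr => i _.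
by rewrite -scalemxAr -scalemxAl.
Qed.

Section Pointed.
Variables (m m' : nat) (phi : 'rV[K]_m -> 'rV[K]_m') (V : set 'rV[K]_m) (xo : 'rV[K]_m).
Hypotheses (Vo : open V) (Vxo : V xo) (phiV : holomorphic_on V phi).
Implicit Types U : set 'rV[K]_m'.

Lemma hol_GL_pullback U (G : 'rV[K]_m' -> 'M[K]_n) :
  hol_GL U G -> hol_GL (V `&` phi @^-1` U) (G \o phi).
Proof.
move=> [GU Gu]; split; first exact: (holomorphic_comp phiV GU).
by move=> x [_ /Gu].
Qed.

Lemma diagonalizable_pullback (J : Type) (M : J -> 'rV[K]_m' -> 'M[K]_n) :
  loc_hol_diagonalizable M (phi xo) ->
  loc_hol_diagonalizable (fun j x => M j (phi x)) xo.
Proof.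
move=> [U [G [Uo Uxo GU GM]]]; exists (V `&` phi @^-1` U), (G \o phi); split.
- exact: (open_holomorphic_preimage Vo phiV Uo).
- by split; [exact: Vxo|exact: Uxo].
- exact: hol_GL_pullback.
- by move=> x j [_ Ux]; exact: GM.
Qed.

Lemma diagonalizable_pullback_form (C : 'I_m' -> 'rV[K]_m' -> 'M[K]_n) :
  loc_hol_diagonalizable C (phi xo) ->
  loc_hol_diagonalizable (fun k x => \sum_l (pd k phi x) 0 l *: C l (phi x)) xo.
Proof.
move=> [U [G [Uo Uxo GU GM]]]; exists (V `&` phi @^-1` U), (G \o phi); split.
- exact: (open_holomorphic_preimage Vo phiV Uo).
- by split; [exact: Vxo|exact: Uxo].
- exact: hol_GL_pullback.
- move=> x j [_ Ux]; rewrite conj_sum; apply: is_diag_mx_sum => l; exact: GM.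
Qed.

Lemma hol_diagonal_form_pullback U (A D : 'rV[K]_m' -> 'M[K]_n) :
  hol_diagonal_form U A D ->
  hol_diagonal_form (V `&` phi @^-1` U) (A \o phi) (D \o phi).
Proof.
move=> [DU Dd [G [GU GA]]]; split; first exact: (holomorphic_comp phiV DU).
  by move=> x [_ /Dd].
exists (G \o phi); split; first exact: hol_GL_pullback.
by move=> x [_ /GA].
Qed.

Lemma hol_GL_pullback_frame U (G : K * 'rV[K]_m' -> 'M[K]_n) :
  hol_GL ([set: K] `*` U) G ->
  hol_GL ([set: K] `*` (V `&` phi @^-1` U)) (fun p => G (p.1, phi p.2)).
Proof.
move=> [GU Gu]; split; last by move=> [z x] [_ [_ Ux]]; apply: Gu; split.
move=> [z x] [_ /= [Vx Ux]].
have d2 : differentiable (fun p : K * 'rV[K]_m => phi p.2) (z, x).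
  apply: (differentiable_comp (f := snd)); first exact: differentiable_snd.
  exact: phiV.
have dp : differentiable (fun p : K * 'rV[K]_m => (p.1, phi p.2)) (z, x).
  apply: (@differentiable_pair _ _ _ _ fst); last exact: d2.
  exact: differentiable_fst.
have dG : differentiable G (z, phi x) by apply: GU; split.
exact: (differentiable_comp dp dG).
Qed.

End Pointed.

Lemma I_d_base_change Ao Bo :
  closed_under_base_change (fun m => @I_d K m n Ao Bo).
Proof.
move=> m m' T phi xo bc [TI TA TC]; split; first exact: (I_all_base_change K_smooth bc TI).
  move: bc => [phixo [V [Vo Vxo phiV]]]; rewrite -phixo in TA.
  exact: (diagonalizable_pullback Vo Vxo phiV TA).
move: bc => [phixo [V [Vo Vxo phiV]]]; rewrite -phixo in TC.
exact: (diagonalizable_pullback_form Vo Vxo phiV TC).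
Qed.

(** All the data are composed with phi, the frame only in its second variable; the 1-form conditions
    are combined with the coefficients of d phi. *)
Lemma I_dv_base_change Ao Bo :
  closed_under_base_change (fun m => @I_dv K m n Ao Bo).
Proof.
move=> m m' T phi xo bc [TI [U [L [D [B [varpi [G]]]]]]].
move=> [[Uo UT] [LU BU vU] DU [[GU [H [HU GH]]] Gg] LBv].
split; first exact: (I_d_base_change bc TI).
move: bc => [phixo [V [Vo Vxo phiV]]].
exists (V `&` phi @^-1` U), (L \o phi), (D \o phi), (B \o phi),
  (fun k x => \sum_l (pd k phi x) 0 l *: varpi l (phi x)), (fun p => G (p.1, phi p.2)).
have [Dh _ _] := DU.
split.
- split; first exact: (open_holomorphic_preimage Vo phiV Uo).
  by split; [exact: Vxo|rewrite /= phixo].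
- split; [exact: (holomorphic_comp phiV LU)|exact: (holomorphic_comp phiV BU)|].
  by move=> k; exact: (holomorphic_pullback K_smooth Vo phiV k vU).
- exact: (hol_diagonal_form_pullback phiV DU).
- split.
    split; first exact: (hol_GL_pullback_frame phiV GU).
    exists (fun p => H (p.1, phi p.2)); split; first exact: (hol_GL_pullback_frame phiV HU).
    by move=> z x z0 [_ Ux]; exact: GH.
  move=> z x z0 [Vx Ux]; have [Gz Gx] := Gg z (phi x) z0 Ux.
  split; first exact: Gz.
  move=> k /=.
  have dG : differentiable (fun y => G (z, y)) (phi x).
    have dp : differentiable (fun y : 'rV[K]_m' => (z, y)) (phi x).
      apply: differentiable_pair; [exact: differentiable_cst|exact: ex_diff].
    have dG : differentiable G (z, phi x) by apply: (GU.1); split.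
    exact: (differentiable_comp dp dG).
  rewrite [pd k (fun y => G (z, phi y)) x](pd_comp k (phiV _ Vx) dG).
  rewrite [pd k (D \o phi) x](pd_comp k (phiV _ Vx) (Dh _ Ux)).
  have -> : - (z *: \sum_l (pd k phi x) 0 l *: defo T l (phi x)) =
      \sum_l (pd k phi x) 0 l *: (- (z *: defo T l (phi x))).
    rewrite scaler_sumr -sumrN; apply: eq_bigr => l _.
    by rewrite scalerN !scalerA mulrC.
  rewrite conj_sum mulmx_sumr scaler_sumr -sumrN -!big_split /=.
  apply: eq_bigr => l _.
  rewrite -scalemxAr -scalerDr; apply: (etrans (congr1 _ (Gx l))).
  by rewrite scalerDr scalerN !scalerA mulrC.
- move=> x [Vx Ux]; have [L1 L2 L3] := LBv _ Ux; split; [exact: L1|exact: L2|].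
  move=> k; rewrite offdiag_sum.
  rewrite [pd k (D \o phi) x](pd_comp k (phiV _ Vx) (Dh _ Ux)) lie_suml.
  by apply: eq_bigr => l _; rewrite L3.
Qed.

(** The inverse series at x is the one at phi x. The dz-equation is unchanged, and the dx-equations
    are combined linearly with the coefficients of d phi. *)
Lemma I_fs_base_change Ao Bo :
  closed_under_base_change (fun m => @I_fs K m n Ao Bo).
Proof.
move=> m m' T phi xo bc [TI [U [Phi [D [B' [[Uo UT] [PU Pu] [DU Dd] B'd fs]]]]]].
split; first exact: (I_all_base_change K_smooth bc TI).
move: bc => [phixo [V [Vo Vxo phiV]]].
exists (V `&` phi @^-1` U), (fun k => Phi k \o phi), (D \o phi), B'; split.
- split; first exact: (open_holomorphic_preimage Vo phiV Uo).
  by split; [exact: Vxo|rewrite /= phixo].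
- split; first by move=> k; exact: (holomorphic_comp phiV (PU k)).
  by move=> x [_ /Pu].
- split; first exact: (holomorphic_comp phiV DU).
  by move=> x [_ /Dd].
- exact: B'd.
move=> x [Vx Ux]; have [psi [psi1 psi2 fz fx]] := fs _ Ux.
exists psi; split; [exact: psi1|exact: psi2|exact: fz|].
move=> k j; pose c l := (pd k phi x) 0 l.
have E1 : fdx_coef (defo (pullback phi xo T) k x) =
    (fun i => \sum_l c l *: fdx_coef (defo T l (phi x)) i).
  apply/funext => -[|i] /=; last by rewrite big1 // => l _; rewrite scaler0.
  by rewrite -sumrN; apply: eq_bigr => l _; rewrite scalerN.
have E2 : fderiv_x (fun j => pd k (Phi j \o phi) x) =
    (fun i => \sum_l c l *: fderiv_x (fun j => pd l (Phi j) (phi x)) i).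
  apply/funext => -[|i] /=; first by rewrite big1 // => l _; rewrite scaler0.
  exact: (pd_comp k (phiV _ Vx) (PU i _ Ux)).
have E3 : fdx_coef (pd k (D \o phi) x) =
    (fun i => \sum_l c l *: fdx_coef (pd l D (phi x)) i).
  apply/funext => -[|i] /=; last by rewrite big1 // => l _; rewrite scaler0.
  rewrite [pd k (D \o phi) x](pd_comp k (phiV _ Vx) (DU _ Ux)).
  by rewrite -sumrN; apply: eq_bigr => l _; rewrite scalerN.
rewrite E1 E2 E3.
have -> : fmul psi (fun i => \sum_l c l *: fdx_coef (defo T l (phi x)) i) =
    (fun i => \sum_l c l *: fmul psi (fdx_coef (defo T l (phi x))) i).
  by apply/funext => i; rewrite fmul_sumr.
rewrite fmul_suml fmul_sumr -big_split /=; apply: eq_bigr => l _.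
by rewrite -scalerDr; apply: congr1; exact: fx.
Qed.

End BaseChangeClasses.

(** * Classes of deformations *)

Section DiagonalMatrices.
Context {K : numFieldType} {n : nat}.
Implicit Types (A B D F : 'M[K]_n).

Lemma mulmx_diag_r F D i j : is_diag_mx D -> (F *m D) i j = F i j * D j j.
Proof.
move=> Dd; rewrite mxE (bigD1 j) //= big1 ?addr0 // => k kj.
by rewrite (is_diag_mxP Dd) ?mulr0.
Qed.

Lemma mulmx_diag_l F D i j : is_diag_mx D -> (D *m F) i j = D i i * F i j.
Proof.
move=> Dd; rewrite mxE (bigD1 i) //= big1 ?addr0 // => k ki.
by rewrite (is_diag_mxP Dd) ?mul0r // eq_sym.
Qed.

Lemma lie_diag_r F D i j : is_diag_mx D -> (lie F D) i j = F i j * (D j j - D i i).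
Proof.
move=> Dd; rewrite /lie mxE mulmx_diag_r // mxE mulmx_diag_l // mulrBr.
by rewrite [D i i * _]mulrC.
Qed.

Lemma lie_diag_l F D i j : is_diag_mx D -> (lie D F) i j = (D i i - D j j) * F i j.
Proof.
move=> Dd; rewrite /lie mxE mulmx_diag_l // mxE mulmx_diag_r // mulrBl.
by rewrite [F i j * _]mulrC.
Qed.

Lemma addmxE A B i j : (A + B) i j = A i j + B i j.
Proof. by rewrite mxE. Qed.

Lemma offdiagE F i j : (offdiag F) i j = if i == j then 0 else F i j.
Proof. by rewrite mxE. Qed.

Lemma offdiagK F : offdiag (offdiag F) = offdiag F.
Proof. by apply/matrixP => i j; rewrite !offdiagE; case: eqP. Qed.

Lemma offdiag_eqP A B : (forall i j, i != j -> A i j = B i j) -> offdiag A = offdiag B.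
Proof.
move=> AB; apply/matrixP => i j; rewrite !offdiagE; case: (eqVneq i j) => // ij.
exact: AB.
Qed.

Lemma offdiag_lie_r F D : is_diag_mx D -> offdiag (lie F D) = lie (offdiag F) D.
Proof.
move=> Dd; apply/matrixP => i j; rewrite offdiagE !lie_diag_r // offdiagE.
by case: eqP => // ->; rewrite subrr mulr0.
Qed.

Lemma offdiag_lie_l F D : is_diag_mx D -> offdiag (lie D F) = lie D (offdiag F).
Proof.
move=> Dd; apply/matrixP => i j; rewrite offdiagE !lie_diag_l // offdiagE.
by case: eqP => // ->; rewrite subrr mul0r.
Qed.

Lemma diag_mx_entry (f : 'I_n -> K) i : (diag_mx (\row_j f j)) i i = f i.
Proof. by rewrite !mxE eqxx. Qed.

Lemma diag_mx_diag (f : 'I_n -> K) : is_diag_mx (diag_mx (\row_j f j)).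
Proof. exact: diag_mx_is_diag. Qed.

End DiagonalMatrices.

Section CauchyProduct.
Context {K : numFieldType} {n : nat}.
Implicit Types a b : nat -> 'M[K]_n.

Lemma fmul_coef0 a b : fmul a b 0%N = a 0%N *m b 0%N.
Proof. by rewrite /fmul big_ord1. Qed.

Lemma fmul_coef1 a b : fmul a b 1%N = a 0%N *m b 1%N + a 1%N *m b 0%N.
Proof. by rewrite /fmul big_ord_recl big_ord1. Qed.

Lemma fmul_coef2 a b :
  fmul a b 2%N = a 0%N *m b 2%N + (a 1%N *m b 1%N + a 2%N *m b 0%N).
Proof. by rewrite /fmul !big_ord_recl big_ord0 addr0. Qed.

End CauchyProduct.

(** * From a formal solution to dv-type *)

Section ConstantFrame.
Context {K : numFieldType} {m n : nat}.
Hypothesis K_smooth : smooth_field K.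
Implicit Types (Ao Bo : 'M[K]_n) (T : deformation K m n) (U : set 'rV[K]_m).

Lemma is_diag_pd U (D : 'rV[K]_m -> 'M[K]_n) k x :
  open U -> holomorphic_on U D -> (forall y, U y -> is_diag_mx (D y)) -> U x ->
  is_diag_mx (pd k D x).
Proof.
move=> Uo DU Dd Ux; apply/is_diag_mxP => i j ij.
apply: (etrans (derive_mx_entry _ i j (DU x Ux))).
have -> : 'D_(delta_mx 0 k) (fun y => D y i j) x = 'D_(delta_mx 0 k) (cst (0 : K)) x.
  by apply: near_eq_derive; apply: near_open Uo Ux _ => y Uy; rewrite (is_diag_mxP (Dd y Uy)).
exact: derive_cst.
Qed.

Lemma hol_frame_P1_cst U (P : 'rV[K]_m -> 'M[K]_n) :
  hol_GL U P -> hol_frame_P1 U (fun p : K * 'rV[K]_m => P p.2).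
Proof.
move=> [PU Pu].
have PG : hol_GL ([set: K] `*` U) (fun p : K * 'rV[K]_m => P p.2).
  split=> [[z x] [_ /= Ux]|[z x] [_ /= Ux]]; last exact: Pu.
  apply: (differentiable_comp (f := snd)); first exact: differentiable_snd.
  exact: PU.
by split; [exact: PG|exists (fun p : K * 'rV[K]_m => P p.2)].
Qed.

(** A frame independent of z extends over P^1 and has no dz-derivative, so the gauged form can be
    read off: B is P^-1 B_o P and varpi is P^-1 dP. Dv-type then reduces to identities on U. *)
Lemma I_dv_cst_frame Ao Bo T U (P D L : 'rV[K]_m -> 'M[K]_n) :
  I_d Ao Bo T -> open U -> U (base T) -> hol_GL U P -> holomorphic_on U D ->
  holomorphic_on U L ->
  (forall x, U x -> is_diag_mx (D x)) ->
  (forall x, U x -> invmx (P x) *m pole T x *m P x = D x) ->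
  (forall k x, U x -> invmx (P x) *m defo T k x *m P x = pd k D x) ->
  (forall x, U x -> offdiag (L x) = L x) ->
  (forall x, U x -> offdiag (invmx (P x) *m Bo *m P x) = lie (L x) (D x)) ->
  (forall k x, U x -> offdiag (invmx (P x) *m pd k P x) = lie (pd k D x) (L x)) ->
  I_dv Ao Bo T.
Proof.
move=> TI Uo UT PU DU LU Dd PA PC LL PB Pv; split; first exact: TI.
have [Ph Pu] := PU.
have dPi x : U x -> differentiable (fun y => invmx (P y)) x.
  by move=> Ux; apply: differentiable_invmx; [exact: Ph|exact: Pu].
exists U, L, D, (fun x => invmx (P x) *m Bo *m P x),
  (fun k x => invmx (P x) *m pd k P x), (fun p => P p.2); split.
- by [].
- split; first exact: LU.
    move=> x Ux; apply: differentiable_mulmx; last exact: Ph.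
    by apply: differentiable_mulmx; [exact: dPi|exact: differentiable_cst].
  move=> k x Ux; apply: differentiable_mulmx; first exact: dPi.
  exact: (proj1 (K_smooth Uo Ph) k x Ux).
- by split; [exact: DU|exact: Dd|exists P; split].
- split; first exact: hol_frame_P1_cst.
  move=> z x z0 Ux; split=> [|k] /=.
    rewrite derive_cst mulmx0 addr0 mulmxN mulNmx mulmxDr mulmxDl PA //.
    by rewrite -scalemxAr -scalemxAl.
  by rewrite mulmxN mulNmx -scalemxAr -scalemxAl PC.
- by move=> x Ux; split; [exact: LL|exact: PB|move=> k; exact: Pv].
Qed.

Lemma I_fs_sub_dv Ao Bo T : I_fs Ao Bo T -> I_dv Ao Bo T.
Proof.
move=> [TI [U [Phi [D [B' [[Uo UT] [PU Pu] [DU Dd] B'd fs]]]]]].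
pose P := Phi 0%N; pose F x := invmx (P x) *m Phi 1%N x.
have PG : hol_GL U P by split; [exact: PU|exact: Pu].
(* These are the coefficients of z^0 and z^-1 in the dz-equation (indices 1 and 2) and of z and z^0
   in the dx-equation (indices 0 and 1), with psi_0 = P^-1 and psi_1 = - F P^-1. *)
have key x : U x -> [/\ invmx (P x) *m pole T x *m P x = D x,
    forall k, invmx (P x) *m defo T k x *m P x = pd k D x,
    invmx (P x) *m Bo *m P x = B' + lie (F x) (D x) &
    forall k, invmx (P x) *m pd k P x = lie (pd k D x) (F x)].
  move=> Ux; have [psi [p1 p2 fz fx]] := fs _ Ux.
  have uP := Pu _ Ux.
  have e0 : psi 0%N = invmx (P x).
    have := p1 0%N; rewrite fmul_coef0 /fone /= => e.
    by rewrite -[LHS]mulmx1 -(mulmxV uP) mulmxA e mul1mx.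
  have e1 : psi 1%N = - (F x *m invmx (P x)).
    have := p1 1%N; rewrite fmul_coef1 /fone /= e0.
    move=> /eqP; rewrite addrC addr_eq0 => /eqP e.
    by rewrite -[LHS]mulmx1 -(mulmxV uP) mulmxA e mulNmx.
  have PiP : invmx (P x) *m P x = 1%:M by exact: mulVmx.
  have PPi : P x *m invmx (P x) = 1%:M by exact: mulmxV.
  have conjF (M : 'M[K]_n) : invmx (P x) *m M *m Phi 1%N x = invmx (P x) *m M *m P x *m F x.
    by rewrite /F !mulmxA -[_ *m P x *m invmx _]mulmxA PPi mulmx1.
  have PA : invmx (P x) *m pole T x *m P x = D x.
    have := fz 1%N; rewrite !(fmul_coef0, fmul_coef1) /= e0.
    rewrite !(mulmx0, mul0mx, addr0, add0r) mulmxN mulNmx.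
    by move=> /oppr_inj.
  have PC k : invmx (P x) *m defo T k x *m P x = pd k D x.
    have := fx k 0%N; rewrite !fmul_coef0 /= e0.
    rewrite !(mulmx0, addr0) mulmxN mulNmx.
    by move=> /oppr_inj.
  split; [exact: PA|exact: PC| |].
    have := fz 2%N; rewrite !(fmul_coef0, fmul_coef1, fmul_coef2) /= e0 e1.
    rewrite mulr0n oppr0 !(mulmx0, mul0mx, addr0, add0r) mulmxDl.
    rewrite !(mulmxN, mulNmx) opprK conjF PA -/P.
    have -> : F x *m invmx (P x) *m pole T x *m P x = F x *m D x.
      by rewrite -PA !mulmxA.
    rewrite /lie.
    move: (invmx (P x) *m Bo *m P x) (D x *m F x) (F x *m D x) => X Y Z.
    move=> /eqP; rewrite -subr_eq0 => /eqP E; apply/eqP; rewrite -subr_eq0.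
    rewrite -oppr_eq0 -[X in _ == X]E; apply/eqP/matrixP => i j; rewrite !mxE.
    by ring.
  move=> k; have := fx k 1%N; rewrite !(fmul_coef0, fmul_coef1) /= e0 e1.
  rewrite !(mulmx0, addr0, add0r) !(mulmxN, mulNmx) opprK conjF PC -/P.
  have -> : F x *m invmx (P x) *m defo T k x *m P x = F x *m pd k D x.
    by rewrite -PC !mulmxA.
  rewrite /lie -/P.
  move: (invmx (P x) *m pd k P x) (pd k D x *m F x) (F x *m pd k D x) => X Y Z.
  move=> E; apply/eqP; rewrite -subr_eq0.
  rewrite -[X in _ == X]E; apply/eqP/matrixP => i j; rewrite !mxE.
  by ring.
have dF : holomorphic_on U F.
  move=> x Ux; apply: differentiable_mulmx; last exact: PU.
  by apply: differentiable_invmx; [exact: PU|exact: Pu].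
apply: (@I_dv_cst_frame Ao Bo T U P D (fun x => offdiag (F x))).
- split; first exact: TI.
    exists U, P; split; [exact: Uo|exact: UT|exact: PG|].
    by move=> x _ Ux; have [-> _ _ _] := key x Ux; exact: Dd.
  exists U, P; split; [exact: Uo|exact: UT|exact: PG|].
  by move=> x k Ux; have [_ -> _ _] := key x Ux; exact: (is_diag_pd k Uo DU Dd Ux).
- exact: Uo.
- exact: UT.
- exact: PG.
- exact: DU.
- move=> x Ux; apply/diff_mxP => i j.
  have [ij|ij] := eqVneq i j.
    have -> : (fun y => offdiag (F y) i j) = cst 0.
      by apply/funext => y; rewrite offdiagE ij eqxx.
    exact: differentiable_cst.
  have -> : (fun y => offdiag (F y) i j) = (fun y => F y i j).
    by apply/funext => y; rewrite offdiagE (negbTE ij).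
  exact: ((diff_mxP _ _).1 (dF x Ux)).
- exact: Dd.
- by move=> x Ux; have [] := key x Ux.
- by move=> k x Ux; have [] := key x Ux.
- by move=> x Ux; exact: offdiagK.
- move=> x Ux; have [_ _ -> _] := key x Ux.
  rewrite -(offdiag_lie_r _ (Dd x Ux)); apply: offdiag_eqP => i j ij.
  by rewrite mxE (is_diag_mxP B'd) // add0r.
- move=> k x Ux; have [_ _ _ ->] := key x Ux.
  exact: (offdiag_lie_l _ (is_diag_pd k Uo DU Dd Ux)).
Qed.

End ConstantFrame.

(** * Integrability in a frame that diagonalizes A *)

Section DiagonalGauge.
Context {K : numFieldType} {m n : nat}.
Hypothesis K_smooth : smooth_field K.
Variables (Bo : 'M[K]_n) (T : deformation K m n) (W : set 'rV[K]_m).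
Variables (f : 'I_n -> 'rV[K]_m -> K) (G : 'rV[K]_m -> 'M[K]_n).
Hypotheses (Wo : open W) (AW : holomorphic_on W (pole T)).
Hypothesis CW : forall k, holomorphic_on W (defo T k).
Hypothesis AC : forall x k, W x -> lie (pole T x) (defo T k x) = 0.
Hypothesis dA : forall x k, W x ->
  pd k (pole T) x = defo T k x + lie (defo T k x) Bo.
Hypotheses (GW : hol_GL W G) (fW : forall i, holomorphic_on W (f i)).

Let Dl x : 'M[K]_n := diag_mx (\row_i f i x).
Hypothesis GA : forall x, W x -> invmx (G x) *m pole T x *m G x = Dl x.

Let Bt x : 'M[K]_n := invmx (G x) *m Bo *m G x.
Let vp k x : 'M[K]_n := invmx (G x) *m pd k G x.
Let Ct k x : 'M[K]_n := invmx (G x) *m defo T k x *m G x.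

Let Gu x : W x -> G x \in unitmx. Proof. exact: GW.2. Qed.
Let Gh : holomorphic_on W G. Proof. exact: GW.1. Qed.

Lemma gauge_diag_holomorphic : holomorphic_on W Dl.
Proof.
move=> x Wx; apply/diff_mxP => i j.
have [ij|ij] := eqVneq i j.
  have -> : (fun y => Dl y i j) = f i by apply/funext => y; rewrite !mxE ij eqxx.
  exact: fW.
have -> : (fun y => Dl y i j) = cst 0 by apply/funext => y; rewrite !mxE (negbTE ij).
exact: differentiable_cst.
Qed.

Lemma gauge_inv_holomorphic : holomorphic_on W (fun x => invmx (G x)).
Proof. by move=> x Wx; apply: differentiable_invmx; [exact: Gh|exact: Gu]. Qed.

Lemma gauge_vp_holomorphic k : holomorphic_on W (vp k).
Proof.
move=> x Wx; apply: differentiable_mulmx; first exact: gauge_inv_holomorphic.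
exact: (proj1 (K_smooth Wo Gh) k x Wx).
Qed.

Lemma gauge_Bt_holomorphic : holomorphic_on W Bt.
Proof.
move=> x Wx; apply: differentiable_mulmx; last exact: Gh.
apply: differentiable_mulmx; first exact: gauge_inv_holomorphic.
exact: differentiable_cst.
Qed.

Lemma gauge_Ct_holomorphic k : holomorphic_on W (Ct k).
Proof.
move=> x Wx; apply: differentiable_mulmx; last exact: Gh.
apply: differentiable_mulmx; first exact: gauge_inv_holomorphic.
exact: CW.
Qed.

Lemma gauge_diag_pd k x : W x -> pd k Dl x = diag_mx (\row_i pd k (f i) x).
Proof.
move=> Wx; apply/matrixP => i j; rewrite !mxE.
apply: (etrans (derive_mx_entry _ i j (gauge_diag_holomorphic Wx))).
have [ij|ij] := eqVneq i j.
  have -> : (fun y => Dl y i j) = f i by apply/funext => y; rewrite !mxE ij eqxx.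
  by rewrite mulr1n.
have -> : (fun y => Dl y i j) = cst 0 by apply/funext => y; rewrite !mxE (negbTE ij).
by rewrite mulr0n; exact: derive_cst.
Qed.

Lemma gauge_commute k x : W x -> lie (Dl x) (Ct k x) = 0.
Proof.
move=> Wx; have GiG := mulVmx (Gu Wx); have GGi := mulmxV (Gu Wx).
have E (M N : 'M[K]_n) : invmx (G x) *m M *m G x *m (invmx (G x) *m N *m G x) =
    invmx (G x) *m (M *m N) *m G x.
  by rewrite !mulmxA -[_ *m G x *m invmx _]mulmxA GGi mulmx1.
rewrite /lie -(GA Wx) /Ct !E -mulmxBl -mulmxBr.
by have := AC k Wx; rewrite /lie => ->; rewrite mulmx0 mul0mx.
Qed.

(** Differentiate A G = G D, substitute dA = C + [C, B_o] and multiply by G^-1 on the left. *)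
Lemma gauge_dA k x : W x ->
  pd k Dl x + lie (vp k x) (Dl x) = Ct k x + lie (Ct k x) (Bt x).
Proof.
move=> Wx; have GiG := mulVmx (Gu Wx); have GGi := mulmxV (Gu Wx).
have AG y : W y -> pole T y *m G y = G y *m Dl y.
  by move=> Wy; rewrite -(GA Wy) !mulmxA mulmxV ?mul1mx //; exact: Gu.
have E1 := derive_mulmx (delta_mx 0 k) (AW Wx) (Gh Wx).
have E2 := derive_mulmx (delta_mx 0 k) (Gh Wx) (gauge_diag_holomorphic Wx).
have E : pd k (pole T) x *m G x + pole T x *m pd k G x =
    pd k G x *m Dl x + G x *m pd k Dl x.
  apply: (etrans (esym E1)); apply: (etrans _ E2).
  by apply: near_eq_derive; exact: near_open Wo Wx AG.
have {}E := congr1 (mulmx (invmx (G x))) E.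
move: E; rewrite !mulmxDr (dA k Wx) !mulmxA GiG mul1mx.
have -> : invmx (G x) *m pole T x *m pd k G x = Dl x *m vp k x.
  by rewrite -(GA Wx) /vp !mulmxA -[_ *m G x *m invmx _]mulmxA GGi mulmx1.
have H (M N : 'M[K]_n) : invmx (G x) *m (M *m N) *m G x =
    invmx (G x) *m M *m G x *m (invmx (G x) *m N *m G x).
  by rewrite !mulmxA -[_ *m G x *m invmx _]mulmxA GGi mulmx1.
rewrite mulmxDr mulmxDl /lie mulmxBr mulmxBl !H -/(Bt x) -/(Ct k x) -/(vp k x).
move: (Ct k x *m Bt x) (Bt x *m Ct k x) (Dl x *m vp k x) (vp k x *m Dl x) (Ct k x) (pd k Dl x).
move=> a b c d e g E; apply/eqP; rewrite -subr_eq0; apply/eqP.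
move/eqP: E; rewrite -subr_eq0 => /eqP E; rewrite -oppr0 -E.
by apply/matrixP => i j; rewrite !mxE; ring.
Qed.

Lemma gauge_dA_entry k x i j : W x ->
  (pd k Dl x) i j + (lie (vp k x) (Dl x)) i j = (Ct k x) i j + (lie (Ct k x) (Bt x)) i j.
Proof. by move=> Wx; rewrite -!addmxE gauge_dA. Qed.

(** Cancellation of f_i - f_j covers two situations at once: eigenvalues distinct at every point,
    and generic d-type, where f_i - f_j may have zeros but has a nonvanishing derivative. *)
Hypothesis cancel : forall (q : 'rV[K]_m -> K) i j, i != j -> holomorphic_on W q ->
  (forall x, W x -> q x * (f i x - f j x) = 0) -> forall x, W x -> q x = 0.

Lemma gauge_defo_diag k x : W x -> is_diag_mx (Ct k x).
Proof.
move=> Wx; apply/is_diag_mxP => i j ij.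
have ij' : i != j by apply: contraNneq ij => ->.
apply: (cancel (q := fun y => Ct k y i j) ij') Wx.
  by move=> y Wy; exact: ((diff_mxP _ _).1 (gauge_Ct_holomorphic k Wy)).
move=> y Wy; have /matrixP/(_ i j) := gauge_commute k Wy.
have -> : (0 : 'M[K]_n) i j = 0 by rewrite mxE.
by rewrite lie_diag_l ?diag_mx_diag // !diag_mx_entry mulrC.
Qed.

(** A bracket with a diagonal matrix has zero diagonal, so only these two terms survive on the
    diagonal of [gauge_dA]. *)
Lemma gauge_defoE k x : W x -> Ct k x = pd k Dl x.
Proof.
move=> Wx; have Cd := gauge_defo_diag k Wx; apply/matrixP => i j.
have [<-|ij] := eqVneq i j; last first.
  by rewrite (is_diag_mxP Cd) // gauge_diag_pd // (is_diag_mxP (diag_mx_diag _)).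
have := gauge_dA_entry k i i Wx.
rewrite lie_diag_r ?diag_mx_diag // subrr mulr0 addr0 => ->.
by rewrite lie_diag_l // subrr mul0r addr0.
Qed.

(** The off-diagonal part of [gauge_dA], once C is known to be dD in this frame. *)
Lemma gauge_offdiag k x i j : W x -> i != j ->
  vp k x i j * (f j x - f i x) = (pd k (f i) x - pd k (f j) x) * Bt x i j.
Proof.
move=> Wx ij; have := gauge_dA_entry k i j Wx.
rewrite gauge_defoE // => /addrI.
rewrite lie_diag_r ?diag_mx_diag // gauge_diag_pd // lie_diag_l ?diag_mx_diag //.
by rewrite !diag_mx_entry.
Qed.

Section OffDiagonalPart.
Variable L : 'rV[K]_m -> 'M[K]_n.
Hypothesis LW : holomorphic_on W L.
Hypothesis LB : forall x i j, W x -> i != j -> Bt x i j = L x i j * (f j x - f i x).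

(** Substituting the factorization of B into [gauge_offdiag] leaves a common factor f_j - f_i to
    cancel. The same L serves for all directions k. *)
Lemma gauge_vpE k x i j : W x -> i != j ->
  vp k x i j = (pd k (f i) x - pd k (f j) x) * L x i j.
Proof.
move=> Wx ij; apply/eqP; rewrite -subr_eq0; apply/eqP.
have fij (l : 'I_n) : holomorphic_on W (fun y => pd k (f l) y).
  move=> y Wy.
  have E z : W z -> (pd k Dl z) l l = pd k (f l) z.
    by move=> Wz; rewrite gauge_diag_pd // diag_mx_entry.
  apply: (near_eq_diff (near_open Wo Wy E)).
  exact: ((diff_mxP _ _).1 (proj1 (K_smooth Wo gauge_diag_holomorphic) k y Wy) l l).
apply: (cancel (q := fun y => vp k y i j - (pd k (f i) y - pd k (f j) y) * L y i j) ij) Wx.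
  move=> y Wy; apply: differentiableB.
    exact: ((diff_mxP _ _).1 (gauge_vp_holomorphic k Wy)).
  apply: differentiableM; first by apply: differentiableB; exact: fij.
  exact: ((diff_mxP _ _).1 (LW Wy)).
move=> y Wy; have := gauge_offdiag k Wy ij; rewrite (LB Wy ij).
move: (vp k y i j) (f i y) (f j y) (pd k (f i) y) (pd k (f j) y) (L y i j).
move=> v a b c d e H; apply: oppr_inj; rewrite oppr0.
have -> : - ((v - (c - d) * e) * (a - b)) = v * (b - a) - (c - d) * (e * (b - a)) by ring.
by rewrite H subrr.
Qed.

Lemma gauge_I_dv Ao : I_d Ao Bo T -> W (base T) -> I_dv Ao Bo T.
Proof.
move=> TI Wb.
have Dd x : is_diag_mx (Dl x) by exact: diag_mx_diag.
apply: (@I_dv_cst_frame K m n K_smooth Ao Bo T W G Dl (fun x => offdiag (L x))).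
- exact: TI.
- exact: Wo.
- exact: Wb.
- exact: GW.
- exact: gauge_diag_holomorphic.
- move=> x Wx; apply/diff_mxP => i j.
  have [ij|ij] := eqVneq i j.
    have -> : (fun y => offdiag (L y) i j) = cst 0.
      by apply/funext => y; rewrite offdiagE ij eqxx.
    exact: differentiable_cst.
  have -> : (fun y => offdiag (L y) i j) = (fun y => L y i j).
    by apply/funext => y; rewrite offdiagE (negbTE ij).
  exact: ((diff_mxP _ _).1 (LW Wx)).
- by move=> x _; exact: Dd.
- exact: GA.
- by move=> k x Wx; exact: gauge_defoE.
- by move=> x _; exact: offdiagK.
- move=> x Wx; rewrite -(offdiag_lie_r _ (Dd x)); apply: offdiag_eqP => i j ij.
  by rewrite (LB Wx ij) lie_diag_r // !diag_mx_entry.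
- move=> k x Wx.
  have Dpd : is_diag_mx (pd k Dl x) by rewrite gauge_diag_pd //; exact: diag_mx_diag.
  rewrite -(offdiag_lie_l _ Dpd); apply: offdiag_eqP => i j ij.
  rewrite (gauge_vpE k Wx ij) lie_diag_l // gauge_diag_pd // !diag_mx_entry.
  by [].
Qed.

End OffDiagonalPart.

End DiagonalGauge.

Lemma open_of_near (V : topologicalType) (x : V) (P : set V) :
  (\forall y \near x, P y) -> exists W : set V, [/\ open W, W x & W `<=` P].
Proof.
by move=> xP; exists P^°; split; [exact: open_interior|exact: xP|exact: interior_subset].
Qed.

Section GenericType.
Context {K : numFieldType} {m n : nat}.
Hypothesis K_smooth : smooth_field K.

Lemma holomorphic_pd_scalar (W : set 'rV[K]_m) (h : 'rV[K]_m -> K) k :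
  open W -> holomorphic_on W h -> holomorphic_on W (fun x => pd k h x).
Proof.
move=> Wo hW; pose M x : 'M[K]_(1, 1) := const_mx (h x).
have E : (fun x => M x 0 0) = h by apply/funext => x; rewrite mxE.
have MW : holomorphic_on W M.
  move=> x Wx; apply/diff_mxP => i j.
  have -> : (fun x => M x i j) = h by apply/funext => y; rewrite mxE.
  exact: hW.
move=> x Wx.
have e z : W z -> (pd k M z) 0 0 = pd k h z.
  by move=> Wz; apply: (etrans (derive_mx_entry _ 0 0 (MW z Wz))); rewrite E.
apply: (near_eq_diff (near_open Wo Wx e)).
exact: ((diff_mxP _ _).1 (proj1 (K_smooth Wo MW) k x Wx) 0 0).
Qed.

(** Near a point where q is nonzero, h would vanish identically, and so would its derivative. *)
Lemma cancel_nonzero_derivative (W : set 'rV[K]_m) (h q : 'rV[K]_m -> K) k :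
  open W -> holomorphic_on W q -> (forall x, W x -> pd k h x != 0) ->
  (forall x, W x -> q x * h x = 0) -> forall x, W x -> q x = 0.
Proof.
move=> Wo qW dh qh x Wx; apply/eqP; apply: contraT => qx.
suff : pd k h x = 0 by move/eqP; rewrite (negbTE (dh x Wx)).
have E : pd k h x = 'D_(delta_mx 0 k) (cst (0 : K)) x.
  apply: near_eq_derive.
  have nearq : \forall y \near x, q y != 0.
    by apply: continuous_near_neq0 qx; apply: differentiable_continuous; exact: qW.
  have nearW : \forall y \near x, W y by apply: near_open Wo Wx _.
  apply: filterS2 nearq nearW => y qy Wy.
  by have /eqP := qh y Wy; rewrite mulf_eq0 (negbTE qy) => /eqP.
by rewrite E; exact: derive_cst.
Qed.

Lemma diff_neq_pd (h1 h2 : 'rV[K]_m -> K) x :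
  differentiable h1 x -> differentiable h2 x ->
  ('d h1 x : 'rV[K]_m -> K) <> 'd h2 x -> exists k, pd k h1 x != pd k h2 x.
Proof.
move=> d1 d2 ne; apply: contrapT => /forallNP H; apply: ne; apply/funext => v.
rewrite [v]row_sum_delta !linear_sum; apply: eq_bigr => k _; rewrite !linearZ.
have /negP := H k; rewrite negbK => /eqP; rewrite /pd (deriveE _ d1) (deriveE _ d2).
exact: congr1.
Qed.

Lemma I_d_gen_sub_dv (Ao Bo : 'M[K]_n) (T : deformation K m n) :
  I_d_gen Ao Bo T -> I_dv Ao Bo T.
Proof.
move=> [TI [U [f [Uo UT fU [_ _ [G [GU GA]]] fgen]]]].
have [[_ [U1 [U1o U1T AU1 CU1 TU1]]] _ _] := TI.
(* For each pair, a direction in which the two differentials differ; the option type covers i = j,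
   since 'I_m may be empty. *)
have /choice[kap kapP] : forall ij : 'I_n * 'I_n, exists k : option 'I_m,
    ij.1 != ij.2 -> exists2 l, k = Some l & pd l (f ij.1) (base T) != pd l (f ij.2) (base T).
  move=> [i j] /=; have [ij|ij] := eqVneq i j; first by exists None.
  have [k kP] := diff_neq_pd (fU i _ UT) (fU j _ UT) (fgen _ _ ij).
  by exists (Some k) => _; exists k.
pose d ij x : K := if kap ij is Some k then pd k (f ij.1) x - pd k (f ij.2) x else 0.
have dU ij : holomorphic_on U (d ij).
  move=> x Ux; rewrite /d; case: (kap ij) => [k|]; last exact: differentiable_cst.
  by apply: differentiableB; exact: (holomorphic_pd_scalar k Uo (fU _) Ux).
have : \forall x \near base T, (U x /\ U1 x) /\ forall ij : 'I_n * 'I_n,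
    ij.1 != ij.2 -> d ij x != 0.
  apply: filterI.
    by apply: filterI; apply: open_nbhs_nbhs; split.
  suff H ij : \forall x \near base T, ij.1 != ij.2 -> d ij x != 0.
    exact: (@filter_forall _ ('I_n * 'I_n)%type
      (fun ij x => ij.1 != ij.2 -> d ij x != 0) _ _ H).
  have [e|e] := eqVneq ij.1 ij.2; first by apply: (near_open Uo UT) => x _; rewrite ?e ?eqxx.
  have dT : d ij (base T) != 0.
    by rewrite /d; have [l -> lP] := kapP _ e; rewrite subr_eq0.
  have dc : {for base T, continuous (d ij)}.
    by apply: differentiable_continuous; exact: dU.
  by apply: filterS (continuous_near_neq0 dc dT).
move=> /open_of_near[W [Wo WT WP]].
have WU x : W x -> U x by move=> /WP[[]].
have WU1 x : W x -> U1 x by move=> /WP[[]].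
have Wd x i j : W x -> i != j -> d (i, j) x != 0.
  by move=> /WP[_ H] ij; exact: (H (i, j)).
pose v k x : 'M[K]_n := invmx (G x) *m pd k G x.
(* [gauge_vpE] read backwards in the single direction chosen for (i, j); [gauge_offdiag] in that
   direction shows that L factors B. *)
pose L x : 'M[K]_n := \matrix_(i, j)
  (if i == j then 0 else
   if kap (i, j) is Some k then (d (i, j) x)^-1 * v k x i j else 0).
have GW : hol_GL W G.
  by split=> [x /WU|x /WU]; [exact: GU.1|exact: GU.2].
have fW i : holomorphic_on W (f i) by move=> x /WU; exact: fU.
have AW : holomorphic_on W (pole T) by move=> x /WU1; exact: AU1.
have CW k : holomorphic_on W (defo T k) by move=> x /WU1; exact: CU1.
have AC x k : W x -> lie (pole T x) (defo T k x) = 0.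
  by move=> /WU1 /TU1[].
have dA x k : W x -> pd k (pole T) x = defo T k x + lie (defo T k x) Bo.
  by move=> /WU1 /TU1[].
have GA' x : W x -> invmx (G x) *m pole T x *m G x = diag_mx (\row_i f i x).
  by move=> /WU; exact: GA.
have cancel (q : 'rV[K]_m -> K) i j : i != j -> holomorphic_on W q ->
    (forall x, W x -> q x * (f i x - f j x) = 0) -> forall x, W x -> q x = 0.
  move=> ij qW qf.
  have [k kE _] := kapP (i, j) ij.
  apply: (@cancel_nonzero_derivative W (f i - f j) q k Wo qW) => [x Wx|]; last exact: qf.
  have := Wd x i j Wx ij; rewrite /d kE /=.
  have -> // : pd k (f i - f j) x = pd k (f i) x - pd k (f j) x.
  exact: deriveB (diff_derivable (fW i x Wx)) (diff_derivable (fW j x Wx)).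
have LE x i j : i != j -> L x i j =
    if kap (i, j) is Some k then (d (i, j) x)^-1 * v k x i j else 0.
  by move=> ij; rewrite mxE (negbTE ij).
have vW k : holomorphic_on W (v k) by exact: (gauge_vp_holomorphic K_smooth Wo GW).
have LW : holomorphic_on W L.
  move=> x Wx; apply/diff_mxP => i j.
  have [ij|ij] := eqVneq i j.
    have -> : (fun y => L y i j) = cst 0 by apply/funext => y; rewrite mxE ij eqxx.
    exact: differentiable_cst.
  have [k kE _] := kapP (i, j) ij.
  have -> : (fun y => L y i j) = (fun y => (d (i, j) y)^-1) * (fun y => v k y i j).
    by apply/funext => y; rewrite LE // kE.
  apply: differentiableM; last exact: ((diff_mxP _ _).1 (vW k x Wx)).
  by apply: differentiableV; [exact: (dU _ _ (WU x Wx))|exact: Wd].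
apply: (gauge_I_dv K_smooth Wo AW CW AC dA GW fW GA' cancel LW _ TI WT) => x i j Wx ij.
have [k kE _] := kapP (i, j) ij.
have H := gauge_offdiag Wo AW CW AC dA GW fW GA' cancel k Wx ij.
have dx := Wd x i j Wx ij.
have dE : d (i, j) x = pd k (f i) x - pd k (f j) x by rewrite /d kE.
by rewrite (LE x i j ij) kE -mulrA H -dE mulrA (mulVf dx) mul1r.
Unshelve. all: by end_near. Qed.

End GenericType.

(** * Holomorphic eigenframes near a simple spectrum *)

Section CharPolyCoefficients.
Context {K : numFieldType} {V : normedModType K}.
Variable x : V.
Implicit Types P Q : V -> {poly K}.

Let dcoef P := forall k, differentiable (fun y => (P y)`_k) x.

Let dcoef_cst p : dcoef (fun=> p).
Proof. by move=> k; exact: differentiable_cst. Qed.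

Let dcoef_mul P Q : dcoef P -> dcoef Q -> dcoef (fun y => P y * Q y).
Proof.
move=> dP dQ k.
have -> : (fun y => (P y * Q y)`_k) = (fun y => \sum_(j < k.+1) (P y)`_j * (Q y)`_(k - j)).
  by apply/funext => y; rewrite coefM.
by apply: differentiable_bigsum => j _; exact: differentiableM.
Qed.

Let dcoef_sum (I : Type) (r : seq I) (P : I -> V -> {poly K}) :
  (forall i, dcoef (P i)) -> dcoef (fun y => \sum_(i <- r) P i y).
Proof.
move=> dP k.
have -> : (fun y => (\sum_(i <- r) P i y)`_k) = (fun y => \sum_(i <- r) (P i y)`_k).
  by apply/funext => y; rewrite coef_sum.
by apply: differentiable_bigsum => i _; exact: dP.
Qed.

Let dcoef_prod (I : Type) (r : seq I) (P : I -> V -> {poly K}) :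
  (forall i, dcoef (P i)) -> dcoef (fun y => \prod_(i <- r) P i y).
Proof.
move=> dP; elim: r => [|i r IH].
  have -> : (fun y => \prod_(i <- [::]) P i y) = (fun=> 1).
    by apply/funext => y; rewrite big_nil.
  exact: dcoef_cst.
have -> : (fun y => \prod_(j <- i :: r) P j y) = (fun y => P i y * \prod_(j <- r) P j y).
  by apply/funext => y; rewrite big_cons.
exact: dcoef_mul.
Qed.

Lemma differentiable_char_poly_coef (n : nat) (A : V -> 'M[K]_n) k :
  differentiable A x -> differentiable (fun y => (char_poly (A y))`_k) x.
Proof.
move=> /diff_mxP dA; move: k.
suff H i j : dcoef (fun y => (char_poly_mx (A y)) i j).
  by apply: dcoef_sum => s; apply: dcoef_mul; [exact: dcoef_cst|apply: dcoef_prod].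
move=> k.
have -> : (fun y => ((char_poly_mx (A y)) i j)`_k) =
    (fun y => ('X *+ (i == j) : {poly K})`_k - (A y i j * (k == 0%N)%:R)).
  apply/funext => y; rewrite !mxE coefB coefC.
  by case: (k == 0%N); rewrite ?mulr1 ?mulr0.
apply: differentiableB; first exact: differentiable_cst.
apply: differentiableM; first exact: dA.
exact: differentiable_cst.
Qed.

End CharPolyCoefficients.

Section VanishingFactor.
Context {K : numFieldType} {V : normedModType K}.

(** At a zero of [a], continuity of [b] is enough, and the differential is b x times that of [a].
    This makes eigenvalues differentiable without an implicit function theorem. *)
Lemma differentiable_mul_vanishing (a b : V -> K) x :
  differentiable a x -> a x = 0 -> {for x, continuous b} ->
  differentiable (fun y => a y * b y) x.
Proof.
move=> da a0 bc.
have Lc : continuous ('d a x) by exact: diff_continuous.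
pose L : {linear V -> K} := (b x \*: 'd a x)%R.
have LLc : continuous L.
  by move=> y; apply: (@cvgM _ _ _ _ (cst (b x))); [exact: cvg_cst|exact: Lc].
have [M M0 MP] : exists2 M, 0 < M & forall h, `|'d a x h| <= M * `|h|.
  have /linear_boundedP[M [Mr MP]] : bounded_near ('d a x) (nbhs (0 : V)).
    by apply: continuous_linear_bounded; exact: Lc.
  have M1 : M < `|M| + 1.
    by rewrite (le_lt_trans (real_ler_norm Mr)) // ltrDl.
  by exists (`|M| + 1); [rewrite ltr_wpDl|exact: MP].
suff [] : is_diff x (fun y => a y * b y) L by [].
apply: eps_diff => // e e0.
pose e1 := e / (2 * (`|b x| + 1)).
have bx1 : 0 < `|b x| + 1 by rewrite ltr_wpDl.
have e10 : 0 < e1 by rewrite divr_gt0 ?mulr_gt0.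
pose e2 := e / (2 * (M + e1)).
have Me : 0 < M + e1 by exact: addr_gt0.
have e20 : 0 < e2 by rewrite divr_gt0 ?mulr_gt0.
have [d1 d10 d1P] := diff_eps da e10.
have /cvgrPdist_lt/(_ e2 e20)/nbhs_ballP[d2 /= d20 d2P] := bc.
have [d d0 [dd1 dd2]] : exists2 d, 0 < d & d <= d1 /\ d <= d2.
  have [?|/ltW ?] := real_leP (gtr0_real d10) (gtr0_real d20); first by exists d1.
  by exists d2.
exists d => // h hd; rewrite a0 mul0r subr0.
suff : `|a (h + x) * b (h + x) - b x * 'd a x h| <= e * `|h| by [].
have h1 := d1P h (lt_le_trans hd dd1); rewrite a0 subr0 in h1.
have h2 : `|b x - b (h + x)| < e2.
  apply: d2P; rewrite -ball_normE /= opprD addrCA subrr addr0 normrN.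
  exact: lt_le_trans hd dd2.
have -> : a (h + x) * b (h + x) - b x * 'd a x h =
    a (h + x) * (b (h + x) - b x) + b x * (a (h + x) - 'd a x h) by ring.
rewrite (le_trans (ler_normD _ _)) // !normrM.
have h3 : `|a (h + x)| <= (M + e1) * `|h|.
  rewrite -[a _](subrK ('d a x h)) (le_trans (ler_normD _ _)) // mulrDl addrC.
  by rewrite lerD.
have -> : e * `|h| = (M + e1) * `|h| * e2 + (`|b x| + 1) * (e1 * `|h|).
  have half u : 0 < u -> u * (e / (2 * u)) = e / 2.
    by move=> /gt_eqF/negbT u0; field.
  have E (u v w t s : K) : u * s * v + w * (t * s) = (u * v + w * t) * s by ring.
  by rewrite E (half _ Me) (half _ bx1) -splitr.
apply: lerD; apply: ler_pM => //; first by rewrite distrC ltW.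
by rewrite lerDl.
Qed.

End VanishingFactor.

(** * Perturbation of simple roots *)

Section RootsNearPoints.
Context {K : numFieldType} {n : nat}.
Hypothesis K_split : forall p : {poly K}, p \is monic ->
  exists rs, p = \prod_(z <- rs) ('X - z%:P).

(** The sum of the inverse distances bounds each of them; it replaces a minimum, as the order of K
    is only partial. *)
Lemma injective_separation (lam : 'I_n -> K) : injective lam ->
  exists2 d, 0 < d & forall i j, i != j -> 3 * d <= `|lam i - lam j|.
Proof.
move=> lamI; pose g (ij : 'I_n * 'I_n) := `|lam ij.1 - lam ij.2|^-1.
pose s := 1 + \sum_ij g ij.
have g0 ij : 0 <= g ij by rewrite invr_ge0.
have s0 : 0 < s by rewrite ltr_wpDr // sumr_ge0.
exists (3^-1 * s^-1) => [|i j ij]; first by rewrite mulr_gt0 ?invr_gt0.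
rewrite mulrA divff ?mul1r; last by rewrite pnatr_eq0.
have lij : 0 < `|lam i - lam j|.
  by rewrite normr_gt0 subr_eq0; apply: contra ij => /eqP/lamI ->.
rewrite -[leRHS]invrK lef_pV2 ?posrE ?invr_gt0 //.
rewrite /s (bigD1 (i, j)) //= addrCA lerDl addr_ge0 // sumr_ge0 //.
Qed.

(** If all n roots were at distance at least d from t, their product formula would give |p(t)| >=
    d^n. *)
Lemma monic_root_near (p : {poly K}) (d t : K) : p \is monic -> size p = n.+1 -> 0 < d ->
  `|p.[t]| < d ^+ n -> exists2 z, root p z & `|t - z| < d.
Proof.
move=> pm ps d0 pt; have [rs pE] := K_split pm.
have rs_n : size rs = n by move: ps; rewrite pE size_prod_XsubC => -[].
have [/hasP[z zrs zd]|far] := boolP (has (fun z => `|t - z| < d) rs).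
  by exists z => //; rewrite pE root_prod_XsubC.
suff : d ^+ n <= `|p.[t]|.
  by move=> /(lt_le_trans pt); rewrite ltxx.
have -> : d ^+ n = \prod_(z <- rs) d by rewrite big_const_seq count_predT rs_n iter_mulr_1.
rewrite pE horner_prod normr_prod.
under [leRHS]eq_bigr => z _ do rewrite hornerXsubC.
rewrite big_seq [leRHS]big_seq; apply: ler_prod => z zrs.
rewrite (ltW d0) /=; move/hasPn: far => /(_ z zrs).
by case: (real_leP (gtr0_real d0) (normr_real (t - z))).
Qed.

(** Roots within d of points that are 3 d apart are distinct; being n in number, they exhaust the
    roots of p. *)
Lemma monic_roots_near (p : {poly K}) (d : K) (lam : 'I_n -> K) :
  p \is monic -> size p = n.+1 -> 0 < d ->
  (forall i j, i != j -> 3 * d <= `|lam i - lam j|) ->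
  (forall i, `|p.[lam i]| < d ^+ n) ->
  exists mu : 'I_n -> K,
    (forall i, `|lam i - mu i| < d) /\ p = \prod_i ('X - (mu i)%:P).
Proof.
move=> pm ps d0 sep plam.
have /choice[mu muP] : forall i, exists z, root p z /\ `|lam i - z| < d.
  by move=> i; have [z] := monic_root_near pm ps d0 (plam i); exists z.
exists mu; split=> [i|]; first exact: (muP i).2.
have muI : injective mu.
  move=> i j muij; apply/eqP; apply: contraT => ij.
  have := sep i j ij; have := (muP i).2; have := (muP j).2; rewrite -muij => hj hi H.
  have : `|lam i - lam j| < d + d.
    have -> : lam i - lam j = (lam i - mu i) - (lam j - mu i) by ring.
    by rewrite (le_lt_trans (ler_normB _ _)) // ltrD.
  move=> /(le_lt_trans H); rewrite -subr_gt0.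
  have -> : d + d - 3 * d = - d by ring.
  by rewrite oppr_gt0 => /(lt_trans d0); rewrite ltxx.
pose rs := [seq mu i | i <- enum 'I_n].
have -> : \prod_i ('X - (mu i)%:P) = \prod_(z <- rs) ('X - z%:P).
  by rewrite big_map big_enum.
rewrite [LHS](@all_roots_prod_XsubC _ p rs).
- by rewrite (monicP pm) scale1r.
- by rewrite size_map size_enum_ord.
- by apply/allP => z /mapP[i _ ->]; exact: (muP i).1.
- by rewrite uniq_rootsE map_inj_uniq ?enum_uniq.
Qed.

End RootsNearPoints.

Section HolomorphicEigenvalues.
Context {K : numFieldType} {V : normedModType K} {n : nat}.
Variables (U : set V) (p : V -> {poly K}) (lam : 'I_n -> K) (d : K).
Variable mu : V -> 'I_n -> K.
Hypotheses (Uo : open U) (d0 : 0 < d).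
Hypothesis sep : forall i j, i != j -> 3 * d <= `|lam i - lam j|.
Hypothesis mu_near : forall x i, U x -> `|lam i - mu x i| < d.
Hypothesis pE : forall x, U x -> p x = \prod_i ('X - (mu x i)%:P).
Hypothesis dp : forall x k, U x -> differentiable (fun y => (p y)`_k) x.

Lemma near_roots_separated x y i k : U x -> U y -> i != k -> d <= `|mu y i - mu x k|.
Proof.
move=> Ux Uy ik; have := sep ik.
have -> : lam i - lam k = (mu y i - mu x k) + ((lam i - mu y i) - (lam k - mu x k)) by ring.
move=> /le_trans/(_ (ler_normD _ _)) H.
have h : `|(lam i - mu y i) - (lam k - mu x k)| <= d + d.
  rewrite (le_trans (ler_normB _ _)) // lerD // ltW //; exact: mu_near.
have {H h} := le_trans H (lerD (lexx _) h); rewrite -lerBlDr.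
by have -> : 3 * d - (d + d) = d by ring.
Qed.

(** The cofactor p x / (X - mu x i) evaluated at mu y i; the separation of the roots keeps it away
    from 0. *)
Let S x i y := \prod_(k | k != i) (mu y i - mu x k).

Let S_ge x i y : U x -> U y -> d ^+ #|[pred k : 'I_n | k != i]| <= `|S x i y|.
Proof.
move=> Ux Uy; rewrite normr_prod -prodr_const; apply: ler_prod => k ki.
by rewrite (ltW d0) near_roots_separated // eq_sym.
Qed.

Let S_neq0 x i y : U x -> U y -> S x i y != 0.
Proof.
move=> Ux Uy; rewrite -normr_gt0; apply: lt_le_trans (S_ge i Ux Uy).
exact: exprn_gt0.
Qed.

Let szp x : U x -> size (p x) = n.+1.
Proof.
by move=> Ux; rewrite pE // -big_enum size_prod_XsubC size_enum_ord.
Qed.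

(* [mu y i] is a root of [p y], so [p x] takes there the small value [(p x - p y).[mu y i]]. *)
Let root_increment x i y : U x -> U y ->
  mu y i - mu x i = \sum_(j < n.+1) ((p x)`_j - (p y)`_j) * (mu y i ^+ j / S x i y).
Proof.
move=> Ux Uy; apply: (mulIf (S_neq0 i Ux Uy)).
have -> : (mu y i - mu x i) * S x i y = (p x).[mu y i].
  rewrite (pE Ux) horner_prod (bigD1 i) //= hornerXsubC; congr (_ * _).
  by apply: eq_bigr => k _; rewrite hornerXsubC.
have py : (p y).[mu y i] = 0.
  by rewrite (pE Uy) horner_prod (bigD1 i) //= hornerXsubC subrr mul0r.
rewrite -[LHS]subr0 -[X in _ - X]py !horner_coef !szp // -sumrB mulr_suml.
by apply: eq_bigr => j _; rewrite -mulrBl -mulrA divfK ?S_neq0.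
Qed.

(** In [root_increment] the factors multiplying the coefficient increments are bounded by M^j / D,
    so the increment of the root tends to 0 with those of the coefficients. *)
Lemma continuous_root i x : U x -> {for x, continuous (fun y => mu y i)}.
Proof.
move=> Ux; apply/cvgrPdist_lt => e e0.
pose D := d ^+ #|[pred k : 'I_n | k != i]|.
have D0 : 0 < D by exact: exprn_gt0.
pose M := `|lam i| + d.
have M0 : 0 < M by rewrite ltr_wpDl.
pose s := 1 + \sum_(j < n.+1) M ^+ j / D.
have t0 (j : 'I_n.+1) : 0 <= M ^+ j / D by rewrite divr_ge0 ?exprn_ge0 // ltW.
have s0 : 0 < s by rewrite ltr_wpDr // sumr_ge0.
have es : 0 < e / s by rewrite divr_gt0.
have H (j : 'I_n.+1) : \forall y \near x, `|(p x)`_j - (p y)`_j| < e / s.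
  have /cvgrPdist_lt/(_ _ es) : {for x, continuous (fun y => (p y)`_j)}.
    by apply: differentiable_continuous; exact: dp.
  exact.
have nearp : \forall y \near x, forall j : 'I_n.+1, `|(p x)`_j - (p y)`_j| < e / s.
  exact: (@filter_forall _ 'I_n.+1 (fun j y => `|(p x)`_j - (p y)`_j| < e / s) _ _ H).
have nearU : \forall y \near x, U y by apply: near_open Uo Ux _.
apply: filterS2 nearp nearU => y yP Uy.
rewrite distrC root_increment // (le_lt_trans (ler_norm_sum _ _ _)) //.
have -> : e = e / s * s by rewrite divfK // gt_eqF.
apply: (@le_lt_trans _ _ (\sum_(j < n.+1) e / s * (M ^+ j / D))).
  apply: ler_sum => j _; rewrite normrM ler_pM // ?(ltW (yP j)) //.
  rewrite normrM normfV normrX ler_pM // ?invr_ge0 //.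
    apply: lerXn2r; rewrite ?nnegrE ?(ltW M0) //.
    have -> : mu y i = lam i - (lam i - mu y i) by ring.
    by rewrite (le_trans (ler_normB _ _)) // lerD2l ltW // mu_near.
  by rewrite lef_pV2 ?posrE ?normr_gt0 ?S_neq0 //; exact: S_ge.
by rewrite -mulr_sumr ltr_pM2l // /s ltrDr.
Qed.

(** Continuity upgrades to differentiability: each term of [root_increment] is a differentiable
    function vanishing at x times a continuous one. *)
Lemma holomorphic_root i : holomorphic_on U (fun x => mu x i).
Proof.
move=> x Ux.
have cmu k : {for x, continuous (fun y => mu y k)} by exact: continuous_root.
have cS : {for x, continuous (S x i)}.
  rewrite /S.
  have H (r : seq 'I_n) : {for x, continuous (fun y => \prod_(k <- r | k != i) (mu y i - mu x k))}.
    elim: r => [|k r IH].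
      have -> : (fun y => \prod_(k <- [::] | k != i) (mu y i - mu x k)) = cst 1.
        by apply/funext => y; rewrite big_nil.
      exact: cst_continuous.
    have [ki|ki] := boolP (k != i).
      have -> : (fun y => \prod_(l <- k :: r | l != i) (mu y i - mu x l)) =
          (fun y => (mu y i - mu x k) * \prod_(l <- r | l != i) (mu y i - mu x l)).
        by apply/funext => y; rewrite big_cons ki.
      apply: (@cvgM _ _ _ _ (fun y => mu y i - mu x k)); last exact: IH.
      by apply: cvgB; [exact: cmu|exact: cvg_cst].
    have -> // : (fun y => \prod_(l <- k :: r | l != i) (mu y i - mu x l)) =
        (fun y => \prod_(l <- r | l != i) (mu y i - mu x l)).
    by apply/funext => y; rewrite big_cons (negbTE ki).
  exact: H.
have E y : U y -> mu x i +
    \sum_(j < n.+1) ((p x)`_j - (p y)`_j) * (mu y i ^+ j / S x i y) = mu y i.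
  by move=> Uy; rewrite -root_increment // addrC subrK.
apply: (near_eq_diff (near_open Uo Ux E)).
apply: (@differentiableD _ _ _ (cst (mu x i))); first exact: differentiable_cst.
apply: differentiable_bigsum => j _.
apply: differentiable_mul_vanishing.
- apply: (@differentiableB _ _ _ (cst (p x)`_j)); first exact: differentiable_cst.
  exact: dp.
- exact: subrr.
- have cX : {for x, continuous (fun y => mu y i ^+ j)}.
    elim: (j : nat) => [|k IH]; first exact: cst_continuous.
    have -> : (fun y => mu y i ^+ k.+1) = (fun y => mu y i * mu y i ^+ k).
      by apply/funext => y; rewrite exprS.
    exact: (cvgM (cmu i) IH).
  exact: (cvgM cX (cvgV (S_neq0 i Ux Ux) cS)).
Qed.

End HolomorphicEigenvalues.

Section SimpleSpectrum.
Context {K : numFieldType} {V : normedModType K} {n : nat}.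
Hypothesis K_split : forall p : {poly K}, p \is monic ->
  exists rs, p = \prod_(z <- rs) ('X - z%:P).

Lemma holomorphic_eigenvalues (U : set V) (A : V -> 'M[K]_n) xo (lam : 'I_n -> K) :
  open U -> U xo -> holomorphic_on U A -> injective lam ->
  char_poly (A xo) = \prod_i ('X - (lam i)%:P) ->
  exists (W : set V) (mu : V -> 'I_n -> K),
    [/\ open W /\ W xo, W `<=` U, (forall i, holomorphic_on W (fun x => mu x i)),
        mu xo = lam &
        forall x, W x -> char_poly (A x) = \prod_i ('X - (mu x i)%:P) /\
          forall i j, i != j -> mu x i != mu x j].
Proof.
move=> Uo Uxo AU lamI Alam.
have [d d0 sep] := injective_separation lamI.
have dc x k : U x -> differentiable (fun y => (char_poly (A y))`_k) x.
  by move=> Ux; apply: differentiable_char_poly_coef; exact: AU.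
have dev (t : K) x : U x -> differentiable (fun y => (char_poly (A y)).[t]) x.
  move=> Ux.
  have -> : (fun y => (char_poly (A y)).[t]) =
      (fun y => \sum_(k < n.+1) (char_poly (A y))`_k * t ^+ k).
    by apply/funext => y; rewrite horner_coef size_char_poly.
  apply: differentiable_bigsum => k _.
  by apply: differentiableM; [exact: dc|exact: differentiable_cst].
have dn : 0 < d ^+ n by exact: exprn_gt0.
have H i : \forall y \near xo, `|(char_poly (A y)).[lam i]| < d ^+ n.
  have /cvgrPdist_lt/(_ _ dn) : {for xo, continuous (fun y => (char_poly (A y)).[lam i])}.
    by apply: differentiable_continuous; exact: dev.
  apply: filterS => y; rewrite Alam horner_prod (bigD1 i) //= hornerXsubC subrr mul0r.
  by rewrite sub0r normrN.
have near_xo : \forall y \near xo, U y /\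
    forall i, `|(char_poly (A y)).[lam i]| < d ^+ n.
  apply: filterI; first exact: (near_open Uo Uxo).
  exact: (@filter_forall _ 'I_n (fun i y => `|(char_poly (A y)).[lam i]| < d ^+ n) _ _ H).
have [W [Wo Wxo WP]] := open_of_near near_xo.
(* The roots are chosen point by point; proximity to lam labels them consistently, and regularity
   follows from the separation. *)
have /choice[mu muP] : forall x, exists mu : 'I_n -> K, W x ->
    (forall i, `|lam i - mu i| < d) /\ char_poly (A x) = \prod_i ('X - (mu i)%:P).
  move=> x; have [Wx|nWx] := pselect (W x); last by exists lam.
  have [mu muP] := monic_roots_near K_split (char_poly_monic (A x))
    (size_char_poly (A x)) d0 sep (WP x Wx).2.
  by exists mu.
have mu_near x i : W x -> `|lam i - mu x i| < d by move=> /muP[H1 _].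
exists W, mu; split => //.
- by move=> x /WP[].
- move=> i; apply: (holomorphic_root (p := fun x => char_poly (A x)) Wo d0 sep mu_near).
    by move=> x /muP[].
  by move=> x k /WP[Ux _]; exact: dc.
- apply/funext => i.
  have : root (char_poly (A xo)) (mu xo i).
    rewrite (muP xo Wxo).2 rootE horner_prod (bigD1 i) //=.
    by rewrite hornerXsubC subrr mul0r.
  have -> : char_poly (A xo) = \prod_(z <- [seq lam j | j <- enum 'I_n]) ('X - z%:P).
    by rewrite Alam big_map big_enum.
  rewrite root_prod_XsubC => /mapP[j _ mE].
  rewrite mE; have [-> //|ij] := eqVneq i j.
  have := sep i j ij; rewrite -mE => /le_lt_trans/(_ (mu_near xo i Wxo)).
  rewrite -subr_gt0; have -> : d - 3 * d = - (2 * d) by ring.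
  by rewrite oppr_gt0 pmulr_rlt0 // => /(lt_trans d0); rewrite ltxx.
- move=> x Wx; split=> [|i j ij]; first exact: (muP x Wx).2.
  rewrite -subr_eq0 -normr_gt0; apply: lt_le_trans d0 _.
  exact: (near_roots_separated sep mu_near).
Qed.

End SimpleSpectrum.

Section SimpleSpectrumFrame.
Context {K : numFieldType} {V : normedModType K} {n : nat}.
Hypothesis K_split : forall p : {poly K}, p \is monic ->
  exists rs, p = \prod_(z <- rs) ('X - z%:P).

Lemma differentiable_mxprod (I : Type) (r : seq I) (P : pred I)
    (M : I -> V -> 'M[K]_n.+1) x :
  (forall i, differentiable (M i) x) ->
  differentiable (fun y => \prod_(i <- r | P i) M i y : 'M[K]_n.+1) x.
Proof.
move=> dM; elim: r => [|i r IH].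
  have -> : (fun y => \prod_(i <- [::] | P i) M i y) = cst 1.
    by apply/funext => y; rewrite big_nil.
  exact: differentiable_cst.
have [Pi|nPi] := boolP (P i).
  have -> : (fun y => \prod_(j <- i :: r | P j) M j y) =
      (fun y => M i y *m \prod_(j <- r | P j) M j y).
    by apply/funext => y; rewrite big_cons Pi.
  exact: differentiable_mulmx.
have -> // : (fun y => \prod_(j <- i :: r | P j) M j y) =
    (fun y => \prod_(j <- r | P j) M j y).
by apply/funext => y; rewrite big_cons (negbTE nPi).
Qed.

(** Column i of G is column i of G0 multiplied by the product of the A - mu_j over j != i, which
    maps into the i-th eigenspace by Cayley-Hamilton. At xo this multiplies the columns of G0 by
    nonzero scalars, so G is invertible nearby. *)
Lemma simple_spectrum_diagonalization (U : set V) (A : V -> 'M[K]_n.+1) xo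
    (lam : 'I_n.+1 -> K) (G0 : 'M[K]_n.+1) :
  open U -> U xo -> holomorphic_on U A -> injective lam -> G0 \in unitmx ->
  A xo *m G0 = G0 *m diag_mx (\row_i lam i) ->
  char_poly (A xo) = \prod_i ('X - (lam i)%:P) ->
  exists (W : set V) (f : 'I_n.+1 -> V -> K) (G : V -> 'M[K]_n.+1),
    [/\ open W /\ W xo, W `<=` U, (forall i, holomorphic_on W (f i)), hol_GL W G &
        forall x, W x ->
          invmx (G x) *m A x *m G x = diag_mx (\row_i f i x) /\
          forall i j, i != j -> f i x != f j x].
Proof.
move=> Uo Uxo AU lamI G0u AG0 Alam.
have [W [mu [[Wo Wxo] WU muW muxo muP]]] :=
  holomorphic_eigenvalues K_split Uo Uxo AU lamI Alam.
pose Q i x : 'M[K]_n.+1 := \prod_(j | j != i) (A x - (mu x j)%:M).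
pose G x : 'M[K]_n.+1 := \matrix_(a, i) (Q i x *m G0) a i.
have GE x a i : G x a i = (Q i x *m G0) a i by rewrite mxE.
have AQ x i : W x -> A x *m Q i x = mu x i *: Q i x.
  move=> Wx; have [cA _] := muP x Wx.
  have := Cayley_Hamilton (A x); rewrite cA (bigD1 i) //= rmorphM rmorph_prod /=.
  rewrite rmorphB /= horner_mx_X horner_mx_C.
  have -> : \prod_(j | j != i) horner_mx (A x) ('X - (mu x j)%:P) = Q i x.
    by apply: eq_bigr => j _; rewrite rmorphB /= horner_mx_X horner_mx_C.
  rewrite mulrBl => /eqP; rewrite subr_eq0 => /eqP E.
  by rewrite -mul_scalar_mx.
have AG x : W x -> A x *m G x = G x *m diag_mx (\row_i mu x i).
  move=> Wx; apply/matrixP => a i.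
  rewrite [RHS]mulmx_diag_r ?diag_mx_diag // diag_mx_entry GE.
  have -> : (A x *m G x) a i = (A x *m (Q i x *m G0)) a i.
    by rewrite mxE [RHS]mxE; apply: eq_bigr => b _; rewrite GE.
  by rewrite mulmxA AQ // -scalemxAl mxE mulrC.
have GW : holomorphic_on W G.
  move=> x Wx; apply/diff_mxP => a i.
  have -> : (fun y => G y a i) = (fun y => (Q i y *m G0) a i).
    by apply/funext => y; rewrite GE.
  suff : differentiable (fun y => Q i y *m G0) x by move/diff_mxP.
  apply: differentiable_mulmx; last exact: differentiable_cst.
  apply: differentiable_mxprod => j; apply: differentiableB; first exact: (AU x (WU x Wx)).
  apply/diff_mxP => b c.
  have -> : (fun y => (mu y j)%:M b c) = (fun y => mu y j * (b == c)%:R).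
    by apply/funext => y; rewrite mxE mulr_natr.
  by apply: differentiableM; [exact: muW|exact: differentiable_cst].
have Gxo : G xo \in unitmx.
  have E : G xo = G0 *m diag_mx (\row_i \prod_(j | j != i) (lam i - lam j)).
    apply/matrixP => a i; rewrite [RHS]mulmx_diag_r ?diag_mx_diag // diag_mx_entry GE.
    rewrite /Q muxo.
    suff H (r : seq 'I_n.+1) b : ((\prod_(j <- r | j != i) (A xo - (lam j)%:M)) *m G0) b i
        = G0 b i * \prod_(j <- r | j != i) (lam i - lam j) by exact: H.
    elim: r b => [|j r IH] b; first by rewrite !big_nil mul1mx mulr1.
    rewrite !big_cons; case: ifP => ji; last exact: IH.
    set M := \prod_(l <- r | _) (A xo - _) in IH *.
    set c := \prod_(l <- r | _) _ in IH *.
    have -> : ((A xo - (lam j)%:M) * M *m G0) b i = ((A xo - (lam j)%:M) *m (M *m G0)) b i.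
      by rewrite mulmxA.
    rewrite mxE; under eq_bigr => l _ do rewrite IH mulrA.
    rewrite -mulr_suml mulrA; congr (_ * _).
    have -> : \sum_l (A xo - (lam j)%:M) b l * G0 l i = ((A xo - (lam j)%:M) *m G0) b i.
      by rewrite mxE.
    rewrite mulmxBl AG0 mul_scalar_mx mxE mulmx_diag_r ?diag_mx_diag // diag_mx_entry.
    by rewrite !mxE mulrBr [G0 b i * lam j]mulrC.
  rewrite E unitmx_mul G0u unitmxE det_diag unitfE; apply/prodf_neq0 => i _.
  rewrite mxE; apply/prodf_neq0 => j ji; rewrite subr_eq0.
  by apply: contra ji => /eqP/lamI ->.
have /open_of_near[W' [W'o W'xo W'P]] : \forall x \near xo, W x /\ \det (G x) != 0.
  apply: filterI; first exact: (near_open Wo Wxo).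
  apply: continuous_near_neq0; last by rewrite -unitfE -unitmxE.
  by apply: differentiable_continuous; apply: differentiable_det; exact: GW.
exists W', (fun i x => mu x i), G; split => //.
- by move=> x /W'P[/WU].
- by move=> i x /W'P[/muW].
- by split=> x /W'P[Wx ?]; [exact: GW|rewrite unitmxE unitfE].
- move=> x /W'P[Wx Gx]; split; last exact: (muP x Wx).2.
  by rewrite -mulmxA AG // mulmxA mulVmx ?mul1mx // unitmxE unitfE.
Qed.

End SimpleSpectrumFrame.

(** * Formal solutions *)

Section FormalSeries.
Context {K : numFieldType} {n : nat}.
Implicit Types (a b c phi psi : nat -> 'M[K]_n.+1).

Let trunc N a : {poly 'M[K]_n.+1} := \poly_(i < N) a i.

Let truncM N a b k : (k < N)%N -> (trunc N a * trunc N b)`_k = fmul a b k.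
Proof.
move=> kN; rewrite coefM; apply: eq_bigr => i _; rewrite !coef_poly.
have iN : (i < N)%N by apply: leq_ltn_trans kN; rewrite -ltnS.
by rewrite iN (leq_ltn_trans (leq_subr _ _) kN).
Qed.

(** Associativity of polynomials: a coefficient of a product depends only on truncations of the
    factors. *)
Lemma fmulA a b c : fmul a (fmul b c) =1 fmul (fmul a b) c.
Proof.
move=> k; have := congr1 (fun p : {poly 'M[K]_n.+1} => p`_k)
  (mulrA (trunc k.+1 a) (trunc k.+1 b) (trunc k.+1 c)).
rewrite [LHS]coefM [RHS]coefM => E.
apply: (etrans _ (etrans E _)); apply: eq_bigr => i _.
  by rewrite truncM ?ltnS ?leq_subr // coef_poly ltn_ord.
by rewrite truncM // coef_poly ltnS leq_subr.
Qed.

Lemma fmul1 a : fmul (@fone K n.+1) a =1 a.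
Proof.
move=> k; rewrite /fmul big_ord_recl subn0 /fone /= mul1mx big1 ?addr0 // => i _.
exact: mul0mx.
Qed.

Lemma fmulr1 a : fmul a (@fone K n.+1) =1 a.
Proof.
move=> k; rewrite /fmul big_ord_recr /= subnn /fone /= mulmx1 big1 ?add0r // => i _.
by rewrite subn_eq0 leqNgt ltn_ord /= mulmx0.
Qed.

Lemma eq_fmul a a' b b' : a =1 a' -> b =1 b' -> fmul a b =1 fmul a' b'.
Proof. by move=> aa bb k; apply: eq_bigr => i _; rewrite aa bb. Qed.

Lemma fmulDr a b c k : fmul a (fun j => b j + c j) k = fmul a b k + fmul a c k.
Proof. by rewrite -big_split; apply: eq_bigr => i _; rewrite mulmxDr. Qed.

(** Each coefficient involves all earlier ones, hence the recursion on lists. *)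
Fixpoint inverse_coefs phi k : seq 'M[K]_n.+1 :=
  if k is j.+1 then
    let s := inverse_coefs phi j in
    rcons s ((fone K n.+1 j - \sum_(i < j) nth 0 s i *m phi (j - i)%N) *m invmx (phi 0%N))
  else [::].

Lemma size_inverse_coefs phi k : size (inverse_coefs phi k) = k.
Proof. by elim: k => //= k IH; rewrite size_rcons IH. Qed.

Lemma left_inverse_exists phi : phi 0%N \in unitmx ->
  exists psi, fmul psi phi =1 fone K n.+1 /\ psi 0%N = invmx (phi 0%N).
Proof.
move=> u0; pose psi k := nth 0 (inverse_coefs phi k.+1) k.
have nthE k i : (i < k)%N -> nth 0 (inverse_coefs phi k) i = psi i.
  elim: k => // k IH; rewrite ltnS leq_eqVlt => /orP[/eqP-> //|ik].
  by rewrite /= nth_rcons size_inverse_coefs ik IH.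
have psiE k : psi k = (fone K n.+1 k - \sum_(i < k) psi i *m phi (k - i)%N) *m invmx (phi 0%N).
  rewrite {1}/psi /= nth_rcons size_inverse_coefs ltnn eqxx.
  by under eq_bigr => i _ do rewrite nthE //.
exists psi; split=> [k|]; last by rewrite psiE big_ord0 subr0 /fone /= mul1mx.
by rewrite /fmul big_ord_recr /= subnn psiE -mulmxA mulVmx // mulmx1 addrC subrK.
Qed.

(** The left inverse psi has itself a left inverse, which must be phi. *)
Lemma inverse_exists phi : phi 0%N \in unitmx ->
  exists psi, fmul psi phi =1 fone K n.+1 /\ fmul phi psi =1 fone K n.+1.
Proof.
move=> u0; have [psi [psiphi psi0]] := left_inverse_exists u0.
exists psi; split=> // k.
have [|chi [chipsi _]] := @left_inverse_exists psi; first by rewrite psi0 unitmx_inv.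
have phiE : phi =1 chi.
  move=> j; rewrite -fmul1 -(eq_fmul chipsi (fun=> erefl)) -fmulA.
  by rewrite (eq_fmul (fun=> erefl) psiphi) fmulr1.
by rewrite (eq_fmul phiE (fun=> erefl)).
Qed.

Lemma fmul_fdz_coef (A B : 'M[K]_n.+1) phi k :
  fmul (fdz_coef A B) phi k =
  match k with 0 => 0 | 1 => - (A *m phi 0%N)
             | j.+2 => - (A *m phi j.+1) - B *m phi j end.
Proof.
case: k => [|[|k]]; first by rewrite fmul_coef0 mul0mx.
  by rewrite fmul_coef1 mul0mx add0r mulNmx.
rewrite /fmul !big_ord_recl /= mul0mx add0r big1 ?addr0 => [|i _]; last exact: mul0mx.
by rewrite !mulNmx /bump /= !subSS !subn0.
Qed.

Lemma fmul_fdz_coefr (A B : 'M[K]_n.+1) phi k :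
  fmul phi (fdz_coef A B) k =
  match k with 0 => 0 | 1 => - (phi 0%N *m A)
             | j.+2 => - (phi j.+1 *m A) - phi j *m B end.
Proof.
case: k => [|[|k]]; first by rewrite fmul_coef0 mulmx0.
  by rewrite fmul_coef1 mulmx0 addr0 mulmxN.
have e1 : (k.+2 - k.+1 = 1)%N by lia.
have e2 : (k.+2 - k = 2)%N by lia.
rewrite /fmul !big_ord_recr /= subnn e1 e2 mulmx0 addr0 big1 ?add0r => [|i _].
  by rewrite !mulmxN addrC.
have -> : (k.+2 - i = (k - i.+1).+3)%N by have := ltn_ord i; lia.
by rewrite /= mulmx0.
Qed.

Lemma fmul_fdx_coef (C : 'M[K]_n.+1) phi k : fmul (fdx_coef C) phi k = - (C *m phi k).
Proof.
rewrite /fmul big_ord_recl /= subn0 mulNmx big1 ?addr0 // => i _.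
exact: mul0mx.
Qed.

Lemma fmul_fdx_coefr (C : 'M[K]_n.+1) phi k : fmul phi (fdx_coef C) k = - (phi k *m C).
Proof.
rewrite /fmul big_ord_recr /= subnn mulmxN big1 ?add0r // => i _.
by rewrite -(subnSK (ltn_ord i)) /= mulmx0.
Qed.

End FormalSeries.

(** * The recursion for the formal gauge transformation *)

Section FormalFrame.
Context {K : numFieldType} {n : nat}.
Implicit Types (D B F : 'M[K]_n).

Definition diagpart B : 'M[K]_n := diag_mx (\row_i B i i).

(* [F_k] solves [[D, F_(k+1)] + (B + k) F_k - F_k B' = 0]: the off-diagonal entries of *)
(* [F_(k+1)] come from the k-th equation and the diagonal ones from the next equation.   *)
Fixpoint formal_frame D B k : 'M[K]_n :=
  if k is j.+1 then
    let N := (B + j%:R%:M) *m formal_frame D B j - formal_frame D B j *m diagpart B in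
    let O := \matrix_(i, l) (if i == l then 0 else N i l / (D l l - D i i)) in
    O - (j.+1%:R)^-1 *: diagpart (B *m O)
  else 1%:M.

Lemma diagpart_diag B : is_diag_mx (diagpart B).
Proof. exact: diag_mx_diag. Qed.

Lemma diagpart_entry B i : diagpart B i i = B i i.
Proof. exact: diag_mx_entry. Qed.

Lemma formal_frameP D B k : is_diag_mx D -> (forall i j, i != j -> D i i != D j j) ->
  (B + k%:R%:M) *m formal_frame D B k + D *m formal_frame D B k.+1 =
  formal_frame D B k *m diagpart B + formal_frame D B k.+1 *m D.
Proof.
move=> Dd Dsep; set F := formal_frame D B.
pose N j := (B + j%:R%:M) *m F j - F j *m diagpart B.
pose E j : 'M[K]_n := \matrix_(i, l) (if i == l then 0 else N j i l / (D l l - D i i)).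
have EE j i l : E j i l = if i == l then 0 else N j i l / (D l l - D i i) by rewrite mxE.
have subE (M M' : 'M[K]_n) i j : (M - M') i j = M i j - M' i j by rewrite addmxE [X in _ + X]mxE.
have scaleE c (M : 'M[K]_n) i j : (c *: M) i j = c * M i j by rewrite mxE.
have FS j : F j.+1 = E j - (j.+1%:R)^-1 *: diagpart (B *m E j) by [].
have Fd j i : F j.+1 i i = - ((j.+1%:R)^-1 * (B *m E j) i i).
  by rewrite FS subE EE eqxx sub0r scaleE diagpart_entry.
have Fo j i l : i != l -> F j.+1 i l = N j i l / (D l l - D i i).
  move=> il; rewrite FS subE EE (negbTE il) scaleE.
  by rewrite (is_diag_mxP (diagpart_diag _)) // mulr0 subr0.
(* For k = 0 this is B_ii - B_ii. For k > 0, the B_ii terms cancel and leave (B E)_ii + k (F_k)_ii,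
   which the diagonal of F_k was chosen to kill. *)
have Nd i : N k i i = 0.
  rewrite /N subE (mulmx_diag_r _ _ _ (diagpart_diag _)) diagpart_entry.
  rewrite mulmxDl addmxE mul_scalar_mx scaleE.
  case: k => [|j]; first by rewrite /F /= mulmx1 mxE eqxx mul0r addr0 mul1r subrr.
  have -> : (B *m F j.+1) i i = (B *m E j) i i + B i i * F j.+1 i i.
    rewrite Fd FS mulmxBr subE -scalemxAr scaleE.
    by rewrite (mulmx_diag_r _ _ _ (diagpart_diag _)) diagpart_entry; ring.
  rewrite Fd; have j0 : (j.+1%:R : K) != 0 by rewrite pnatr_eq0.
  by field.
apply/matrixP => i j; rewrite !addmxE [(D *m _) i j]mulmx_diag_l //.
rewrite [(F k.+1 *m D) i j]mulmx_diag_r //.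
have NE : ((B + k%:R%:M) *m F k) i j = N k i j + (F k *m diagpart B) i j.
  by rewrite -addmxE subrK.
rewrite NE; have [ij|ij] := eqVneq i j.
  by rewrite -ij Nd add0r [D i i * _]mulrC.
have Dij : D j j - D i i != 0 by rewrite subr_eq0 eq_sym Dsep.
by rewrite (Fo _ _ _ ij); field.
Qed.

(* Compatibility of the dz- and dx-equations: [X0], [X1] are consecutive coefficients of the *)
(* dx-equation, and they solve the equation defining the coefficients of the dz-equation.    *)
Lemma dx_equation_recursion D B d b w F0 F1 F2 dB dF0 dF1 :
  lie D d = 0 -> lie b d = 0 -> lie w D = lie d B -> dB = lie B w ->
  B *m F0 + D *m F1 = F0 *m b + F1 *m D ->
  B *m F1 + F1 + D *m F2 = F1 *m b + F2 *m D ->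
  dB *m F0 + B *m dF0 + (d *m F1 + D *m dF1) = dF0 *m b + (dF1 *m D + F1 *m d) ->
  let X0 := lie F1 d + w *m F0 + dF0 in
  let X1 := lie F2 d + w *m F1 + dF1 in
  B *m X0 + D *m X1 = X0 *m b + X1 *m D.
Proof.
move=> H1 H2 H3 H4 Z0 Z1 dZ X0 X1; apply/eqP; rewrite -subr_eq0; apply/eqP.
move/eqP: H3; rewrite -subr_eq0 => /eqP H3.
move/eqP: H4; rewrite -subr_eq0 => /eqP H4.
move/eqP: Z0; rewrite -subr_eq0 => /eqP Z0.
move/eqP: Z1; rewrite -subr_eq0 => /eqP Z1.
move/eqP: dZ; rewrite -subr_eq0 => /eqP dZ.
(* A noncommutative certificate: the goal as an explicit combination of the hypotheses, checked
   entrywise by [ring] with the expanded products as atoms. *)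
transitivity (lie (B *m F1 + F1 + D *m F2 - (F1 *m b + F2 *m D)) d + lie F2 (lie D d)
   + w *m (B *m F0 + D *m F1 - (F0 *m b + F1 *m D)) - (lie w D - lie d B) *m F1
   + (dB *m F0 + B *m dF0 + (d *m F1 + D *m dF1) - (dF0 *m b + (dF1 *m D + F1 *m d)))
   - (dB - lie B w) *m F0 + F1 *m lie b d); last first.
  by rewrite Z1 H1 Z0 H3 dZ H4 H2 /lie !(mul0mx, mulmx0, subr0, addr0).
rewrite /X0 /X1 /lie !(mulmxDr, mulmxDl, mulmxN, mulNmx, mulmxA).
apply/matrixP => i j.
have oppE (M : 'M[K]_n) : (- M) i j = - M i j by rewrite mxE.
by rewrite !(addmxE, oppE); ring.
Qed.

End FormalFrame.

Lemma differentiable_formal_frame (K : numFieldType) (V : normedModType K) (n k : nat)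
    (D B : V -> 'M[K]_n) x :
  differentiable D x -> differentiable B x -> (forall i j, i != j -> D x i i != D x j j) ->
  differentiable (fun y => formal_frame (D y) (B y) k) x.
Proof.
move=> dD dB Dsep; elim: k => [|k IH]; first exact: differentiable_cst.
have diagd (M : V -> 'M[K]_n) : differentiable M x -> differentiable (fun y => diagpart (M y)) x.
  move=> dM; apply/diff_mxP => i j.
  have -> : (fun y => diagpart (M y) i j) = (fun y => M y i i * (i == j)%:R).
    by apply/funext => y; rewrite !mxE mulr_natr.
  by apply: differentiableM; [exact: ((diff_mxP _ _).1 dM)|exact: differentiable_cst].
pose N y := (B y + k%:R%:M) *m formal_frame (D y) (B y) k
  - formal_frame (D y) (B y) k *m diagpart (B y).
have dN : differentiable N x.
  apply: differentiableB; apply: differentiable_mulmx => //; last exact: diagd.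
  by apply: differentiableD => //; exact: differentiable_cst.
pose E y : 'M[K]_n := \matrix_(i, l) (if i == l then 0 else N y i l / (D y l l - D y i i)).
have dE : differentiable E x.
  apply/diff_mxP => i l; have [il|il] := eqVneq i l.
    have -> : (fun y => E y i l) = cst 0 by apply/funext => y; rewrite mxE il eqxx.
    exact: differentiable_cst.
  have -> : (fun y => E y i l) = (fun y => N y i l * (D y l l - D y i i)^-1).
    by apply/funext => y; rewrite mxE (negbTE il).
  have dD' := (diff_mxP _ _).1 dD.
  apply: differentiableM; first exact: ((diff_mxP _ _).1 dN).
  apply: differentiableV; first by apply: differentiableB; exact: dD'.
  by rewrite subr_eq0 eq_sym Dsep.
have -> : (fun y => formal_frame (D y) (B y) k.+1) =
    (fun y => E y - (k.+1%:R)^-1 *: diagpart (B y *m E y)) by [].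
apply: differentiableB => //; apply: differentiableZ; apply: diagd.
exact: differentiable_mulmx.
Qed.

(** * Diagonal entries in a frame with distinct eigenvalues *)

Section SeparatedGauge.
Context {K : numFieldType} {m n : nat}.
Hypothesis K_smooth : smooth_field K.
Variables (Bo : 'M[K]_n) (T : deformation K m n) (W : set 'rV[K]_m).
Variables (f : 'I_n -> 'rV[K]_m -> K) (G : 'rV[K]_m -> 'M[K]_n).
Hypotheses (Wo : open W) (AW : holomorphic_on W (pole T)).
Hypothesis CW : forall k, holomorphic_on W (defo T k).
Hypothesis AC : forall x k, W x -> lie (pole T x) (defo T k x) = 0.
Hypothesis dA : forall x k, W x ->
  pd k (pole T) x = defo T k x + lie (defo T k x) Bo.
Hypotheses (GW : hol_GL W G) (fW : forall i, holomorphic_on W (f i)).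

Let Dl x : 'M[K]_n := diag_mx (\row_i f i x).
Hypothesis GA : forall x, W x -> invmx (G x) *m pole T x *m G x = Dl x.
Hypothesis f_sep : forall x i j, W x -> i != j -> f i x != f j x.

Let Bt x : 'M[K]_n := invmx (G x) *m Bo *m G x.
Let vp k x : 'M[K]_n := invmx (G x) *m pd k G x.

Let Gu x : W x -> G x \in unitmx. Proof. exact: GW.2. Qed.
Let Gh : holomorphic_on W G. Proof. exact: GW.1. Qed.

Lemma separated_cancel (q : 'rV[K]_m -> K) i j : i != j -> holomorphic_on W q ->
  (forall x, W x -> q x * (f i x - f j x) = 0) -> forall x, W x -> q x = 0.
Proof.
move=> ij _ qf x Wx; have /eqP := qf x Wx; rewrite mulf_eq0 subr_eq0.
by rewrite (negbTE (f_sep Wx ij)) orbF => /eqP.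
Qed.

Lemma mul_gauge_vp k x : W x -> G x *m vp k x = pd k G x.
Proof. by move=> Wx; rewrite mulmxA mulmxV ?mul1mx //; exact: Gu. Qed.

Lemma mul_gauge_Bt x : W x -> G x *m Bt x = Bo *m G x.
Proof. by move=> Wx; rewrite !mulmxA mulmxV ?mul1mx //; exact: Gu. Qed.

Lemma mul_gauge_diag x : W x -> pole T x *m G x = G x *m Dl x.
Proof. by move=> Wx; rewrite -(GA Wx) !mulmxA mulmxV ?mul1mx //; exact: Gu. Qed.

Lemma mul_gauge_defo k x : W x -> defo T k x *m G x = G x *m pd k Dl x.
Proof.
move=> Wx; rewrite -(gauge_defoE Wo AW CW AC dA GW fW GA separated_cancel k Wx).
by rewrite !mulmxA mulmxV ?mul1mx //; exact: Gu.
Qed.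

Let Bt_hol : holomorphic_on W Bt.
Proof. exact: (gauge_Bt_holomorphic Bo GW). Qed.

Let vp_hol k : holomorphic_on W (vp k).
Proof. exact: (gauge_vp_holomorphic K_smooth Wo GW). Qed.

Let gauge_inj x (M N : 'M[K]_n) : W x -> G x *m M = G x *m N -> M = N.
Proof.
by move=> Wx E; rewrite -[M]mul1mx -[N]mul1mx -(mulVmx (Gu Wx)) -!mulmxA E.
Qed.

(** Differentiate G Bt = Bo G, in which Bo is constant. *)
Lemma gauge_pd_Bt k x : W x -> pd k Bt x = lie (Bt x) (vp k x).
Proof.
move=> Wx; apply: (gauge_inj Wx).
have E : pd k G x *m Bt x + G x *m pd k Bt x = Bo *m pd k G x.
  have E1 := derive_mulmx (delta_mx 0 k) (Gh Wx) (Bt_hol Wx).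
  have E2 := derive_mulmx (delta_mx 0 k) (differentiable_cst Bo x) (Gh Wx).
  apply: (etrans (esym E1)).
  have E3 : 'D_(delta_mx 0 k) (fun y => G y *m Bt y) x =
      'D_(delta_mx 0 k) (fun y => cst Bo y *m G y) x.
    by apply: near_eq_derive; exact: near_open Wo Wx mul_gauge_Bt.
  by apply: (etrans E3); apply: (etrans E2); rewrite derive_cst mul0mx add0r.
have -> : G x *m pd k Bt x = Bo *m pd k G x - pd k G x *m Bt x by rewrite -E [X in X - _]addrC addrK.
rewrite /lie mulmxBr (mulmxA (G x) (Bt x)) mul_gauge_Bt // (mulmxA (G x) (vp k x)).
by rewrite mul_gauge_vp // -(mulmxA Bo) mul_gauge_vp.
Qed.

(** The Maurer-Cartan equation: both sides multiplied by G are mixed second derivatives of G. *)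
Lemma gauge_vp_flat k l x : W x ->
  vp k x *m vp l x + pd k (vp l) x = vp l x *m vp k x + pd l (vp k) x.
Proof.
move=> Wx; apply: (gauge_inj Wx).
have E a b : G x *m (vp a x *m vp b x + pd a (vp b) x) = pd a (fun y => pd b G y) x.
  have E1 := derive_mulmx (delta_mx 0 a) (Gh Wx) (vp_hol b Wx).
  have E2 : 'D_(delta_mx 0 a) (fun y => G y *m vp b y) x =
      'D_(delta_mx 0 a) (fun y => pd b G y) x.
    by apply: near_eq_derive; exact: near_open Wo Wx (mul_gauge_vp b).
  apply: (etrans _ E2); apply: (etrans _ (esym E1)).
  by rewrite mulmxDr (mulmxA (G x)) mul_gauge_vp.
exact: etrans (E k l) (etrans ((K_smooth Wo Gh).2 k l x Wx) (esym (E l k))).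
Qed.

Let offdiagL k x i j : W x -> i != j ->
  vp k x i j * (f j x - f i x) = (pd k (f i) x - pd k (f j) x) * Bt x i j.
Proof. exact: (gauge_offdiag Wo AW CW AC dA GW fW GA separated_cancel). Qed.

Let offdiagR k x i j : W x -> i != j ->
  vp k x j i * (f j x - f i x) = (pd k (f i) x - pd k (f j) x) * Bt x j i.
Proof.
move=> Wx ij; have := @offdiagL k x j i Wx; rewrite eq_sym => /(_ ij) H.
by rewrite -opprB mulrN H -mulNr opprB.
Qed.

Let f_sub_neq0 x i j : W x -> i != j -> f j x - f i x != 0.
Proof. by move=> Wx ij; rewrite subr_eq0 eq_sym f_sep. Qed.

Let lie_entry (M N : 'M[K]_n) i : (lie M N) i i = \sum_j (M i j * N j i - N i j * M j i).
Proof.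
rewrite /lie addmxE [(M *m N) i i]mxE sumrB; congr (_ + _).
by rewrite mxE [(N *m M) i i]mxE.
Qed.

Let comm0 (a b : K) : a * b - b * a = 0.
Proof. by ring. Qed.

(** In the diagonal of [Bt, vp], multiplying the j-th term by f_j - f_i turns both of its products
    into (d f_i - d f_j) B_ij B_ji, so they cancel. *)
Lemma pd_gauge_Bt_diag k x i : W x -> pd k (fun y => Bt y i i) x = 0.
Proof.
move=> Wx; rewrite -[LHS](derive_mx_entry _ i i (Bt_hol Wx)).
apply: (etrans (congr1 (fun M : 'M[K]_n => M i i) (gauge_pd_Bt k Wx))).
rewrite lie_entry big1 // => j _.
have [<-|ij] := eqVneq i j; first exact: comm0.
apply: (mulIf (f_sub_neq0 Wx ij)); rewrite mul0r mulrBl -mulrA offdiagR //.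
rewrite [X in _ - X]mulrAC offdiagL //.
have alg (a b c : K) : b * (a * c) - a * b * c = 0 by ring.
exact: alg.
Qed.

(** By flatness it suffices that the products in either order have the same diagonal. After
    multiplication by (f_j - f_i)^2, the j-th term becomes an expression symmetric in k and l. *)
Lemma pd_gauge_vp_diag k l x i : W x ->
  pd k (fun y => vp l y i i) x = pd l (fun y => vp k y i i) x.
Proof.
move=> Wx; rewrite -[LHS](derive_mx_entry _ i i (vp_hol l Wx)).
rewrite -[RHS](derive_mx_entry _ i i (vp_hol k Wx)).
have E : (vp k x *m vp l x) i i = (vp l x *m vp k x) i i.
  apply/eqP; rewrite -subr_eq0; apply/eqP.
  have -> : (vp k x *m vp l x) i i - (vp l x *m vp k x) i i = lie (vp k x) (vp l x) i i.
    by rewrite /lie addmxE [X in _ = _ + X]mxE.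
  rewrite lie_entry big1 // => j _.
  have [<-|ij] := eqVneq i j; first exact: comm0.
  apply: (mulIf (f_sub_neq0 Wx ij)); apply: (mulIf (f_sub_neq0 Wx ij)); rewrite !mul0r.
  have e a b : vp a x i j * vp b x j i * (f j x - f i x) * (f j x - f i x) =
      ((pd a (f i) x - pd a (f j) x) * Bt x i j) * ((pd b (f i) x - pd b (f j) x) * Bt x j i).
    have comm4 (u v c : K) : u * v * c * c = (u * c) * (v * c) by ring.
    by apply: (etrans (comm4 _ _ _)); apply: congr2; [exact: offdiagL|exact: offdiagR].
  have alg (a b c d : K) : a * c * (b * d) - b * c * (a * d) = 0 by ring.
  rewrite !mulrBl; apply: (etrans (congr2 (fun u v => u - v) (e k l) (e l k))).
  exact: alg.
have H := congr1 (fun M : 'M[K]_n => M i i) (gauge_vp_flat k l Wx).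
have {}H := etrans (esym (addmxE _ _ i i)) (etrans H (addmxE _ _ i i)).
apply: (addrI ((vp k x *m vp l x) i i)); apply: (etrans H).
exact: (congr1 (fun u => u + _) (esym E)).
Qed.

End SeparatedGauge.

(** * The dx-equation and the formal solution *)

Section NormalGauge.
Context {K : numFieldType} {m n : nat}.
Variables (Bo : 'M[K]_n.+1) (T : deformation K m n.+1) (W : set 'rV[K]_m).
Variables (f : 'I_n.+1 -> 'rV[K]_m -> K) (G : 'rV[K]_m -> 'M[K]_n.+1).
Hypotheses (Wo : open W) (AW : holomorphic_on W (pole T)).
Hypothesis CW : forall k, holomorphic_on W (defo T k).
Hypothesis AC : forall x k, W x -> lie (pole T x) (defo T k x) = 0.
Hypothesis dA : forall x k, W x ->
  pd k (pole T) x = defo T k x + lie (defo T k x) Bo.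
Hypotheses (GW : hol_GL W G) (fW : forall i, holomorphic_on W (f i)).

Let Dl x : 'M[K]_n.+1 := diag_mx (\row_i f i x).
Hypothesis GA : forall x, W x -> invmx (G x) *m pole T x *m G x = Dl x.
Hypothesis f_sep : forall x i j, W x -> i != j -> f i x != f j x.

Let Bt x : 'M[K]_n.+1 := invmx (G x) *m Bo *m G x.
Let vp k x : 'M[K]_n.+1 := invmx (G x) *m pd k G x.

Hypothesis vp_diag0 : forall k x i, W x -> vp k x i i = 0.
Variable Bd : 'M[K]_n.+1.
Hypothesis Bt_diag : forall x, W x -> diagpart (Bt x) = Bd.

Let F k x : 'M[K]_n.+1 := formal_frame (Dl x) (Bt x) k.

Let Dl_hol : holomorphic_on W Dl. Proof. exact: gauge_diag_holomorphic. Qed.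
Let Bt_hol : holomorphic_on W Bt. Proof. exact: (gauge_Bt_holomorphic Bo GW). Qed.

Let Dl_entry x i : Dl x i i = f i x. Proof. exact: diag_mx_entry. Qed.

Let Dl_sep x i j : W x -> i != j -> Dl x i i != Dl x j j.
Proof. by move=> Wx ij; rewrite !Dl_entry f_sep. Qed.

Let Dl_diag x : is_diag_mx (Dl x). Proof. exact: diag_mx_diag. Qed.

Let dDl_diag l x : W x -> is_diag_mx (pd l Dl x).
Proof. by move=> Wx; rewrite (gauge_diag_pd fW l Wx); exact: diag_mx_diag. Qed.

Let dDl_entry l x i : W x -> pd l Dl x i i = pd l (f i) x.
Proof. by move=> Wx; rewrite (gauge_diag_pd fW l Wx) diag_mx_entry. Qed.

Let Bd_diag x : W x -> is_diag_mx Bd.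
Proof. by move=> /Bt_diag <-; exact: diagpart_diag. Qed.

Let F_hol k : holomorphic_on W (F k).
Proof.
move=> x Wx; apply: differentiable_formal_frame; [exact: Dl_hol|exact: Bt_hol|].
by move=> i j; exact: Dl_sep.
Qed.

Let diag_comm (M N : 'M[K]_n.+1) : is_diag_mx M -> is_diag_mx N -> lie M N = 0.
Proof.
move=> Md Nd; apply/matrixP => i j; rewrite lie_diag_r // [RHS]mxE.
have [<-|ij] := eqVneq i j; first by rewrite subrr mulr0.
by rewrite (is_diag_mxP Md) ?mul0r.
Qed.

Let dz_eq k x : W x ->
  (Bt x + k%:R%:M) *m F k x + Dl x *m F k.+1 x = F k x *m Bd + F k.+1 x *m Dl x.
Proof.
move=> Wx; rewrite -(Bt_diag Wx).
by apply: formal_frameP; [exact: Dl_diag|move=> i j; exact: Dl_sep].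
Qed.

Let gauge_vp_comm l x : W x -> lie (vp l x) (Dl x) = lie (pd l Dl x) (Bt x).
Proof.
move=> Wx; have := gauge_dA Wo AW dA GW fW GA l Wx.
rewrite (gauge_defoE Wo AW CW AC dA GW fW GA (separated_cancel f_sep) l Wx).
exact: addrI.
Qed.

Let d_dz_eq k l x : W x ->
  pd l Bt x *m F k x + (Bt x + k%:R%:M) *m pd l (F k) x +
    (pd l Dl x *m F k.+1 x + Dl x *m pd l (F k.+1) x) =
  pd l (F k) x *m Bd + (pd l (F k.+1) x *m Dl x + F k.+1 x *m pd l Dl x).
Proof.
move=> Wx; pose v : 'rV[K]_m := delta_mx 0 l.
have dBk : differentiable (fun y => Bt y + k%:R%:M) x.
  by apply: differentiableD; [exact: Bt_hol|exact: differentiable_cst].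
have dBkE : 'D_v (fun y => Bt y + k%:R%:M) x = pd l Bt x.
  have := deriveD (diff_derivable (v := v) (Bt_hol Wx))
    (diff_derivable (v := v) (differentiable_cst (k%:R%:M : 'M[K]_n.+1) x)).
  by rewrite derive_cst addr0.
have dF j : differentiable (F j) x by exact: F_hol.
have dDx : differentiable Dl x by exact: Dl_hol.
have dBd : differentiable (cst Bd : 'rV[K]_m -> 'M[K]_n.+1) x by exact: differentiable_cst.
have E1 := deriveD (diff_derivable (v := v) (differentiable_mulmx dBk (dF k)))
  (diff_derivable (v := v) (differentiable_mulmx dDx (dF k.+1))).
have E2 := deriveD (diff_derivable (v := v) (differentiable_mulmx (dF k) dBd))
  (diff_derivable (v := v) (differentiable_mulmx (dF k.+1) dDx)).
have E3 := near_eq_derive v (near_open Wo Wx (@dz_eq k)).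
have {}E1 := etrans (esym E1) (etrans E3 E2).
rewrite (derive_mulmx v dBk (dF k)) (derive_mulmx v dDx (dF k.+1)) dBkE in E1.
rewrite (derive_mulmx v (dF k) dBd) (derive_mulmx v (dF k.+1) dDx) in E1.
by rewrite derive_cst mulmx0 addr0 in E1.
Qed.

(** The defect of the dx-equation for the series with coefficients G F_k, multiplied by G^-1. *)
Let X l k x := lie (F k.+1 x) (pd l Dl x) + vp l x *m F k x + pd l (F k) x.

Let X_rec l k x : W x ->
  (Bt x + k%:R%:M) *m X l k x + Dl x *m X l k.+1 x = X l k x *m Bd + X l k.+1 x *m Dl x.
Proof.
move=> Wx; have sc (c : K) (M : 'M[K]_n.+1) : c%:M *m M = M *m c%:M.
  by rewrite mul_scalar_mx mul_mx_scalar.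
(* Applied with Bt + k in the role of B; the scalar k drops out of the brackets and the
   derivative. *)
apply: (dx_equation_recursion (dB := pd l Bt x)).
- by apply: diag_comm => //; exact: dDl_diag.
- by apply: diag_comm; [exact: (Bd_diag Wx)|exact: dDl_diag].
- rewrite gauge_vp_comm // /lie mulmxDr mulmxDl sc opprD addrACA subrr addr0.
  by [].
- rewrite (gauge_pd_Bt Bo Wo GW l Wx) /lie mulmxDr mulmxDl sc opprD addrACA subrr addr0.
  by [].
- exact: dz_eq.
- have := @dz_eq k.+1 x Wx.
  have -> : (Bt x + k.+1%:R%:M) *m F k.+1 x = (Bt x + k%:R%:M) *m F k.+1 x + F k.+1 x.
    by rewrite -natr1 2!mulmxDl !mul_scalar_mx scalerDl scale1r addrA.
  exact.
- exact: d_dz_eq.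
Qed.

(** Off the diagonal this is [gauge_offdiag], since F_1 is Bt divided by the eigenvalue differences;
    on the diagonal it is the normalization [vp_diag0]. *)
Let X0 l x : W x -> X l 0 x = 0.
Proof.
move=> Wx; apply/matrixP => i j; rewrite [RHS]mxE.
have -> : X l 0 x = lie (F 1 x) (pd l Dl x) + vp l x.
  rewrite /X [F 0 x]/= mulmx1.
  have -> : pd l (F 0) x = 0 by exact: derive_cst.
  by rewrite addr0.
rewrite addmxE lie_diag_r ?dDl_diag // !dDl_entry //.
have [<-|ij] := eqVneq i j; first by rewrite subrr mulr0 add0r vp_diag0.
have c0 : f j x - f i x != 0 by rewrite subr_eq0 eq_sym f_sep.
have H1 : F 1 x i j * (f j x - f i x) = Bt x i j.
  have H := congr1 (fun M : 'M[K]_n.+1 => M i j) (@dz_eq 0 x Wx).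
  have {}H := etrans (esym (addmxE _ _ i j)) (etrans H (addmxE _ _ i j)).
  have e1 : ((Bt x + 0%:R%:M) *m F 0 x) i j = Bt x i j.
    rewrite [F 0 x]/= mulmx1; apply: (etrans (addmxE _ _ i j)).
    by rewrite [X in _ + X]mxE mulr0n mul0rn addr0.
  have e2 : (F 0 x *m Bd) i j = 0.
    by rewrite [F 0 x]/= mul1mx (is_diag_mxP (Bd_diag Wx)).
  have e3 := mulmx_diag_l (F 1 x) i j (Dl_diag x).
  have e4 := mulmx_diag_r (F 1 x) i j (Dl_diag x).
  have {}H := etrans (esym (congr2 +%R e1 e3)) (etrans H (congr2 +%R e2 e4)).
  move: H; rewrite !Dl_entry add0r mulrBr => <-.
  by rewrite [f i x * _]mulrC addrK.
have H2 := gauge_offdiag Wo AW CW AC dA GW fW GA (separated_cancel f_sep) l Wx ij.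
apply: (mulIf c0); rewrite mul0r mulrDl.
have -> : F 1 x i j * (pd l (f j) x - pd l (f i) x) * (f j x - f i x) =
    F 1 x i j * (f j x - f i x) * (pd l (f j) x - pd l (f i) x) by exact: mulrAC.
rewrite H1; apply: (etrans (congr1 (fun u => _ + u) H2)).
have alg (a b c : K) : c * (a - b) + (b - a) * c = 0 by ring.
exact: alg.
Qed.

(** If X_k = 0, the recursion makes X_(k+1) commute with D, hence diagonal. The diagonal of the next
    recursion then reads (k + 1) X_(k+1) = 0. *)
Let dx_eq l k x : W x -> X l k x = 0.
Proof.
move=> Wx; elim: k => [|k IH]; first exact: X0.
have Xd : is_diag_mx (X l k.+1 x).
  apply/is_diag_mxP => i j; rewrite neq_ltn => ij'.
  have ij : i != j by rewrite neq_ltn.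
  have := @X_rec l k x Wx; rewrite IH mulmx0 mul0mx !add0r => /matrixP/(_ i j).
  rewrite mulmx_diag_l ?mulmx_diag_r ?Dl_diag // mulrC => /eqP.
  rewrite -subr_eq0 -mulrBr mulf_eq0 subr_eq0 (negbTE (Dl_sep Wx ij)) orbF.
  by move/eqP.
apply/matrixP => i j; rewrite [RHS]mxE.
have [<-|ij] := eqVneq i j; last by rewrite (is_diag_mxP Xd).
have H := congr1 (fun M : 'M[K]_n.+1 => M i i) (@X_rec l k.+1 x Wx).
have {}H := etrans (esym (addmxE _ _ i i)) (etrans H (addmxE _ _ i i)).
have e1 := mulmx_diag_r (Bt x + k.+1%:R%:M) i i Xd.
have e2 := mulmx_diag_r (X l k.+1 x) i i (Bd_diag Wx).
have e3 := mulmx_diag_l (X l k.+2 x) i i (Dl_diag x).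
have e4 := mulmx_diag_r (X l k.+2 x) i i (Dl_diag x).
have {}H := etrans (esym (congr2 +%R e1 e3)) (etrans H (congr2 +%R e2 e4)).
have e5 : (Bt x + k.+1%:R%:M) i i = Bd i i + k.+1%:R.
  by apply: (etrans (addmxE _ _ i i)); rewrite -(Bt_diag Wx) diagpart_entry [X in _ + X]mxE eqxx.
have {}H := etrans (congr1 (fun u => u * _ + _) (esym e5)) H.
have alg (b c u v w : K) : (b + c) * u + w * v = u * b + v * w -> c * u = 0.
  move=> E; have -> : c * u = (b + c) * u + w * v - (u * b + v * w) by ring.
  by rewrite E subrr.
have k0 : (k.+1%:R : K) != 0 by rewrite pnatr_eq0.
exact: (mulfI k0 (etrans (alg _ _ _ _ _ H) (esym (mulr0 _)))).
Qed.

Let Phi k x := G x *m F k x.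

Lemma normal_gauge_I_fs Ao : I_all Ao Bo T -> W (base T) -> I_fs Ao Bo T.
Proof.
move=> TI WT; split; first exact: TI.
have Gh x : W x -> differentiable G x by exact: GW.1.
have Phi0 x : Phi 0 x = G x by rewrite /Phi [F 0 x]/= mulmx1.
exists W, Phi, Dl, Bd; split.
- by [].
- split=> [k x Wx|x Wx]; first by apply: differentiable_mulmx; [exact: Gh|exact: F_hol].
  by rewrite Phi0; exact: GW.2.
- by split; [exact: Dl_hol|move=> x _; exact: Dl_diag].
- exact: (Bd_diag WT).
move=> x Wx phi; have AG := mul_gauge_diag GW GA Wx.
have CG l := mul_gauge_defo Wo AW CW AC dA GW fW GA f_sep l Wx.
have BG := mul_gauge_Bt Bo GW Wx; have vG l := mul_gauge_vp GW l Wx.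
have [|psi [psiphi phipsi]] := @inverse_exists K n phi.
  by rewrite /phi Phi0; exact: GW.2.
(* Multiplication by phi on the left removes the inverse series from both gauge equations. *)
have key (a da b : nat -> 'M[K]_n.+1) :
    (forall k, fmul a phi k + da k = fmul phi b k) ->
    forall k, fmul (fmul psi a) phi k + fmul psi da k = b k.
  move=> H k; rewrite -fmulA -fmulDr (eq_fmul (fun=> erefl) H) fmulA.
  by rewrite (eq_fmul psiphi (fun=> erefl)) fmul1.
exists psi; split; [exact: psiphi|exact: phipsi| |].
- apply: key => k; rewrite fmul_fdz_coef fmul_fdz_coefr.
  case: k => [|[|k]]; first by rewrite /= addr0.
    by rewrite /= addr0 /phi Phi0 AG.
  have alg (P A B D B1 E0 E1 B' : 'M[K]_n.+1) : A *m P = P *m D -> B *m P = P *m B1 ->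
      (B1 + k%:R%:M) *m E0 + D *m E1 = E0 *m B' + E1 *m D ->
      - (A *m (P *m E1)) - B *m (P *m E0) + - (P *m E0 *+ k) =
      - (P *m E1 *m D) - P *m E0 *m B'.
    move=> AP BP; rewrite mulmxDl mul_scalar_mx => /(congr1 (mulmx P)).
    rewrite !mulmxDr -scalemxAr scaler_nat !mulmxA AP BP => E.
    rewrite -!opprD; congr (- _); rewrite [RHS]addrC -E.
    by rewrite -addrA addrC.
  exact: (alg _ _ _ _ _ _ _ _ AG (esym BG) (@dz_eq k x Wx)).
- move=> l; apply: key => k; rewrite fmul_fdx_coef fmul_fdx_coefr.
  case: k => [|k]; first by rewrite /= addr0 /phi Phi0 CG.
  have E : pd l (Phi k) x = pd l G x *m F k x + G x *m pd l (F k) x.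
    exact: (derive_mulmx (delta_mx 0 l) (Gh x Wx) (F_hol k Wx)).
  have alg (P C D dP V E0 E1 dE0 : 'M[K]_n.+1) : C *m P = P *m D -> P *m V = dP ->
      lie E1 D + V *m E0 + dE0 = 0 ->
      - (C *m (P *m E1)) + (dP *m E0 + P *m dE0) = - (P *m E1 *m D).
    move=> CP <- /(congr1 (mulmx P)); rewrite mulmx0 /lie !mulmxDr mulmxN !mulmxA CP => H.
    by apply/eqP; rewrite -subr_eq0 opprK -H; apply/eqP; rewrite addrC !addrA.
  rewrite /= E; exact: (alg _ _ _ _ _ _ _ _ (CG l) (vG l) (@dx_eq l k x Wx)).
Qed.

End NormalGauge.

(** The minimal polynomial of a diagonalizable matrix is the product over its distinct eigenvalues;
    regularity gives it full degree, so no eigenvalue repeats. *)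
Lemma regular_diagonalizable_spectrum (K : numFieldType) (n : nat) (A : 'M[K]_n.+1) :
  regular_mx A -> diagonalizable A ->
  exists (lam : 'I_n.+1 -> K) (G0 : 'M[K]_n.+1),
    [/\ injective lam, G0 \in unitmx, A *m G0 = G0 *m diag_mx (\row_i lam i) &
        char_poly A = \prod_i ('X - (lam i)%:P)].
Proof.
move=> Areg [P Pu Pd]; have minE := diagonalizable_for_mxminpoly Pu Pd.
pose D := mxpoly.conjmx P A.
have us : uniq [seq D i i | i <- enum 'I_n.+1].
  have := congr1 (fun p : {poly K} => size p) minE.
  rewrite Areg size_char_poly size_prod_XsubC => -[sz].
  by rewrite -[uniq _]negbK -ltn_size_undup -sz size_map size_enum_ord ltnn.
exists (fun i => D i i), (invmx P); split.
- by apply/injectiveP.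
- by rewrite unitmx_inv.
- have -> : diag_mx (\row_i D i i) = D.
    apply/matrixP => i j; have [<-|ij] := eqVneq i j; first exact: diag_mx_entry.
    by rewrite (is_diag_mxP Pd) // (is_diag_mxP (diag_mx_diag _)).
  by rewrite /D mxpoly.conjumx // !mulmxA mulVmx // mul1mx.
- by rewrite -Areg minE undup_id // big_map big_enum.
Qed.

Definition has_form_exponentials (K : numFieldType) : Prop :=
  forall (m : nat) (U : set 'rV[K]_m) x0 (w : 'I_m -> 'rV[K]_m -> K),
    open U -> U x0 -> (forall k, holomorphic_on U (w k)) ->
    (forall x k l, U x -> pd k (w l) x = pd l (w k) x) ->
    exists (W : set 'rV[K]_m) (E : 'rV[K]_m -> K),
      [/\ open W, W x0, W `<=` U &
          forall x, W x -> [/\ differentiable E x, E x != 0 &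
            forall k, pd k E x = w k x * E x]].

Definition has_local_constancy (K : numFieldType) : Prop :=
  forall (m : nat) (U : set 'rV[K]_m) x0 (h : 'rV[K]_m -> K),
    open U -> U x0 -> holomorphic_on U h -> (forall k x, U x -> pd k h x = 0) ->
    exists W : set 'rV[K]_m, [/\ open W, W x0, W `<=` U & forall x, W x -> h x = h x0].

(** * Normalization of the frame and the regular case *)

Section GaugeNormalization.
Context {K : numFieldType} {m n : nat}.
Hypothesis K_smooth : smooth_field K.
Hypothesis K_exp : has_form_exponentials K.

Lemma near_intersection (I : finType) (W : I -> set 'rV[K]_m) x0 :
  (forall i, open (W i)) -> (forall i, W i x0) ->
  \forall x \near x0, forall i, W i x.
Proof.
move=> Wo Wx0.
have H i : \forall x \near x0, W i x by apply: open_nbhs_nbhs; split.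
exact: (@filter_forall _ I (fun i x => W i x) _ _ H).
Qed.

(** Rescaling column i by E_i preserves the diagonal form of A and adds d log E_i to the i-th
    diagonal entry of G^-1 dG, so E_i is taken with logarithmic differential minus that entry. *)
Lemma diagonal_gauge_normalization (U : set 'rV[K]_m) x0 (G A : 'rV[K]_m -> 'M[K]_n)
    (f : 'I_n -> 'rV[K]_m -> K) :
  open U -> U x0 -> hol_GL U G ->
  (forall x, U x -> invmx (G x) *m A x *m G x = diag_mx (\row_i f i x)) ->
  (forall x k l i, U x -> pd k (fun y => (invmx (G y) *m pd l G y) i i) x =
     pd l (fun y => (invmx (G y) *m pd k G y) i i) x) ->
  exists (W : set 'rV[K]_m) (P : 'rV[K]_m -> 'M[K]_n),
    [/\ open W /\ W x0, W `<=` U, hol_GL W P,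
        forall x, W x -> invmx (P x) *m A x *m P x = diag_mx (\row_i f i x) &
        forall k x i, W x -> (invmx (P x) *m pd k P x) i i = 0].
Proof.
move=> Uo Ux0 GU GA Gflat; have Gh : holomorphic_on U G by exact: GU.1.
pose vp k x := invmx (G x) *m pd k G x.
have vph k i : holomorphic_on U (fun x => vp k x i i).
  by move=> x Ux; exact: ((diff_mxP _ _).1 (gauge_vp_holomorphic K_smooth Uo GU k Ux)).
have /choice[WE WEP] : forall i, exists WE : set 'rV[K]_m * ('rV[K]_m -> K),
    [/\ open WE.1, WE.1 x0, WE.1 `<=` U &
        forall x, WE.1 x -> [/\ differentiable WE.2 x, WE.2 x != 0 &
          forall k, pd k WE.2 x = - vp k x i i * WE.2 x]].
  move=> i; have [||W [E WEP]] := K_exp (w := fun k x => - vp k x i i) Uo Ux0.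
  - by move=> k x Ux; apply: differentiableN; exact: vph.
  - move=> x k l Ux.
    have dN a : differentiable (fun y => vp a y i i) x by exact: vph.
    apply: (etrans (deriveN (diff_derivable (dN l)))).
    apply: (etrans _ (esym (deriveN (diff_derivable (dN k))))).
    exact: (congr1 (fun u => - u) (Gflat x k l i Ux)).
  by exists (W, E).
have W1o i : open (WE i).1 by have [] := WEP i.
have W1x i : (WE i).1 x0 by have [] := WEP i.
have near_x0 : \forall x \near x0, U x /\ forall i, (WE i).1 x.
  by apply: filterI; [exact: (near_open Uo Ux0)|exact: near_intersection].
have [W [Wo Wx0 WP]] := open_of_near near_x0.
pose E i := (WE i).2.
have EP x i : W x -> [/\ differentiable (E i) x, E i x != 0 &
    forall k, pd k (E i) x = - vp k x i i * E i x].
  by move=> /WP[_ /(_ i) W1]; have [_ _ _ H] := WEP i; exact: H.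
have EW i : holomorphic_on W (E i) by move=> x Wx; have [] := EP x i Wx.
have E0 x i : W x -> E i x != 0 by move=> Wx; have [] := EP x i Wx.
pose D x : 'M[K]_n := diag_mx (\row_i E i x).
pose Di x : 'M[K]_n := diag_mx (\row_i (E i x)^-1).
have Dd x : is_diag_mx (D x) by exact: diag_mx_diag.
have Did x : is_diag_mx (Di x) by exact: diag_mx_diag.
have De x i : D x i i = E i x by exact: diag_mx_entry.
have Die x i : Di x i i = (E i x)^-1 by exact: diag_mx_entry.
have DDi x : W x -> D x *m Di x = 1%:M.
  move=> Wx; apply/matrixP => i j; rewrite mulmx_diag_r // [RHS]mxE Die.
  have [<-|ij] := eqVneq i j; first by rewrite De divff // E0.
  by rewrite (is_diag_mxP (Dd x)) // mul0r.
have Du x : W x -> D x \in unitmx by move=> /DDi/mulmx1_unit[].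
have Dh : holomorphic_on W D by exact: gauge_diag_holomorphic.
pose P x := G x *m D x.
have WU x : W x -> U x by move=> /WP[].
have Gu x : W x -> G x \in unitmx by move=> /WU; exact: GU.2.
have Pu x : W x -> P x \in unitmx by move=> Wx; rewrite unitmx_mul Gu // Du.
have Ph : holomorphic_on W P.
  by move=> x Wx; apply: differentiable_mulmx; [exact: (Gh x (WU x Wx))|exact: Dh].
have left_cancel x (M N : 'M[K]_n) : W x -> P x *m M = N -> invmx (P x) *m N = M.
  by move=> Wx <-; rewrite mulmxA mulVmx ?mul1mx // Pu.
exists W, P; split => //.
- move=> x Wx; rewrite -mulmxA; apply: left_cancel => //.
  have AG : A x *m G x = G x *m diag_mx (\row_i f i x).
    by rewrite -(GA x (WU x Wx)) !mulmxA mulmxV ?mul1mx // Gu.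
  rewrite /P [RHS]mulmxA AG -!mulmxA; congr (_ *m _); apply/matrixP => i j.
  rewrite mulmx_diag_r ?diag_mx_diag // [RHS]mulmx_diag_r // diag_mx_entry De.
  have [<-|ij] := eqVneq i j; first by rewrite De diag_mx_entry mulrC.
  by rewrite !(is_diag_mxP (diag_mx_diag _)) // !mul0r.
- move=> k x i Wx.
  have -> : invmx (P x) *m pd k P x = Di x *m (vp k x *m D x) + Di x *m pd k D x.
    apply: left_cancel => //.
    have -> : pd k P x = pd k G x *m D x + G x *m pd k D x.
      exact: (derive_mulmx (delta_mx 0 k) (Gh x (WU x Wx)) (Dh x Wx)).
    have PDi M : P x *m (Di x *m M) = G x *m M.
      by rewrite /P mulmxA -(mulmxA (G x)) DDi // mulmx1.
    by rewrite mulmxDr !PDi (mulmxA (G x)) /vp (mulmxA (G x)) mulmxV ?mul1mx // Gu.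
  have dDd : is_diag_mx (pd k D x).
    by rewrite (gauge_diag_pd EW k Wx); exact: diag_mx_diag.
  have dDe : pd k D x i i = pd k (E i) x.
    by rewrite (gauge_diag_pd EW k Wx); exact: diag_mx_entry.
  apply: (etrans (addmxE _ _ i i)); have [_ _ dE] := EP x i Wx.
  apply: (etrans (congr2 +%R (mulmx_diag_l _ i i (Did x)) (mulmx_diag_l _ i i (Did x)))).
  apply: (etrans (congr1 (fun u => _ * u + _) (mulmx_diag_r _ i i (Dd x)))).
  rewrite dDe dE De.
  have alg (a b c : K) : a * (b * c) + a * (- b * c) = 0 by ring.
  exact: alg.
Qed.

End GaugeNormalization.

Section RegularType.
Context {K : numFieldType} {m n : nat}.
Hypothesis K_smooth : smooth_field K.
Hypothesis K_split : forall p : {poly K}, p \is monic ->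
  exists rs, p = \prod_(z <- rs) ('X - z%:P).
Hypothesis K_exp : has_form_exponentials K.
Hypothesis K_cst : has_local_constancy K.

Lemma I_all_sub_fs (Ao Bo : 'M[K]_n.+1) (T : deformation K m n.+1) :
  regular_mx Ao -> diagonalizable Ao -> I_all Ao Bo T -> I_fs Ao Bo T.
Proof.
move=> Areg Adiag TI; have [TA [U [Uo UT AU CU TU]]] := TI.
have [lam [G0 [lamI G0u AG0 Alam]]] := regular_diagonalizable_spectrum Areg Adiag.
rewrite -TA in AG0 Alam.
have [W [f [G [[Wo WT] WU fW GW GA]]]] :=
  simple_spectrum_diagonalization K_split Uo UT AU lamI G0u AG0 Alam.
have AC x k : U x -> lie (pole T x) (defo T k x) = 0 by move=> /TU[].
have dA x k : U x -> pd k (pole T) x = defo T k x + lie (defo T k x) Bo by move=> /TU[].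
have f_sep x i j : W x -> i != j -> f i x != f j x by move=> Wx; exact: (GA x Wx).2.
have GA1 x : W x -> invmx (G x) *m pole T x *m G x = diag_mx (\row_i f i x).
  by move=> Wx; exact: (GA x Wx).1.
have AW : holomorphic_on W (pole T) by move=> x /WU; exact: AU.
have CW k : holomorphic_on W (defo T k) by move=> x /WU; exact: CU.
have ACW x k : W x -> lie (pole T x) (defo T k x) = 0 by move=> /WU; exact: AC.
have dAW x k : W x -> pd k (pole T) x = defo T k x + lie (defo T k x) Bo.
  by move=> /WU; exact: dA.
have flat x k l i : W x -> pd k (fun y => (invmx (G y) *m pd l G y) i i) x =
    pd l (fun y => (invmx (G y) *m pd k G y) i i) x.
  by move=> Wx; exact: (pd_gauge_vp_diag K_smooth Wo AW CW ACW dAW GW fW GA1 f_sep).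
have [W1 [P [[W1o W1T] W1W PW1 PA Pvp]]] :=
  diagonal_gauge_normalization K_smooth K_exp Wo WT GW GA1 flat.
have AW1 : holomorphic_on W1 (pole T) by move=> x /W1W; exact: AW.
have CW1 k : holomorphic_on W1 (defo T k) by move=> x /W1W; exact: CW.
have ACW1 x k : W1 x -> lie (pole T x) (defo T k x) = 0 by move=> /W1W; exact: ACW.
have dAW1 x k : W1 x -> pd k (pole T) x = defo T k x + lie (defo T k x) Bo.
  by move=> /W1W; exact: dAW.
have fW1 i : holomorphic_on W1 (f i) by move=> x /W1W; exact: fW.
have f_sep1 x i j : W1 x -> i != j -> f i x != f j x by move=> /W1W; exact: f_sep.
pose Bt x := invmx (P x) *m Bo *m P x.
have Bth i : holomorphic_on W1 (fun x => Bt x i i).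
  by move=> x W1x; exact: ((diff_mxP _ _).1 (gauge_Bt_holomorphic Bo PW1 W1x)).
have Bt0 i k x : W1 x -> pd k (fun y => Bt y i i) x = 0.
  exact: (pd_gauge_Bt_diag W1o AW1 CW1 ACW1 dAW1 PW1 fW1 PA f_sep1).
(* Fs-type requires a constant exponent matrix, here the diagonal of P^-1 B_o P at the base
   point. *)
have /choice[W2 W2P] : forall i, exists V : set 'rV[K]_m,
    [/\ open V, V (base T), V `<=` W1 & forall x, V x -> Bt x i i = Bt (base T) i i].
  by move=> i; exact: (K_cst W1o W1T (@Bth i) (@Bt0 i)).
have W2o i : open (W2 i) by have [] := W2P i.
have W2T i : W2 i (base T) by have [] := W2P i.
have near_T : \forall x \near base T, W1 x /\ forall i, W2 i x.
  by apply: filterI; [exact: (near_open W1o W1T)|exact: near_intersection].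
have [Z [Zo ZT ZP]] := open_of_near near_T.
have ZW x : Z x -> W1 x by move=> /ZP[].
have Bt_diag x : Z x -> diagpart (Bt x) = diagpart (Bt (base T)).
  move=> /ZP[_ Zx]; congr diag_mx; apply/rowP => i; rewrite [LHS]mxE [RHS]mxE.
  by have [_ _ _ H] := W2P i; exact: H.
have AZ : holomorphic_on Z (pole T) by move=> x /ZW; exact: AW1.
have CZ k : holomorphic_on Z (defo T k) by move=> x /ZW; exact: CW1.
have ACZ x k : Z x -> lie (pole T x) (defo T k x) = 0 by move=> /ZW; exact: ACW1.
have dAZ x k : Z x -> pd k (pole T) x = defo T k x + lie (defo T k x) Bo.
  by move=> /ZW; exact: dAW1.
have PZ : hol_GL Z P by split=> x /ZW; [exact: PW1.1|exact: PW1.2].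
have fZ i : holomorphic_on Z (f i) by move=> x /ZW; exact: fW1.
have PAZ x : Z x -> invmx (P x) *m pole T x *m P x = diag_mx (\row_i f i x).
  by move=> /ZW; exact: PA.
have f_sepZ x i j : Z x -> i != j -> f i x != f j x by move=> /ZW; exact: f_sep1.
have PvpZ k x i : Z x -> (invmx (P x) *m pd k P x) i i = 0 by move=> /ZW; exact: Pvp.
exact: (normal_gauge_I_fs Zo AZ CZ ACZ dAZ PZ fZ PAZ f_sepZ PvpZ Bt_diag TI ZT).
Qed.

End RegularType.

Section ComplexField.
Context {R : realType}.

Lemma KK_local_constancy : has_local_constancy (KK R).
Proof.
move=> m U x0 h Uo Ux0 hU dh; have [r r0 rU] := open_nvP Uo Ux0.
exists [set y | nv (y - x0) < r]; split.
- exact: nv_open.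
- by rewrite /= subrr nv0.
- by move=> y; exact: rU.
move=> y /= yr; apply/eqP; rewrite -subr_eq0 -nm0_eq0.
pose u := y - x0.
have seg (t : R) : 0 <= t <= 1 -> U (t%:C%C *: u + x0).
  move=> /andP[t0 t1]; apply: rU; rewrite addrK nvZ nm_real ger0_norm //.
  by rewrite (le_lt_trans _ yr) // ler_piMl // nv_ge0.
have hy := @mean_value_bound R _ h x0 u 0.
have -> : y = u + x0 by rewrite subrK.
rewrite eq_le nm_ge0 andbT; apply: hy => t /seg Ut.
  exact: diff_derivable (hU _ Ut).
rewrite derive_coord; last exact: hU.
by rewrite big1 ?nm0 // => k _; rewrite dh // mulr0.
Qed.

Lemma KK_split (p : {poly KK R}) : p \is monic ->
  exists rs, p = \prod_(z <- rs) ('X - z%:P).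
Proof.
move=> pm; have [rs E] := @closed_field_poly_normal R[i]%C p.
by exists rs; move: E; rewrite (monicP pm) scale1r.
Qed.

End ComplexField.

Theorem theorem4p22 (R : realType) (n : nat) (Ao Bo : 'M[R[i]%C]_n.+1) :
  [/\ [/\ closed_under_base_change (fun m => @I_d _ m _ Ao Bo),
          closed_under_base_change (fun m => @I_dv _ m _ Ao Bo) &
          closed_under_base_change (fun m => @I_fs _ m _ Ao Bo)],
      (forall m : nat,
        [/\ @I_fs _ m _ Ao Bo `<=` @I_dv _ m _ Ao Bo,
            @I_d_gen _ m _ Ao Bo `<=` @I_dv _ m _ Ao Bo,
            @I_dv _ m _ Ao Bo `<=` @I_d _ m _ Ao Bo &
            @I_d _ m _ Ao Bo `<=` @I_all _ m _ Ao Bo]) &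
      (regular_mx Ao -> diagonalizable Ao ->
       forall m : nat,
        [/\ @I_fs _ m _ Ao Bo = @I_dv _ m _ Ao Bo,
            @I_dv _ m _ Ao Bo = @I_d _ m _ Ao Bo &
            @I_d _ m _ Ao Bo = @I_all _ m _ Ao Bo])].
Proof.
pose sm := @KK_smooth R.
split.
- split.
  + exact: (@I_d_base_change (KK R) n.+1 sm Ao Bo).
  + exact: (@I_dv_base_change (KK R) n.+1 sm Ao Bo).
  + exact: (@I_fs_base_change (KK R) n.+1 sm Ao Bo).
- move=> m; split.
  + move=> T; exact: (@I_fs_sub_dv (KK R) m n.+1 sm Ao Bo T).
  + move=> T; exact: (@I_d_gen_sub_dv (KK R) m n.+1 sm Ao Bo T).
  + by move=> T [].
  + by move=> T [].
- move=> Areg Adiag m.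
  have fs_dv T : @I_fs _ m _ Ao Bo T -> @I_dv _ m _ Ao Bo T.
    exact: (@I_fs_sub_dv (KK R) m n.+1 sm Ao Bo T).
  have dv_d T : @I_dv _ m _ Ao Bo T -> @I_d _ m _ Ao Bo T by case.
  have d_all T : @I_d _ m _ Ao Bo T -> @I_all _ m _ Ao Bo T by case.
  (* This closes the cycle of inclusions, from which all the equalities follow. *)
  have all_fs T : @I_all _ m _ Ao Bo T -> @I_fs _ m _ Ao Bo T.
    exact: (@I_all_sub_fs (KK R) m n sm (@KK_split R) (@closed_form_exponential R)
      (@KK_local_constancy R) Ao Bo T Areg Adiag).
  split; rewrite eqEsubset; split=> T TI.
  + exact: fs_dv.
  + by apply: all_fs; apply: d_all; exact: dv_d.
  + exact: dv_d.
  + by apply: fs_dv; apply: all_fs; exact: d_all.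
  + exact: d_all.
  + by apply: dv_d; apply: fs_dv; exact: all_fs.
Qed.
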